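(* For $d\ge 2$, the links of $(d-2)$-cells in the geodesic $r$-power of an $\widetilde A$-complex of dimension $d$ (of density $q$) are either complete bipartite graphs, or expanders with (adjacency) spectrum $$\left\{\pm(q+1)q^{r-1},\ \pm\sqrt{q^{2r-1}},\ \pm\sqrt{q^{2r-2}},\ \ldots,\ \pm\sqrt{q^{r+1}},\ \pm\sqrt{q^{r}}\right\}.$$ Consequently, geodesic powers of $\widetilde A$-complexes are high-dimensional expanders.
   Context: Simplicial complexes. $X(j)$ denotes the cells of dimension $j$ (size $j+1$); a complex is pure of dimension $d$ if every cell lies in a $d$-cell. The link $X_\tau$ of a cell $\tau$ is obtained by taking all cells containing $\tau$ and removing $\tau$ from them; $X_\emptyset=X$. For $\tau\in X(i)$, $-1\le i\le d-2$, $\mu_\tau$ is the second largest eigenvalue of the normalized adjacency operator of the one-skeleton of $X_\tau$. A pure $d$-dimensional complex is a $\lambda$-high dimensional expander if $\mu_\tau\le\lambda$ for every $-1\le i\le d-2$ and every $\tau\in X(i)$; informally, a high-dimensional expander is a complex whose links are good expanders. A $k$-regular graph is called an expander if the nontrivial eigenvalues of its adjacency matrix (those other than $\pm k$) are of small magnitude in comparison with $k$. Buildings and $\widetilde A$-complexes. Let $F$ be a non-archimedean local field with ring of integers $\mathcal O$, uniformizer $\pi$ and residue field $\mathcal O/\pi\mathcal O\cong\mathbb F_q$. The building $\mathcal B_n(F)$ is the $(n-1)$-dimensional clique complex whose vertices are the homothety classes of $\mathcal O$-lattices in $F^n$ (identified with $PGL_n(F)/PGL_n(\mathcal O)$, where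 $K=PGL_n(\mathcal O)$, via $gK\mapsto g\mathcal O^n$), two distinct classes being adjacent iff they have representatives $L,L'$ with $\pi L<L'<L$. Vertices are colored by $\mathrm{col}(gK)=\mathrm{ord}_\pi\det g\in\mathbb Z/n\mathbb Z$ and directed edges by $\mathrm{col}(v\to w)=\mathrm{col}(w)-\mathrm{col}(v)$, a nonzero element of $\mathbb Z/n\mathbb Z$. An $\widetilde A_{n-1}$-complex of density $q$ is a quotient $X=\Gamma\backslash\mathcal B_n(F)$ by a cocompact lattice $\Gamma\le PGL_n(F)$ acting on $\mathcal B_n(F)$ without fixed points; it is a finite simplicial complex of dimension $n-1$ with fundamental group $\Gamma$, and it inherits the coloring of directed edges. An $\widetilde A$-complex of dimension $d$ is an $\widetilde A_d$-complex. Geodesics and powers. In such a complex $X$, an $r$-geodesic (of color one) is a sequence of vertices $v_0,\dots,v_r$ such that $\{v_i,v_{i+1}\}\in X(1)$, $v_{i+2}\ne v_i$, $\{v_i,v_{i+1},v_{i+2}\}\notin X(2)$, and $\mathrm{col}(v_i\to v_{i+1})=1$ for all relevant $i$. The geodesic $r$-power of a $d$-dimensional such complex $X$ has the same vertices as $X$; $d+1$ distinct vertices $v_0,\dots,v_d$ form a $d$-cell iff, possibly after reordering, there is an $r$-geodesic from each $v_i$ to $v_{i+1}$ ($0\le i<d$) and from $v_d$ to $v_0$; the lower-dimensional cells are the subcells of the $d$-cells.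
   Formalization: Assumes every nontrivial element of Γ moves each building vertex by more than (d+1)r (for fixed X and large r the claim fails); ''high-dimensional expander'' means some λ<1 depending only on d, q, r, for the power if connected, otherwise for each connected component. *)

(* Defs.v *)
From HB Require Import structures.
From mathcomp Require Import all_boot all_order all_algebra.
From mathcomp Require Import boolp classical_sets cardinality reals.
Set Implicit Arguments.
Unset Strict Implicit.
Unset Printing Implicit Defensive.
Import Order.TTheory GRing.Theory Num.Theory.
Local Open Scope ring_scope.

(** * Finite simplicial complexes *)

(* A complex on a finite vertex type V is the set of all its cells, including
   the empty cell; X(j) consists of the cells with j + 1 elements. *)

Section Complexes.
Variable V : finType.
Implicit Types (X : {set {set V}}) (s t : {set V}).

Definition faces X (j : nat) : {set {set V}} := [set s in X | #|s| == j.+1].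

Definition link X t : {set {set V}} := [set s :\: t | s in X & t \subset s].

Definition pure_complex (d : nat) X : Prop :=
  (forall s t, s \in X -> t \subset s -> t \in X) /\
  (forall t, t \in X -> exists2 s, s \in faces X d & t \subset s).

Definition verts X : {set V} := [set x | [set x] \in X].

Definition skel X : rel V := [rel x y | (x != y) && ([set x; y] \in X)].

Definition skel_deg X (x : V) : nat := #|[set y | skel X x y]|.

Definition skel_connected X : Prop :=
  {in verts X &, forall x y, connect (skel X) x y}.

(* The subcomplex on the connected component of x. A geodesic r-power can be
   disconnected when r and d + 1 are not coprime: its edges change the color by
   multiples of r. *)
Definition component X (x : V) : {set {set V}} :=
  [set s in X | s \subset [set y | connect (skel X) x y]].

Definition complete_bipartite X : Prop :=
  exists A B : {set V},
    [/\ A != finset.set0, B != finset.set0, [disjoint A & B], A :|: B = verts X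
      & forall x y, skel X x y =
          (x \in A) && (y \in B) || (x \in B) && (y \in A)].

Definition skel_regular (k : nat) X : Prop :=
  {in verts X, forall x, skel_deg X x = k}.

Section Spectra.
Variable R : realType.

Definition adj_mx X : 'M[R]_#|verts X| :=
  \matrix_(i, j) (skel X (enum_val i) (enum_val j))%:R.

(* The normalized adjacency operator f |-> (x |-> mean of f over the
   neighbours of x). *)
Definition nadj_mx X : 'M[R]_#|verts X| :=
  \matrix_(i, j) ((skel X (enum_val i) (enum_val j))%:R
                  / (skel_deg X (enum_val i))%:R).

(* k-regular, with every eigenvalue other than k and -k of magnitude at most
   eps * k. *)
Definition expander (k : nat) (eps : R) X : Prop :=
  skel_regular k X /\
  (forall a, eigenvalue (adj_mx X) a -> a != k%:R -> a != - k%:R ->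
     `|a| <= eps * k%:R).

(* mu is the second largest eigenvalue of A, counted with multiplicity; in
   particular all eigenvalues of A are real. *)
Definition second_eigenvalue (n : nat) (A : 'M[R]_n) (mu : R) : Prop :=
  exists s : seq R,
    [/\ sorted >=%R s, char_poly A = \prod_(a <- s) ('X - a%:P),
        (1 < size s)%N & mu = s`_1].

(* The cells of dimension -1 <= i <= d - 2 are those with less than d
   elements; the empty cell has link X. *)
Definition high_dim_expander (d : nat) (lam : R) X : Prop :=
  pure_complex d X /\
  (forall t, t \in X -> (#|t| < d)%N ->
     exists2 mu, second_eigenvalue (nadj_mx (link X t)) mu & mu <= lam).

End Spectra.
End Complexes.

(** * Non-archimedean local fields *)

(* k <= ord x, with the convention ord 0 = +oo *)
Definition ordge (F : fieldType) (ord : F -> int) (k : int) (x : F) : bool :=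
  (x == 0) || (k <= ord x).

(* A field complete with respect to a normalized discrete valuation, with
   finite residue field. The value of ord at 0 is irrelevant; res is the
   reduction from the ring of integers onto the residue field, and its values
   at non-integral elements are irrelevant. *)
Record localField := LocalField {
  lf_sort :> fieldType;
  ord : lf_sort -> int;
  unif : lf_sort;
  residue : finFieldType;
  res : lf_sort -> residue;
  ordM : forall x y, x != 0 -> y != 0 -> ord (x * y) = ord x + ord y;
  ordD : forall x y, x != 0 -> y != 0 -> x + y != 0 ->
    Num.min (ord x) (ord y) <= ord (x + y);
  unif_neq0 : unif != 0;
  ord_unif : ord unif = 1;
  lf_complete : forall u : nat -> lf_sort,
    (forall k : int, exists N : nat, forall i j : nat,
       (N <= i)%N -> (N <= j)%N -> ordge ord k (u i - u j)) ->
    exists l, forall k : int, exists N : nat, forall i : nat,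
       (N <= i)%N -> ordge ord k (u i - l);
  res1 : res 1 = 1;
  resD : forall x y, ordge ord 0 x -> ordge ord 0 y ->
    res (x + y) = res x + res y;
  resM : forall x y, ordge ord 0 x -> ordge ord 0 y ->
    res (x * y) = res x * res y;
  res_surj : forall a, exists2 x, ordge ord 0 x & res x = a;
  res_eq0 : forall x, ordge ord 0 x -> (res x == 0) = ordge ord 1 x
}.

Arguments ord {l}.
Arguments unif {l}.

(** * The building of PGL_n(F) *)

Section Building.
Variables (F : localField) (n : nat).

Definition GL := {g : 'M[F]_n | g \in unitmx}.

(* the lattice g O^n *)
Definition latt (g : 'M[F]_n) : set 'cV[F]_n :=
  [set x | exists2 y : 'cV[F]_n,
     forall i, ordge ord 0 (y i ord0) & x = g *m y]%classic.

(* A vertex is represented by g in GL_n(F), standing for the homothety class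
   of g O^n; g and h represent the same vertex iff [same_vertex g h]. *)
Definition same_vertex (g h : 'M[F]_n) : Prop :=
  exists2 c : F, c != 0 & latt g = latt (c *: h).

Definition adjacent (g h : 'M[F]_n) : Prop :=
  exists a b : F, [/\ a != 0, b != 0,
    (latt (unif *: (a *: g)) `<` latt (b *: h))%classic
    & (latt (b *: h) `<` latt (a *: g))%classic].

(* The color is the class of this integer modulo n. *)
Definition color (g : 'M[F]_n) : int := ord (\det g).

Definition mxge (k : nat) (A : 'M[F]_n) : Prop :=
  forall i j, ordge ord k%:Z (A i j).

(* Subgroups of PGL_n(F) are represented by their preimages in GL_n(F), that
   is, by the subgroups of GL_n(F) containing the scalar matrices. *)
Definition PGL_subgroup (G : set 'M[F]_n) : Prop :=
  [/\ forall g, G g -> g \in unitmx,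
      forall c : F, c != 0 -> G c%:M,
      forall g h, G g -> G h -> G (g *m h)
    & forall g, G g -> G (invmx g)].

(* Some neighbourhood of the identity of PGL_n(F) meets G trivially. *)
Definition PGL_discrete (G : set 'M[F]_n) : Prop :=
  exists k : nat, forall g, G g -> mxge k (g - 1%:M) -> is_scalar_mx g.

Definition GL_open (U : set 'M[F]_n) : Prop :=
  forall g, U g -> exists k : nat,
    forall h, h \in unitmx -> mxge k (h - g) -> U h.

(* The quotient space G \ PGL_n(F) is compact: its open sets correspond to the
   open subsets of GL_n(F) invariant under G on the left. *)
Definition PGL_cocompact (G : set 'M[F]_n) : Prop :=
  forall C : set (set 'M[F]_n),
    (forall U, C U -> GL_open U /\ (forall x g, G x -> U g -> U (x *m g))) ->
    (forall g, g \in unitmx -> exists2 U, C U & U g) ->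
    exists D : set (set 'M[F]_n),
      [/\ finite_set D, (D `<=` C)%classic
        & forall g, g \in unitmx -> exists2 U, D U & U g].

(* No nontrivial element of G fixes a point of the geometric realization of
   the building, i.e. maps a nonempty cell to itself. The cell is listed by
   representatives of its vertices. *)
Definition acts_freely (G : set 'M[F]_n) : Prop :=
  forall x, G x -> forall (m : nat) (s : 'I_m.+1 -> GL),
    (forall i j, i != j -> adjacent (val (s i)) (val (s j))) ->
    (forall i, exists j, same_vertex (x *m val (s i)) (val (s j))) ->
    is_scalar_mx x.

(* Every nontrivial element of G moves every vertex to distance more than m in
   the one-skeleton of the building. *)
Definition displacement_gt (G : set 'M[F]_n) (m : nat) : Prop :=
  forall x, G x -> ~~ is_scalar_mx x ->
  forall (l : nat) (w : nat -> GL),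
    (forall i, (i < l)%N -> adjacent (val (w i)) (val (w i.+1))) ->
    same_vertex (x *m val (w 0%N)) (val (w l)) ->
    (m < l)%N.

End Building.

(** * A-tilde complexes and their geodesic powers *)

(* An A-tilde complex of dimension d and density q: the quotient of the
   building of PGL_(d+1)(F) by a fixed-point free cocompact lattice. The
   finite set of vertices of the quotient is presented as a finite type
   with a surjection from the vertices of the building whose fibers are the
   orbits of the lattice. *)
Record AtildeComplex (d q : nat) := MkAtildeComplex {
  At_field : localField;
  At_density : #|residue At_field| = q;
  At_group : set 'M[At_field]_d.+1;
  At_subgroup : PGL_subgroup At_group;
  At_discrete : PGL_discrete At_group;
  At_cocompact : PGL_cocompact At_group;
  At_free : acts_freely At_group;
  At_vertex : finType;
  At_proj : GL At_field d.+1 -> At_vertex;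
  At_proj_surj : forall v, exists g, At_proj g = v;
  At_proj_eq : forall g h, At_proj g = At_proj h <->
    exists2 x, At_group x & same_vertex (x *m val g) (val h)
}.

Section Powers.
Variables (d q : nat) (X : AtildeComplex d q).
Local Notation V := (At_vertex X).

(* The images of the cells of the building, a clique complex. *)
Definition At_cells : {set {set V}} :=
  [set s : {set V} | `[< exists f : V -> GL (At_field X) d.+1,
     {in s, forall v, At_proj (f v) = v} /\
     {in s &, forall v w, v != w -> adjacent (val (f v)) (val (f w))} >]].

(* The directed edge v -> w lifts to an edge of the building of color c. *)
Definition edge_color (v w : V) (c : int) : Prop :=
  exists g h, [/\ At_proj g = v, At_proj h = w, adjacent (val g) (val h)
    & (color (val h) - color (val g) = c %[mod d.+1%:Z])%Z].

Definition geodesic (r : nat) (v : nat -> V) : Prop :=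
  (forall i, (i < r)%N ->
     [set v i; v i.+1] \in faces At_cells 1 /\ edge_color (v i) (v i.+1) 1) /\
  (forall i, (i.+2 <= r)%N ->
     v i.+2 != v i /\ [set v i; v i.+1; v i.+2] \notin faces At_cells 2).

Definition geodesic_joined (r : nat) (x y : V) : Prop :=
  exists v : nat -> V, [/\ geodesic r v, v 0%N = x & v r = y].

(* [ordS] is the cyclic successor on {0, ..., d}. *)
Definition power_top_cell (r : nat) (s : {set V}) : Prop :=
  exists f : 'I_d.+1 -> V,
    [/\ injective f, s = [set f i | i : 'I_d.+1]
      & forall i, geodesic_joined r (f i) (f (ordS i))].

Definition geodesic_power (r : nat) : {set {set V}} :=
  [set t : {set V} |
     `[< exists2 s : {set V}, power_top_cell r s & t \subset s >]].

(* The injectivity radius of X is large enough, relative to r, for every closed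
   walk formed by d + 1 consecutive r-geodesics to lift to a closed walk in the
   building. It also makes X a genuine simplicial complex, with a well-defined
   coloring of directed edges. Some bound of this kind is unavoidable: if X is
   fixed and r grows, the degrees in the links of the geodesic r-power cannot
   exceed the number of vertices of X. *)
Definition geodesically_wide (r : nat) : Prop :=
  displacement_gt (@At_group d q X) (d.+1 * r).

End Powers.

(* a belongs to { +-(q+1)q^(r-1), +-sqrt(q^(2r-1)), ..., +-sqrt(q^r) }. *)
Definition power_link_spectrum (R : realType) (q r : nat) (a : R) : Prop :=
  [\/ a = ((q.+1 * q ^ r.-1)%N)%:R, a = - ((q.+1 * q ^ r.-1)%N)%:R
    | exists2 j : nat, (r <= j <= (2 * r).-1)%N &
        a = Num.sqrt (q%:R ^+ j) \/ a = - Num.sqrt (q%:R ^+ j)].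

(* Main.v *)
Require Import Defs.
From HB Require Import structures.
From mathcomp Require Import all_boot all_order all_algebra.
From mathcomp Require Import boolp classical_sets cardinality reals.
From mathcomp Require Import perm complex generic_quotient ring_quotient.
From mathcomp Require Import ring lra zify.
Set Implicit Arguments.
Unset Strict Implicit.
Unset Printing Implicit Defensive.
Import Order.TTheory GRing.Theory Num.Theory.
Local Open Scope ring_scope.

(** Chambers. A top cell of the power is a cyclic sequence of [d + 1] vertices joined by
    [r]-geodesics. The closed walk has length [(d + 1) * r], so the displacement hypothesis lets it
    lift to a chain of lattices that closes up to homothety. A geodesic of color one has a lift
    whose end lattices have cyclic quotient of length [r], and by Nakayama such a chain has an
    adapted basis [W]: its members are [W *m D i], where [D i] multiplies the first [i] basis
    vectors by [unif ^+ r] ([standard_form], [chamber_lift]). Chambers at a vertex are thus full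
    flags over the chain ring O / pi^r.

    Codimension two. Fix all positions of a chamber but two. If these are not cyclic neighbours,
    they vary independently and the link is complete bipartite. Otherwise a rotation brings them to
    positions 1 and 2, where they run over the incident pairs of the projective Hjelmslev plane over
    O / pi^r ([block_plane]). Two points congruent exactly modulo pi^k have q^k common lines, so for
    the incidence matrix N the product of N and its transpose is a combination of indicator matrices
    of nested congruence relations. Its eigenvalues telescope to the square of (q+1) q^(r-1) and to
    q^(2r-1), ..., q^r; their square roots with both signs form the spectrum ([bipartite_spectrum]).

    High-dimensional expansion, with a bound depending only on [d], [q], [r]. Links of nonempty
    cells are connected, because flags with common members are joined by galleries through them
    ([gallery_flags]), and have bounded size, so a crude path argument bounds their second
    eigenvalue. The link of the empty cell is unbounded. There one projects functions of chambers,
    for each [i], onto those independent of the [i]-th vertex. These projections have angle 0 for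
    positions that are not cyclic neighbours, and cosine at most sqrt q / (q+1), by the plane, for
    neighbours. Each position has two neighbours and 2 sqrt q / (q+1) < 1, so [spectral_gap]
    applies; for functions of a single vertex it yields [gallery_poincare] and then the second
    eigenvalue. *)

(** * Averaging over equivalence classes and angles between averages *)

Section Average.
Variables (R : realFieldType) (C : finType).
Implicit Types (F G u w : C -> R) (e : rel C).

Definition dotp F G : R := \sum_c F c * G c.

Definition avg e F (c : C) : R := (\sum_(c' | e c c') F c') / #|[set c' | e c c']|%:R.

Definition dev e F (c : C) : R := F c - avg e F c.

Definition constant_along e F := forall c c', e c c' -> F c = F c'.

Lemma dotpC F G : dotp F G = dotp G F.
Proof. by apply: eq_bigr => c _; rewrite mulrC. Qed.

Lemma dotpDl F G u : dotp (fun c => F c + G c) u = dotp F u + dotp G u.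
Proof. by rewrite /dotp -big_split; apply: eq_bigr => c _; rewrite mulrDl. Qed.

Lemma dotpZl a F u : dotp (fun c => a * F c) u = a * dotp F u.
Proof. by rewrite /dotp mulr_sumr; apply: eq_bigr => c _; rewrite mulrA. Qed.

Lemma dotpDr F G u : dotp u (fun c => F c + G c) = dotp u F + dotp u G.
Proof. by rewrite dotpC dotpDl !(dotpC u). Qed.

Lemma dotpZr a F u : dotp u (fun c => a * F c) = a * dotp u F.
Proof. by rewrite dotpC dotpZl dotpC. Qed.

Lemma dotpBl F G u : dotp (fun c => F c - G c) u = dotp F u - dotp G u.
Proof. by rewrite /dotp -sumrB; apply: eq_bigr => c _; rewrite mulrBl. Qed.

Lemma dotpBr F G u : dotp u (fun c => F c - G c) = dotp u F - dotp u G.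
Proof. by rewrite dotpC dotpBl !(dotpC u). Qed.

Lemma eq_dotp F F' G G' : F =1 F' -> G =1 G' -> dotp F G = dotp F' G'.
Proof. by move=> eF eG; apply: eq_bigr => c _; rewrite eF eG. Qed.

Lemma dotp_ge0 F : 0 <= dotp F F.
Proof. by apply: sumr_ge0 => c _; rewrite -expr2 sqr_ge0. Qed.

Lemma dotp_eq0 F : dotp F F = 0 -> forall c, F c = 0.
Proof.
move/eqP; rewrite psumr_eq0 => [/allP H c|c _]; last by rewrite -expr2 sqr_ge0.
by have /implyP/(_ isT) := H c (mem_index_enum c); rewrite mulf_eq0 orbb => /eqP.
Qed.

Lemma cauchy_schwarz_dotp F G : dotp F G ^+ 2 <= dotp F F * dotp G G.
Proof.
have [G0|Gn0] := eqVneq (dotp G G) 0.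
  have -> : dotp F G = 0.
    by apply: big1 => c _; rewrite (dotp_eq0 G0) mulr0.
  by rewrite G0 mulr0 expr0n.
have Gp : 0 < dotp G G by rewrite lt_def Gn0 dotp_ge0.
have := dotp_ge0 (fun c => dotp G G * F c - dotp F G * G c).
rewrite dotpBl !dotpBr !dotpZl !dotpZr (dotpC G F) => H.
rewrite -(ler_pM2l Gp); lra.
Qed.

Section OneRelation.
Variable e : rel C.
Hypothesis e_equiv : equivalence_rel e.

Lemma class_refl c : e c c. Proof. by case: (e_equiv c c c). Qed.

Lemma class_eq c c' : e c c' -> e c =1 e c'.
Proof. by move=> ecc' x; case: (e_equiv c c' x) => _ /(_ ecc'). Qed.

Lemma class_sym c c' : e c c' = e c' c.
Proof.
by apply/idP/idP => h; rewrite -(class_eq h) class_refl.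
Qed.

Lemma class_card_gt0 c : (0 < #|[set c' | e c c']|)%N.
Proof. by apply/card_gt0P; exists c; rewrite inE class_refl. Qed.

Lemma class_card_neq0 c : (#|[set c' | e c c']|%:R : R) != 0.
Proof. by rewrite pnatr_eq0 -lt0n class_card_gt0. Qed.

Lemma class_card_eq c c' : e c c' -> #|[set x | e c x]| = #|[set x | e c' x]|.
Proof. by move=> h; apply: eq_card => x; rewrite !inE (class_eq h). Qed.

Lemma avg_const F : constant_along e (avg e F).
Proof.
move=> c c' h; rewrite /avg (class_card_eq h); congr (_ / _).
by apply: eq_bigl => x; rewrite (class_eq h).
Qed.

Lemma avg_id F : constant_along e F -> avg e F =1 F.
Proof.
move=> cF c; rewrite /avg (eq_bigr (fun=> F c)) => [|c' /cF //].
have E : #|[set c' | e c c']| = #|e c| by rewrite cardsE.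
by rewrite sumr_const E -[_ *+ _]mulr_natr mulfK // -E class_card_neq0.
Qed.

Lemma avg_sym F G : dotp (avg e F) G = dotp F (avg e G).
Proof.
rewrite /dotp /avg.
transitivity (\sum_c \sum_(c' | e c c') F c' * (G c / #|[set x | e c x]|%:R)).
  by apply: eq_bigr => c _; rewrite !mulr_suml; apply: eq_bigr => c' _; rewrite mulrAC mulrA.
rewrite (exchange_big_dep xpredT) //=; apply: eq_bigr => c' _.
rewrite mulr_suml mulr_sumr; apply: eq_big => [c|c ec]; first exact: class_sym.
by rewrite (class_card_eq ec).
Qed.

Lemma avg_dotp F G : constant_along e G -> dotp (avg e F) G = dotp F G.
Proof. by move=> cG; rewrite avg_sym; apply: eq_dotp => // c; apply: avg_id. Qed.

Lemma avg_sqr F : dotp (avg e F) (avg e F) = dotp F (avg e F).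
Proof. by rewrite avg_dotp //; apply: avg_const. Qed.

Lemma avgB F G : avg e (fun c => F c - G c) =1 (fun c => avg e F c - avg e G c).
Proof. by move=> c; rewrite /avg sumrB mulrBl. Qed.

(** [avg e] is the orthogonal projection onto the functions constant along [e], hence gives the
    nearest such function. *)
Lemma avg_best F G : constant_along e G ->
  dotp (dev e F) (dev e F) <=
  dotp (fun c => F c - G c) (fun c => F c - G c).
Proof.
move=> cG; rewrite -subr_ge0.
rewrite !(dotpBl, dotpBr) !avg_sqr (dotpC (avg _ _) F) (dotpC G F).
have -> : dotp F G = dotp (avg e F) G by rewrite avg_dotp.
have := dotp_ge0 (fun c => avg e F c - G c).
rewrite !(dotpBl, dotpBr) avg_sqr (dotpC G (avg _ _)); lra.
Qed.

Lemma sum_ge0_classes (X : C -> R) :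
  (forall c0, 0 <= \sum_(c | e c0 c) X c) -> 0 <= \sum_c X c.
Proof.
move=> H; have -> : \sum_c X c = \sum_c avg e X c.
  have := @avg_dotp X (fun=> 1); rewrite /dotp => h.
  transitivity (\sum_c X c * 1); first by apply: eq_bigr => c _; rewrite mulr1.
  by rewrite -h //; apply: eq_bigr => c _; rewrite mulr1.
by apply: sumr_ge0 => c _; rewrite divr_ge0.
Qed.

End OneRelation.

(** Tower property of conditional expectations: the indicator of a coarse class is constant on the
    fine classes. *)
Lemma avg_coarser e e' F : equivalence_rel e -> equivalence_rel e' ->
  subrel e e' -> avg e' (avg e F) =1 avg e' F.
Proof.
move=> he he' sub c0.
suff E : \sum_(c' | e' c0 c') avg e F c' = \sum_(c' | e' c0 c') F c'.
  by rewrite {1}/avg E.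
rewrite big_mkcond /=.
pose chi c : R := (e' c0 c)%:R.
have cchi : constant_along e chi.
  move=> c c' ecc'; rewrite /chi (class_sym he') (class_eq he' (sub _ _ ecc')).
  by rewrite (class_sym he').
have := avg_dotp he F cchi; rewrite /dotp /chi => H.
have E (G : C -> R) : \sum_i (if e' c0 i then G i else 0) = \sum_c G c * (e' c0 c)%:R.
  by apply: eq_bigr => c _; case: ifP; rewrite ?(mulr1, mulr0).
by rewrite E H [RHS]big_mkcond E.
Qed.

End Average.

(* The angle between the complements of two subspaces is controlled by the
   angle between the subspaces: with S = P1 + P2 one has S <= 1 + eps off the
   common part, and (2 - S)(1 + eps - S) =
   (1 - eps)(1 + eps - S) + (1 + eps - S)^2. *)
Lemma complement_angle (R : realFieldType) (C : finType) (e1 e2 e12 : rel C)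
    (eps : R) :
  equivalence_rel e1 -> equivalence_rel e2 -> equivalence_rel e12 ->
  subrel e1 e12 -> subrel e2 e12 -> 0 <= eps <= 1 ->
  (forall u w : C -> R, constant_along e1 u -> constant_along e2 w ->
     avg e12 u =1 (fun=> 0) -> avg e12 w =1 (fun=> 0) ->
     2 * dotp u w <= eps * (dotp u u + dotp w w)) ->
  forall F : C -> R,
    - (eps * (dotp (dev e1 F) (dev e1 F) + dotp (dev e2 F) (dev e2 F))) <=
    2 * dotp (dev e1 F) (dev e2 F).
Proof.
move=> h1 h2 h12 s1 s2 /andP[eps0 eps1] angle F.
pose f c := F c - avg e12 F c.
pose p := avg e1 f; pose s := avg e2 f.
have f0 : avg e12 f =1 (fun=> 0).
  by move=> c; rewrite avgB (avg_id h12 (avg_const h12 F)) subrr.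
have cc1 : constant_along e1 (avg e12 F) by move=> c c' /s1/(avg_const h12).
have cc2 : constant_along e2 (avg e12 F) by move=> c c' /s2/(avg_const h12).
have ea : dev e1 F =1 (fun c => f c - p c).
  by move=> c; rewrite /dev /p /f avgB (avg_id h1 cc1); lra.
have eb : dev e2 F =1 (fun c => f c - s c).
  by move=> c; rewrite /dev /s /f avgB (avg_id h2 cc2); lra.
have p0 : avg e12 p =1 (fun=> 0) by move=> c; rewrite avg_coarser.
have s0 : avg e12 s =1 (fun=> 0) by move=> c; rewrite avg_coarser.
have A := angle p s (avg_const h1 f) (avg_const h2 f) p0 s0.
have pp : dotp p p = dotp f p by exact: avg_sqr.
have ss : dotp s s = dotp f s by exact: avg_sqr.
rewrite (eq_dotp ea ea) (eq_dotp eb eb) (eq_dotp ea eb).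
clearbody p s f.
(* With [A], this square bounds the form of S by 1 + eps, which is [B]; it is used once more in the
   last step. *)
have V := dotp_ge0 (fun c => (p c + s c) - (1 + eps) * f c).
move: V; rewrite !(dotpBl, dotpBr, dotpDl, dotpDr, dotpZl, dotpZr).
rewrite (dotpC p f) (dotpC s f) (dotpC s p) pp ss.
rewrite pp ss in A.
set X := dotp f p in A *; set Y := dotp f s in A *; set Z := dotp p s in A *.
set N := dotp f f.
move=> V.
have B : X + Y <= (1 + eps) * N.
  have : 0 <= (1 + eps) * ((1 + eps) * N - (X + Y)) by lra.
  by rewrite pmulr_rge0 ?subr_ge0 //; lra.
have : 0 <= (1 - eps) * ((1 + eps) * N - (X + Y)) by rewrite mulr_ge0; lra.
lra.
Qed.

(** * Spectral gap of a sum of projections from pairwise angles *)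

(** Fredholm alternative: the cokernel matrix of [M] has columns in the kernel of [M]. *)
Lemma symmetric_range (R : realFieldType) (m : nat) (M : 'M[R]_m) (u : 'rV[R]_m) :
  M^T = M -> (forall v : 'cV[R]_m, M *m v = 0 -> u *m v = 0) ->
  exists w : 'rV[R]_m, u = w *m M.
Proof.
move=> sM H; apply/submxP; rewrite submxE; apply/eqP/matrixP => i j.
have K : M *m col j (cokermx M) = 0.
  by rewrite colE mulmxA mulmx_coker mul0mx.
have := H _ K; rewrite colE mulmxA -colE => /matrixP/(_ i ord0).
by rewrite !mxE.
Qed.

Section Gap.
Variables (R : realFieldType) (C I : finType) (e : I -> rel C).
Variables (eps : I -> I -> R) (c0 : R).
Hypothesis e_equiv : forall i, equivalence_rel (e i).
Hypothesis eps_sym : forall i j, eps i j = eps j i.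
Hypothesis eps_row : forall i, \sum_(j | j != i) eps i j <= 1 - c0.
Hypothesis e_angle : forall (F : C -> R) i j, i != j ->
  - (eps i j * (dotp (dev (e i) F) (dev (e i) F) + dotp (dev (e j) F) (dev (e j) F))) <=
  2 * dotp (dev (e i) F) (dev (e j) F).
Hypothesis c0_gt0 : 0 < c0.
Hypothesis e_connected : forall F : C -> R,
  (forall i, constant_along (e i) F) -> forall c c', F c = F c'.

Let Q i (F : C -> R) := dev (e i) F.
Let L (F : C -> R) c := \sum_i Q i F c.

Let dotp_sumr (F : C -> R) (G : I -> C -> R) :
  dotp F (fun c => \sum_i G i c) = \sum_i dotp F (G i).
Proof.
rewrite /dotp exchange_big; apply: eq_bigr => c _.
by rewrite mulr_sumr.
Qed.

Let dotp_suml (F : C -> R) (G : I -> C -> R) :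
  dotp (fun c => \sum_i G i c) F = \sum_i dotp (G i) F.
Proof. by rewrite dotpC dotp_sumr; apply: eq_bigr => i _; rewrite dotpC. Qed.

Let QQ i F G : dotp (Q i F) (Q i G) = dotp F (Q i G).
Proof.
rewrite /Q /dev dotpBl [X in _ - X = _](_ : _ = 0) ?subr0 // dotpBr.
rewrite [X in X - _](_ : _ = dotp (avg (e i) F) (avg (e i) G)) ?subrr //.
by rewrite (avg_sym (e_equiv i)) -(avg_dotp (e_equiv i)) //; apply: avg_const.
Qed.

Let Q_sym i F G : dotp (Q i F) G = dotp F (Q i G).
Proof. by rewrite dotpC -QQ dotpC QQ. Qed.

Let energyE F G : \sum_i dotp (Q i F) (Q i G) = dotp F (L G).
Proof. by rewrite dotp_sumr; apply: eq_bigr => i _; apply: QQ. Qed.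

(** Expand the square of [L F]. The angle hypothesis bounds each cross term by diagonal ones, and
    the row sums of [eps] leave the fraction [c0] of the diagonal. *)
Let laplacian_sq F : c0 * (\sum_i dotp (Q i F) (Q i F)) <= dotp (L F) (L F).
Proof.
rewrite dotp_sumr; under [X in _ <= X]eq_bigr do rewrite dotp_suml.
have D i : \sum_j dotp (Q j F) (Q i F) =
    dotp (Q i F) (Q i F) + \sum_(j | j != i) dotp (Q i F) (Q j F).
  by rewrite (bigD1 i) //=; congr (_ + _); apply: eq_bigr => j _; rewrite dotpC.
under [X in _ <= X]eq_bigr do rewrite D.
rewrite big_split /=.
have K : - (\sum_i \sum_(j | j != i) eps i j * (dotp (Q i F) (Q i F) + dotp (Q j F) (Q j F)))
   <= 2 * \sum_i \sum_(j | j != i) dotp (Q i F) (Q j F).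
  rewrite -sumrN mulr_sumr; apply: ler_sum => i _.
  rewrite -sumrN mulr_sumr; apply: ler_sum => j ji.
  by apply: e_angle; rewrite eq_sym.
have E : \sum_i \sum_(j | j != i) eps i j * (dotp (Q i F) (Q i F) + dotp (Q j F) (Q j F))
   = 2 * \sum_i (\sum_(j | j != i) eps i j) * dotp (Q i F) (Q i F).
  under eq_bigr do (under eq_bigr do rewrite mulrDr; rewrite big_split /=).
  rewrite big_split /= mulr2n mulrDl mul1r; congr (_ + _).
    by apply: eq_bigr => i _; rewrite mulr_suml.
  rewrite (exchange_big_dep xpredT) //=; apply: eq_bigr => i _.
  rewrite mulr_suml; apply: eq_big => [j|j _]; first by rewrite eq_sym.
  by rewrite eps_sym.
have B : \sum_i (\sum_(j | j != i) eps i j) * dotp (Q i F) (Q i F)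
   <= (1 - c0) * \sum_i dotp (Q i F) (Q i F).
  rewrite mulr_sumr; apply: ler_sum => i _.
  by rewrite ler_wpM2r ?dotp_ge0.
rewrite E in K; lra.
Qed.

Let L_matrix : 'M[R]_#|C| :=
  \matrix_(i, j) L (fun c => (c == enum_val i)%:R) (enum_val j).

Let dotp_delta (F : C -> R) x : dotp F (fun c => (c == x)%:R) = F x.
Proof.
rewrite /dotp (bigD1 x) //= eqxx mulr1 big1 ?addr0 // => c /negPf->.
by rewrite mulr0.
Qed.

Let L_sym F G : dotp (L F) G = dotp F (L G).
Proof.
rewrite dotp_suml dotp_sumr; apply: eq_bigr => i _; exact: Q_sym.
Qed.

Let L_matrixE (v : 'rV[R]_#|C|) j :
  (v *m L_matrix) 0 j = L (fun c => v 0 (enum_rank c)) (enum_val j).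
Proof.
rewrite -[RHS]dotp_delta L_sym /dotp mxE.
rewrite (reindex (@enum_val C C)) /=; last first.
  by exists enum_rank => x _; rewrite ?enum_valK ?enum_rankK.
apply: eq_bigr => i _; rewrite enum_valK mxE; congr (_ * _).
by rewrite -[LHS]dotp_delta -[RHS]dotp_delta L_sym dotpC.
Qed.

(** Write [F = L G]. Then the squared norm of [F] is the sum of the products of [Q i F] and [Q i G];
    Cauchy-Schwarz bounds its square by the product of the energies of [F] and [G], and
    [laplacian_sq] bounds the energy of [G] by the squared norm of [L G = F], divided by [c0]. *)
Theorem spectral_gap F : \sum_c F c = 0 ->
  c0 * dotp F F <= \sum_i dotp (dev (e i) F) (dev (e i) F).
Proof.
move=> F0; pose u : 'rV[R]_#|C| := \row_j F (enum_val j).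
have sM : L_matrix^T = L_matrix.
  apply/matrixP => i j; rewrite !mxE.
  by rewrite -[LHS]dotp_delta -[RHS]dotp_delta L_sym dotpC.
(* By connectedness the kernel of [L] consists of constants, to which [F] is orthogonal. *)
have [|w uw] := symmetric_range (u := u) sM.
  move=> v Mv0.
  pose G c := v (enum_rank c) 0.
  have LG c : L G c = 0.
    have := L_matrixE v^T (enum_rank c); rewrite enum_rankK.
    rewrite -[L_matrix]trmxK -trmx_mul sM Mv0 !mxE => /esym h.
    by rewrite -[RHS]h; congr (L _ _); apply: funext => x; rewrite mxE.
  have E0 : \sum_i dotp (Q i G) (Q i G) = 0.
    by rewrite energyE; apply: big1 => c _; rewrite LG mulr0.
  have Gc i : constant_along (e i) G.
    have /eqP := E0; rewrite psumr_eq0 => [/allP/(_ i (mem_index_enum _))|j _]; last exact: dotp_ge0.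
    move=> /implyP/(_ isT)/eqP/dotp_eq0 h c c' ecc'.
    have := h c; have := h c'; rewrite /Q /dev => /eqP; rewrite subr_eq0 => /eqP->.
    by move/eqP; rewrite subr_eq0 => /eqP->; apply: avg_const.
  have Gcc := e_connected Gc.
  apply/matrixP => i j; rewrite !mxE !ord1.
  transitivity (dotp F G).
    rewrite /dotp [RHS](reindex (@enum_val C C)) /=; last first.
      by exists enum_rank => x _; rewrite ?enum_valK ?enum_rankK.
    by apply: eq_bigr => k _; rewrite !mxE /G enum_valK.
  case: (pickP C) => [c1 _|h]; last by rewrite /dotp big1 // => c; have := h c.
  rewrite /dotp; under eq_bigr do rewrite (Gcc _ c1).
  by rewrite -mulr_suml F0 mul0r.
pose G c := w 0 (enum_rank c).
have FLG : F =1 L G.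
  move=> c; have /rowP/(_ (enum_rank c)) := uw.
  by rewrite L_matrixE mxE !enum_rankK.
have FF : dotp F F = \sum_i dotp (Q i F) (Q i G).
  by rewrite energyE; apply: eq_dotp.
have CS : (\sum_i dotp (Q i F) (Q i G)) ^+ 2 <=
    (\sum_i dotp (Q i F) (Q i F)) * (\sum_i dotp (Q i G) (Q i G)).
  have := @cauchy_schwarz_dotp R (I * C)%type (fun x => Q x.1 F x.2) (fun x => Q x.1 G x.2).
  by rewrite /dotp -!(pair_bigA _ (fun i c => Q i _ c * Q i _ c)).
have LL := laplacian_sq G.
rewrite -(eq_dotp FLG FLG) in LL.
rewrite -FF in CS.
have [FF0|] := eqVneq (dotp F F) 0.
  by rewrite FF0 mulr0 sumr_ge0 // => i _; apply: dotp_ge0.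
move=> FFn0; have FFp : 0 < dotp F F by rewrite lt_def FFn0 dotp_ge0.
set A := (X in _ <= X); set B := \sum_i dotp (Q i G) (Q i G) in CS LL.
have A0 : 0 <= A by apply: sumr_ge0 => i _; apply: dotp_ge0.
rewrite -(ler_pM2r FFp) -mulrA -expr2.
apply: (le_trans (ler_wpM2l (ltW c0_gt0) CS)).
by rewrite mulrCA ler_wpM2l.
Qed.

End Gap.

(** * Real spectrum and second eigenvalue of weighted symmetric matrices *)

(** The two Schur complements of one block matrix [K], cleared of denominators. *)
Lemma det_scalar_add_rank1 (A : comNzRingType) (n : nat) (a : A)
    (u : 'cV[A]_n) (v : 'rV[A]_n) :
  a * \det (a%:M + u *m v) = (a + (v *m u) 0 0) * a ^+ n.
Proof.
pose K : 'M[A]_(1 + n) := block_mx 1%:M (- v) u a%:M.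
have d1 : \det K = \det (a%:M + u *m v).
  have E : K *m block_mx 1%:M v 0 1%:M = block_mx 1%:M 0 u (a%:M + u *m v).
    by rewrite mulmx_block !mulmx1 !mul1mx !mulmx0 !addr0 subrr addrC.
  have := congr1 determinant E.
  by rewrite det_mulmx det_ublock det_lblock !det1 !mulr1 mul1r.
have d2 : a * \det K = (a + (v *m u) 0 0) * a ^+ n.
  have E : block_mx a%:M v 0 1%:M *m K = block_mx (a%:M + v *m u) 0 u a%:M.
    rewrite mulmx_block !mulmx1 !mul1mx !mul0mx !add0r mulmxN.
    by rewrite mul_scalar_mx mul_mx_scalar addNr.
  have := congr1 determinant E.
  rewrite det_mulmx det_ublock det_lblock det1 !det_scalar mulr1 expr1 => ->.
  by rewrite det_mx11 !mxE.
by rewrite -d1.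
Qed.

(* Deflation of the eigenvalue 1 of a stochastic matrix. *)
Lemma char_poly_deflate (F : fieldType) (n : nat) (M : 'M[F]_n)
    (u : 'cV[F]_n) (p : 'rV[F]_n) : p *m M = p -> (p *m u) 0 0 = 1 ->
  ('X - 1) * char_poly (M - u *m p) = 'X * char_poly M.
Proof.
move=> pM pu.
set U := map_mx polyC u; set P := map_mx polyC p.
have E : char_poly_mx (M - u *m p) = char_poly_mx M + U *m P.
  by rewrite /char_poly_mx map_mxB map_mxM opprB addrA addrAC.
have PM : P *m char_poly_mx M = ('X - 1) *: P.
  rewrite /char_poly_mx mulmxBr -map_mxM pM mul_mx_scalar scalerBl scale1r //.
have E2 : (('X - 1)%:M + U *m P) *m char_poly_mx M
    = ('X - 1)%:M *m char_poly_mx (M - u *m p).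
  by rewrite E mulmxDl -mulmxA PM -scalemxAr !mul_scalar_mx [RHS]scalerDr.
have := congr1 determinant E2; rewrite !det_mulmx det_scalar -/(char_poly M) -/(char_poly (M - u *m p)) => D.
have X1 : 'X - 1 != 0 :> {poly F} by rewrite -polyC1 polyXsubC_eq0.
have R1 := det_scalar_add_rank1 ('X - 1) U P.
have PU : (P *m U) 0 0 = 1 by rewrite -map_mxM mxE pu.
rewrite PU subrK in R1.
apply: (@mulfI _ (('X - 1) ^+ n)); first exact: expf_neq0.
by rewrite mulrCA -D mulrA R1 -mulrA mulrCA.
Qed.

Section WeightedSymmetric.
Import ComplexField.
Local Open Scope complex_scope.
Variable R : rcfType.

Let conjM (x y : R[i]) : conjc (x * y) = conjc x * conjc y.
Proof. exact: rmorphM. Qed.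

Let conj_sum (J : Type) (s : seq J) (P : pred J) (f : J -> R[i]) :
  conjc (\sum_(i <- s | P i) f i) = \sum_(i <- s | P i) conjc (f i).
Proof. exact: rmorph_sum. Qed.

(** The matrix is self-adjoint for a weighted inner product, so every complex eigenvalue equals its
    conjugate. *)
Lemma char_poly_weighted_symmetric (n : nat) (B : 'M[R]_n) (w : 'I_n -> R) :
  B^T = B -> (forall i, 0 < w i) ->
  exists s : seq R,
    char_poly (\matrix_(i, j) (B i j / w i)) = \prod_(a <- s) ('X - a%:P).
Proof.
move=> sB w0; set N := \matrix_(i, j) _.
have [zs zsE] := closed_field_poly_normal (map_poly (real_complex R) (char_poly N)).
have mon : char_poly N \is monic := char_poly_monic N.
rewrite lead_coef_map (monicP mon) rmorph1 scale1r in zsE.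
have real z : z \in zs -> z = (complex.Re z)%:C.
  move=> zin; have : root (map_poly (real_complex R) (char_poly N)) z.
    by rewrite zsE root_prod_XsubC.
  rewrite map_char_poly -eigenvalue_root_char => /eigenvalueP [v vE vn0].
  (* The squared norm of [v] for the weights [1 / w], real and nonzero. *)
  pose S := \sum_i (w i)%:C^-1 * (v 0 i * conjc (v 0 i)).
  have sym i j : B i j = B j i by rewrite -{1}sB mxE.
  have vj j : \sum_i v 0 i * ((B i j)%:C / (w i)%:C) = z * v 0 j.
    have /rowP/(_ j) := vE; rewrite !mxE => <-; apply: eq_bigr => i _.
    by rewrite !mxE rmorphM fmorphV.
  have E : \sum_j (\sum_i v 0 i * ((B i j)%:C / (w i)%:C)) * (conjc (v 0 j) / (w j)%:C) = z * S.
    rewrite /S mulr_sumr; apply: eq_bigr => j _; rewrite vj; ring.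
  have Ec : conjc (\sum_j (\sum_i v 0 i * ((B i j)%:C / (w i)%:C)) * (conjc (v 0 j) / (w j)%:C)) =
      \sum_j (\sum_i v 0 i * ((B i j)%:C / (w i)%:C)) * (conjc (v 0 j) / (w j)%:C).
    under eq_bigr do rewrite mulr_suml.
    rewrite conj_sum exchange_big /=; apply: eq_bigr => i _.
    rewrite conj_sum; apply: eq_bigr => j _.
    rewrite !(conjM, conjc_inv) !conjc_real conjcK (sym i j); ring.
  have Sr : conjc S = S.
    rewrite /S conj_sum; apply: eq_bigr => j _.
    by rewrite !conjM conjc_inv conjc_real conjcK; ring.
  have S0 : S != 0.
    have T0 i : 0 <= (w i)%:C^-1 * (v 0 i * conjc (v 0 i)).
      by rewrite mulr_ge0 ?mul_conjC_ge0 // invr_ge0 ler0c ltW.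
    apply: contra vn0; rewrite psumr_eq0 // => /allP H.
    apply/eqP/rowP => j; have /implyP/(_ isT) := H j (mem_index_enum j).
    rewrite mulf_eq0 invr_eq0 mulf_eq0 conjc_eq0 orbb => /orP[|/eqP -> //].
      by rewrite -[0]/(0%:C) (inj_eq (@complexI _)) gt_eqF.
    by rewrite mxE.
  have : conjc z * S = z * S by rewrite -[in LHS]Sr -conjM -E Ec.
  move/(mulIf S0); case: (z) => a b [] /eqP; rewrite eq_sym -addr_eq0 -mulr2n.
  by rewrite mulrn_eq0 /= => /eqP ->.
exists [seq complex.Re z | z <- zs].
apply: (map_poly_inj (real_complex R)); rewrite zsE big_map rmorph_prod.
rewrite big_seq [RHS]big_seq; apply: eq_bigr => z zin.
by rewrite rmorphB /= map_polyX map_polyC {1}(real z zin).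
Qed.
End WeightedSymmetric.

Section SecondEigenvalue.
Variable R : realType.

(** Deflate the eigenvalue 1 by the stationary distribution [p]. Eigenvectors of the deflated matrix
    with nonzero eigenvalue have weighted mean zero, so the Poincare hypothesis bounds all its
    eigenvalues by [lam]. *)
Lemma second_eigenvalue_poincare_mx (n : nat) (A : 'M[R]_n) (w : 'I_n -> R) (lam : R) :
  (1 < n)%N -> A^T = A -> (forall i, 0 < w i) -> (forall i, \sum_j A i j = w i) ->
  0 <= lam <= 1 ->
  (forall h : 'I_n -> R, \sum_i w i * h i = 0 ->
     \sum_i \sum_j A i j * h i * h j <= lam * \sum_i w i * h i ^+ 2) ->
  exists2 mu, second_eigenvalue (\matrix_(i, j) (A i j / w i)) mu & mu <= lam.
Proof.
move=> n1 sA w0 rA /andP[lam0 lam1] poinc; set M := \matrix_(i, j) _.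
have symA i j : A i j = A j i by rewrite -{1}sA mxE.
have wn0 i : w i != 0 by rewrite gt_eqF.
pose W := \sum_i w i.
have W0 : W != 0.
  rewrite gt_eqF // /W (bigD1 (Ordinal (ltnW n1))) //=.
  by apply: ltr_wpDr => //; apply: sumr_ge0 => i _; apply: ltW.
pose u : 'cV[R]_n := \col_i 1; pose p : 'rV[R]_n := \row_j (w j / W).
have pM : p *m M = p.
  apply/rowP => j; rewrite !mxE -rA mulr_suml; apply: eq_bigr => i _.
  by rewrite !mxE (symA j); field; rewrite W0 wn0.
have pu : (p *m u) 0 0 = 1.
  rewrite mxE; under eq_bigr do rewrite !mxE mulr1.
  by rewrite -mulr_suml mulfV.
have defl := char_poly_deflate pM pu.
pose B := \matrix_(i, j) (A i j - w i * w j / W).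
have BE : M - u *m p = \matrix_(i, j) (B i j / w i).
  apply/matrixP => i j; rewrite !mxE big_ord1 !mxE.
  by field; rewrite W0 wn0.
have sB : B^T = B.
  by apply/matrixP => i j; rewrite !mxE symA; congr (_ - _ / _); rewrite mulrC.
have [s sE] := char_poly_weighted_symmetric sB w0.
rewrite -BE in sE.
have s_le a : a \in s -> a <= lam.
  move=> ain; have [->//|an0] := eqVneq a 0.
  have : root (char_poly (M - u *m p)) a by rewrite sE root_prod_XsubC.
  rewrite -eigenvalue_root_char BE => /eigenvalueP [v vE vn0].
  pose h i := v 0 i / w i.
  have hE j : \sum_i h i * B i j = a * (w j * h j).
    have /rowP/(_ j) := vE; rewrite !mxE => E.
    transitivity (a * v 0 j); last by rewrite /h; field.
    by rewrite -E; apply: eq_bigr => i _; rewrite !mxE /h mulrAC mulrA.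
  (* The rows of [B] sum to zero. *)
  have h0 : \sum_i w i * h i = 0.
    apply: (mulfI an0); rewrite mulr0 mulr_sumr.
    under eq_bigr do rewrite -hE.
    rewrite exchange_big big1 //= => i _; rewrite -mulr_sumr.
    rewrite [X in _ * X](_ : _ = 0) ?mulr0 //.
    under eq_bigr do rewrite mxE.
    rewrite sumrB rA -mulr_suml -mulr_sumr -/W; field.
    by [].
  have hA j : \sum_i h i * A i j = a * (w j * h j).
    rewrite -hE; apply/eqP; rewrite -subr_eq0 -sumrB.
    rewrite [X in X == 0](_ : _ = (\sum_i w i * h i) * (w j / W)).
      by rewrite h0 mul0r.
    rewrite mulr_suml; apply: eq_bigr => i _; rewrite !mxE; field.
    by [].
  have := poinc h h0.
  rewrite [X in X <= _](_ : _ = a * \sum_i w i * h i ^+ 2); last first.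
    rewrite exchange_big mulr_sumr; apply: eq_bigr => j _ /=.
    rewrite -mulr_suml (eq_bigr (fun i => h i * A i j)) => [|i _]; last exact: mulrC.
    rewrite hA; ring.
  rewrite ler_pM2r // lt_def sumr_ge0 ?andbT => [|i _]; last first.
    by rewrite mulr_ge0 ?sqr_ge0 // ltW.
  apply: contra vn0; rewrite psumr_eq0 => [|i _]; last by rewrite mulr_ge0 ?sqr_ge0 // ltW.
  move=> /allP H; apply/eqP/rowP => j.
  have /implyP/(_ isT) := H j (mem_index_enum j).
  rewrite mulf_eq0 (negPf (wn0 j)) sqrf_eq0 /= /h mulf_eq0 invr_eq0 (negPf (wn0 j)) orbF.
  by move/eqP ->; rewrite mxE.
(* Deflation turned one eigenvalue 1 into 0: trading this 0 for 1 recovers the spectrum of [M] with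
   multiplicities. *)
have s0 : 0 \in s.
  rewrite -root_prod_XsubC -sE /root.
  have := congr1 (fun P => P.[0]) defl; rewrite !hornerM hornerX mul0r => /eqP.
  rewrite mulf_eq0 => /orP[|//].
  by rewrite -polyC1 hornerXsubC sub0r oppr_eq0 oner_eq0.
have ps := perm_to_rem s0.
have sn : size s = n.
  have := size_char_poly (M - u *m p).
  by rewrite sE size_prod_XsubC => -[].
have sr : size (rem 0 s) = n.-1 by rewrite size_rem // sn.
have cM : char_poly M = ('X - 1%:P) * \prod_(a <- rem 0 s) ('X - a%:P).
  apply: (@mulfI _ 'X); first by rewrite polyX_eq0.
  by rewrite -defl sE (perm_big _ ps) /= big_cons polyC0 subr0 polyC1 mulrCA.
pose t := sort >=%R (rem 0 s).
have tin a : a \in t -> a <= lam by rewrite mem_sort => /mem_rem; apply: s_le.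
have tsz : size t = n.-1 by rewrite size_sort.
have t1 : (0 < size t)%N by rewrite tsz -ltnS prednK // ltnW.
exists (t`_0); last by apply: tin; apply: mem_nth.
exists (1 :: t); split => //.
- rewrite /= path_min_sorted; first by apply: sort_sorted; exact: ge_total.
  by apply/allP => a /tin h; apply: le_trans h lam1.
- rewrite cM big_cons; congr (_ * _).
  by apply: perm_big; rewrite perm_sym perm_sort.
Qed.

Variable V : finType.

Lemma second_eigenvalue_poincare (Y : {set {set V}}) (lam : R) :
  (1 < #|verts Y|)%N -> (forall x y, skel Y x y -> y \in verts Y) ->
  {in verts Y, forall x, (0 < skel_deg Y x)%N} -> 0 <= lam <= 1 ->
  (forall h : V -> R, \sum_(x in verts Y) (skel_deg Y x)%:R * h x = 0 ->
     \sum_(x in verts Y) \sum_(y in verts Y) (skel Y x y)%:R * h x * h y <=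
     lam * \sum_(x in verts Y) (skel_deg Y x)%:R * h x ^+ 2) ->
  exists2 mu, second_eigenvalue (nadj_mx R Y) mu & mu <= lam.
Proof.
move=> Y1 Yv Yd lam01 poinc.
have sym x y : skel Y x y = skel Y y x by rewrite /skel /= eq_sym finset.setUC.
pose A : 'M[R]_#|verts Y| := \matrix_(i, j) (skel Y (enum_val i) (enum_val j))%:R.
have sumE (f : V -> R) : \sum_(i < #|verts Y|) f (enum_val i) = \sum_(x in verts Y) f x.
  by rewrite [RHS]big_enum_val.
have [||||||mu] := @second_eigenvalue_poincare_mx _ A (fun i => (skel_deg Y (enum_val i))%:R) lam.
- exact: Y1.
- by apply/matrixP => i j; rewrite !mxE sym.
- by move=> i; rewrite ltr0n Yd // enum_valP.
- move=> i; under eq_bigr do rewrite mxE.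
  rewrite (sumE (fun y => (skel Y (enum_val i) y)%:R)).
  rewrite -natr_sum -big_mkcondr sum1_card /skel_deg; congr (_%:R).
  apply: eq_card => y; rewrite !inE /=.
  by apply/andP/idP => [[]//|h]; split => //; have := Yv _ _ h; rewrite inE.
- exact: lam01.
- move=> h h0.
  pose H x : R := \sum_i h i * (x == enum_val i)%:R.
  have HE i : h i = H (enum_val i).
    rewrite /H (bigD1 i) //= eqxx mulr1 big1 ?addr0 // => j ji.
    by rewrite (inj_eq enum_val_inj) eq_sym (negPf ji) mulr0.
  have H0 : \sum_(x in verts Y) (skel_deg Y x)%:R * H x = 0.
    by rewrite -sumE -[RHS]h0; apply: eq_bigr => i _; rewrite HE.
  have := poinc H H0; rewrite -!sumE.
  under eq_bigr do rewrite -sumE.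
  under [X in _ -> X <= _]eq_bigr do under eq_bigr do rewrite mxE !HE.
  by under [X in _ -> _ <= _ * X]eq_bigr do rewrite HE.
- by rewrite (_ : nadj_mx R Y = \matrix_(i, j) (A i j / (skel_deg Y (enum_val i))%:R));
    [exists mu | apply/matrixP => i j; rewrite !mxE].
Qed.

End SecondEigenvalue.

(** * Second eigenvalues from Dirichlet energies *)

Section Energy.
Variables (R : realType) (V : finType).
Implicit Types (Y : {set {set V}}) (h : V -> R).

Definition energy Y h : R :=
  \sum_(x in verts Y) \sum_(y in verts Y) (skel Y x y)%:R * (h x - h y) ^+ 2.

Lemma skel_sym Y x y : skel Y x y = skel Y y x.
Proof. by rewrite /skel /= eq_sym finset.setUC. Qed.

Lemma skel_degE Y x : (forall x y, skel Y x y -> y \in verts Y) ->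
  (skel_deg Y x)%:R = \sum_(y in verts Y) (skel Y x y)%:R :> R.
Proof.
move=> Yv; rewrite -natr_sum -big_mkcondr sum1_card /skel_deg; congr (_%:R).
apply: eq_card => y; rewrite !inE /=.
by apply/idP/andP => [h|[]//]; split => //; have := Yv _ _ h; rewrite inE.
Qed.

Lemma energy_ge Y h x y : x \in verts Y -> y \in verts Y -> skel Y x y ->
  (h x - h y) ^+ 2 <= energy Y h.
Proof.
move=> xY yY sxy; rewrite /energy (bigD1 x) //= (bigD1 y) //= sxy mul1r -addrA.
rewrite lerDl addr_ge0 //; apply: sumr_ge0 => z _; first by rewrite mulr_ge0 ?sqr_ge0.
by apply: sumr_ge0 => w _; rewrite mulr_ge0 ?sqr_ge0.
Qed.

Lemma energy_ge0 Y h : 0 <= energy Y h.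
Proof. by do 2![apply: sumr_ge0 => ? _]; rewrite mulr_ge0 ?sqr_ge0. Qed.

(** Any center [m] is allowed, since the weighted mean minimizes the weighted square deviation. The
    energy counts each edge in both directions, whence the factor 1/2. *)
Lemma second_eigenvalue_energy Y (c : R) :
  (1 < #|verts Y|)%N -> (forall x y, skel Y x y -> y \in verts Y) ->
  {in verts Y, forall x, (0 < skel_deg Y x)%N} -> 0 <= c <= 1 ->
  (forall h, exists m, c * (\sum_(x in verts Y) (skel_deg Y x)%:R * (h x - m) ^+ 2)
     <= energy Y h) ->
  exists2 mu, second_eigenvalue (nadj_mx R Y) mu & mu <= 1 - c / 2.
Proof.
move=> Y1 Yv Yd /andP[c0 c1] H.
apply: second_eigenvalue_poincare => //; first by apply/andP; split; lra.
move=> h h0.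
set D := \sum_(x in verts Y) _ * _ ^+ 2; set T := \sum_(x in verts Y) \sum_(y in _) _.
have degE x := skel_degE x Yv.
have E : energy Y h = 2 * D - 2 * T.
  have A : \sum_(x in verts Y) \sum_(y in verts Y) (skel Y x y)%:R * h x ^+ 2 = D.
    by apply: eq_bigr => x _; rewrite degE mulr_suml.
  have B : \sum_(x in verts Y) \sum_(y in verts Y) (skel Y x y)%:R * h y ^+ 2 = D.
    by rewrite -A exchange_big; do 2![apply: eq_bigr => ? _]; rewrite skel_sym.
  rewrite mulr2n mulrDl !mul1r -{1}A -{1}B /T !mulr_sumr -big_split -sumrB.
  apply: eq_bigr => x _; rewrite mulr_sumr -big_split -sumrB; apply: eq_bigr => y _ /=.
  ring.
have [m] := H h.
have -> : \sum_(x in verts Y) (skel_deg Y x)%:R * (h x - m) ^+ 2 =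
    D + m ^+ 2 * \sum_(x in verts Y) (skel_deg Y x)%:R.
  transitivity (D - 2 * m * (\sum_(x in verts Y) (skel_deg Y x)%:R * h x)
      + m ^+ 2 * \sum_(x in verts Y) (skel_deg Y x)%:R); last by rewrite h0; ring.
  rewrite /D !mulr_sumr -sumrB -big_split; apply: eq_bigr => x _ /=; ring.
move=> K; have : c * D <= 2 * D - 2 * T.
  rewrite -E; apply: le_trans K; rewrite ler_wpM2l // lerDl mulr_ge0 ?sqr_ge0 //.
  by apply: sumr_ge0.
lra.
Qed.

(** Each step at worst doubles the bound so far and adds two energies; the base 4 absorbs both. *)
Lemma connected_path_bound Y h x p : (forall x y, skel Y x y -> y \in verts Y) ->
  x \in verts Y -> path (skel Y) x p ->
  (h x - h (last x p)) ^+ 2 <= 4 ^+ size p * energy Y h.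
Proof.
move=> Yv; elim: p x => [|y p IH] x xY /=.
  by rewrite subrr expr0n mul1r energy_ge0.
case/andP=> sxy pyp; have yY := Yv _ _ sxy.
have A := energy_ge h xY yY sxy; have B := IH y yY pyp.
have C : energy Y h <= 4 ^+ size p * energy Y h.
  by rewrite ler_peMl ?energy_ge0 // exprn_ege1 // ler1n.
rewrite (exprS 4) -mulrA.
set a := h x in A *; set b := h y in A B *; set z := h (last y p) in B *.
have := sqr_ge0 (a - b - (b - z)); lra.
Qed.

(** Deliberately crude: for a connected graph the bound depends only on an upper bound for the
    number of vertices. *)
Lemma connected_second_eigenvalue Y (N : nat) :
  (1 < #|verts Y| <= N)%N -> (forall x y, skel Y x y -> y \in verts Y) ->
  skel_connected Y ->
  exists2 mu, second_eigenvalue (nadj_mx R Y) mu &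
    mu <= 1 - ((N%:R * N%:R * 4 ^+ N)^-1 / 2).
Proof.
case/andP=> Y1 YN Yv conn.
have N1 : (0 < N)%N by apply: leq_trans YN; apply: ltnW.
have K1 : 1 <= (N%:R * N%:R * 4 ^+ N : R).
  by rewrite !mulr_ege1 ?exprn_ege1 ?ler1n.
apply: second_eigenvalue_energy => //.
- move=> x xY; apply/card_gt0P.
  have [y yY yx] : exists2 y, y \in verts Y & y != x.
    have := Y1; rewrite (cardsD1 x) xY ltnS => /card_gt0P [y].
    by rewrite in_setD1 => /andP[]; exists y.
  have /connectP [[|z p] /= pz lz] := conn x y xY yY.
    by rewrite lz eqxx in yx.
  by exists z; rewrite inE; case/andP: pz.
- by rewrite invr_ge0 (le_trans _ K1) //= invf_le1 // (lt_le_trans _ K1).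
move=> h.
have /card_gt0P [x0 x0Y] : (0 < #|verts Y|)%N by apply: ltnW.
exists (h x0).
rewrite mulrC ler_pdivrMr ?(lt_le_trans _ K1) //.
have degN x : ((skel_deg Y x)%:R : R) <= N%:R.
  rewrite ler_nat; apply: leq_trans YN; apply: subset_leq_card.
  by apply/fintype.subsetP => y; rewrite inE => /Yv.
(* A path without repetition from [x0] has length at most [N]; the degree and the number of vertices
   give the two factors [N]. *)
apply: (@le_trans _ _ (\sum_(x in verts Y) N%:R * (4 ^+ N * energy Y h))).
  apply: ler_sum => x xY; apply: ler_pM => //; first exact: sqr_ge0.
  have /connectP [p0 pp ->] := conn x0 x x0Y xY.
  case/shortenP: pp => p pp up _.
  have -> : (h (last x0 p) - h x0) ^+ 2 = (h x0 - h (last x0 p)) ^+ 2 by ring.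
  apply: le_trans (connected_path_bound h Yv x0Y pp) _.
  rewrite ler_wpM2r ?energy_ge0 // ler_weXn2l ?ler1n //.
  apply: (leq_trans _ YN); apply: (@leq_trans (size (x0 :: p))) => //.
  rewrite cardE; apply: uniq_leq_size => // z; rewrite mem_enum.
  elim: p x0 x0Y pp {up} => [|y p IH] x1 x1Y /=; first by rewrite !inE => _ /eqP ->; rewrite inE in x1Y.
  case/andP=> sy py; rewrite in_cons => /orP[/eqP->//|]; apply: IH => //; exact: Yv sy.
rewrite sumr_const -[_ *+ _]mulr_natl.
rewrite [X in _ <= X](_ : _ = N%:R * (N%:R * (4 ^+ N * energy Y h))); last ring.
rewrite ler_wpM2r ?ler_nat //.
by rewrite !mulr_ge0 ?energy_ge0 // exprn_ge0.
Qed.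

End Energy.

(** * Spectrum of the incidence graph of a Hjelmslev plane from its counts *)

Section Hjelmslev.
Variables (R : realType) (P Q : finType) (E : P -> Q -> bool) (q r : nat).
Variable lv : nat -> rel P.
Hypothesis q1 : (1 < q)%N.
Hypothesis r0 : (0 < r)%N.
Hypothesis lv_equiv : forall k, equivalence_rel (lv k).
Hypothesis lv0 : forall x x', lv 0 x x'.
Hypothesis lvr : forall x x', lv r x x' = (x == x').
Hypothesis lv_dec : forall k x x', lv k.+1 x x' -> lv k x x'.
Hypothesis lv_card : forall k x, (0 < k <= r)%N ->
  #|[set x' | lv k x x']| = (q ^ (2 * (r - k)))%N.
Hypothesis cardP : #|P| = ((q ^ 2 + q + 1) * q ^ (2 * r.-1))%N.
Hypothesis degP : forall x, #|[set y | E x y]| = (q.+1 * q ^ r.-1)%N.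
Hypothesis degQ : forall y, #|[set x | E x y]| = (q.+1 * q ^ r.-1)%N.
Hypothesis codeg : forall k x x', (k < r)%N -> lv k x x' -> ~~ lv k.+1 x x' ->
  #|[set y | E x y && E x' y]| = (q ^ k)%N.

(** Increments of the codegree: [c 0 + ... + c m] is q^m for m < r, and the full sum up to [r] is
    the degree (q+1) q^(r-1). *)
Let c (k : nat) : R :=
  if k == 0%N then 1 else if (k < r)%N then q%:R ^+ k - q%:R ^+ k.-1 else q%:R ^+ r.

Let s (k : nat) : R :=
  if k == 0%N then (q%:R ^+ 2 + q%:R + 1) * q%:R ^+ (2 * r.-1) else q%:R ^+ (2 * (r - k)).

(** The eigenvalue on functions that are constant on level [j] classes and sum to zero over the
    classes of every lower level; [s k] is the size of a class of level [k]. *)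
Let lam (j : nat) : R := \sum_(j <= k < r.+1) c k * s k.

Let sumc m : (m < r)%N -> \sum_(0 <= k < m.+1) c k = q%:R ^+ m.
Proof.
elim: m => [|m IH] mr; first by rewrite big_nat1 /c.
rewrite big_nat_recr //= IH ?(ltnW mr) // /c /= mr; ring.
Qed.

Let lv_le k l x x' : (k <= l)%N -> lv l x x' -> lv k x x'.
Proof.
move=> /subnKC <-; elim: (l - k)%N => [|m IH]; first by rewrite addn0.
by rewrite addnS => /lv_dec.
Qed.

Let exact_level x x' : x != x' -> exists2 k, (k < r)%N & lv k x x' /\ ~~ lv k.+1 x x'.
Proof.
rewrite -lvr; elim: (r) => [|m IH] nr; first by rewrite lv0 in nr.
have [lm|nlm] := boolP (lv m x x'); first by exists m.
by have [k km H] := IH nlm; exists k => //; apply: leq_trans km _.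
Qed.

(** The levels relating [x] to [x'] form an initial segment, so the increments add up to the
    codegree. *)
Let codegE x x' : (#|[set y | E x y && E x' y]|%:R : R) =
  \sum_(0 <= k < r.+1) c k * (lv k x x')%:R.
Proof.
have rr : r = r.-1.+1 by rewrite prednK.
have [<-|nx] := eqVneq x x'.
  rewrite (eq_bigr c) => [|k _]; last by rewrite (class_refl (lv_equiv k)) mulr1.
  rewrite big_nat_recr //= {1}rr sumc -?rr //.
  rewrite (eq_card (B := [set y | E x y])) => [|y]; last by rewrite !inE andbb.
  by rewrite degP /c (gtn_eqF r0) ltnn natrM natrX -natr1 {3}rr exprS; ring.
have [k kr [lk nlk]] := exact_level nx.
rewrite (codeg kr lk nlk) natrX -(sumc kr).
rewrite [RHS](big_cat_nat _ (n := k.+1)) //=; last exact: leqW.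
rewrite [X in _ = _ + X]big_nat [X in _ = _ + X]big1 ?addr0 => [|i /andP[ki _]]; last first.
  by rewrite [lv i _ _](_ : _ = false) ?mulr0 //; apply: contraNF nlk; apply: lv_le.
rewrite big_nat [RHS]big_nat; apply: eq_bigr => i /andP[_ ik].
by rewrite (lv_le _ lk) ?mulr1.
Qed.

Let J k (u : P -> R) x := \sum_(x' | lv k x x') u x'.

Let cardE k x : (k <= r)%N -> (#|[set x' | lv k x x']|%:R : R) = s k.
Proof.
case: k => [|k] kr; last by rewrite lv_card // natrX.
rewrite (eq_card (B := P)) => [|y]; last by rewrite !inE lv0.
by rewrite cardP /s /= natrM !natrD !natrX.
Qed.

Let s0 k : (k <= r)%N -> 0 < s k.
Proof.
move=> kr; case: (pickP P) => [x _|H].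
  by rewrite -(cardE x kr) ltr0n class_card_gt0.
have : (0 < #|P|)%N by rewrite cardP muln_gt0 addn1 /= expn_gt0 ltnW.
by case/card_gt0P => x; have := H x.
Qed.

Let JE k u x : (k <= r)%N -> J k u x = s k * avg (lv k) u x.
Proof.
by move=> kr; rewrite /J /avg cardE // mulrC divfK // gt_eqF // s0.
Qed.

Definition push (u : P -> R) (y : Q) : R := \sum_(x | E x y) u x.
Definition pull (w : Q -> R) (x : P) : R := \sum_(y | E x y) w y.

Let T (u : P -> R) x := \sum_(0 <= k < r.+1) c k * J k u x.

Let pull_pushE u x : pull (push u) x = T u x.
Proof.
rewrite /pull /push /T (exchange_big_dep xpredT) //=.
transitivity (\sum_x' u x' * \sum_(0 <= k < r.+1) c k * (lv k x x')%:R).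
  apply: eq_bigr => x' _; rewrite sumr_const -mulr_natr -codegE.
  by congr (_ * _%:R); apply: eq_card => y; rewrite !inE.
under [LHS]eq_bigr do rewrite mulr_sumr.
rewrite exchange_big /=; apply: eq_bigr => k _.
rewrite /J mulr_sumr [RHS]big_mkcond /=; apply: eq_bigr => x' _.
by case: (lv k x x'); rewrite ?mulr1 ?mulr0 // mulrC.
Qed.

Let dotp_push u w : \sum_y push u y * w y = \sum_x u x * pull w x.
Proof.
rewrite /push /pull; under eq_bigr do rewrite mulr_suml.
rewrite (exchange_big_dep xpredT) //=; apply: eq_bigr => x _.
by rewrite mulr_sumr.
Qed.

(** For 0 < k < r the product [c k * s k] is q^(2r-k) - q^(2r-k-1), so the sum telescopes. *)
Let lamE m : (m < r)%N -> lam (r - m) = q%:R ^+ (r + m).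
Proof.
elim: m => [|m IH] mr.
  rewrite subn0 /lam big_nat1 /c /s (gtn_eqF r0) ltnn subnn muln0 mulr1 addn0 //.
rewrite /lam big_ltn; last by lia.
have -> : (r - m.+1).+1 = (r - m)%N by lia.
rewrite -/(lam _) IH; last by lia.
have k0 : (r - m.+1 == 0)%N = false by lia.
have kr : (r - m.+1 < r)%N by lia.
rewrite /c /s k0 kr mulrBl -!exprD.
have -> : (r - m.+1 + 2 * (r - (r - m.+1)) = r + m.+1)%N by lia.
have -> : ((r - m.+1).-1 + 2 * (r - (r - m.+1)) = r + m)%N by lia.
by rewrite subrK.
Qed.

Let K : R := (q.+1 * q ^ r.-1)%N%:R.

Let lam1E : lam 1 = q%:R ^+ (2 * r).-1.
Proof.
have := @lamE r.-1; rewrite (_ : r - r.-1 = 1)%N; last by lia.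
by rewrite (_ : r + r.-1 = (2 * r).-1)%N; [apply; lia | lia].
Qed.

Let lam0E : lam 0 = K ^+ 2.
Proof.
rewrite /lam big_ltn // -/(lam 1) lam1E /c /s /= mul1r /K natrM natrX exprMn -exprM -natr1 (mulnC r.-1).
have -> : ((2 * r).-1 = (2 * r.-1).+1)%N by lia.
rewrite (exprS _ (2 * r.-1)); ring.
Qed.

Let c_ge0 k : 0 <= c k.
Proof.
rewrite /c; case: ifP => // /negbT; rewrite -lt0n => k0; case: ifP => _.
  by rewrite subr_ge0 ler_weXn2l ?ler1n ?leq_pred // ltnW.
by rewrite exprn_ge0.
Qed.

(** The level 0 term vanishes on [u], and for k > 0 the operator [J k] is [s k] times a projection;
    the remaining weights add up to [lam 1]. *)
Lemma push_bound u : \sum_x u x = 0 ->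
  \sum_y push u y ^+ 2 <= q%:R ^+ (2 * r).-1 * \sum_x u x ^+ 2.
Proof.
move=> u0.
rewrite -lam1E.
under eq_bigr do rewrite expr2.
rewrite dotp_push; under eq_bigr do rewrite pull_pushE /T mulr_sumr.
rewrite exchange_big /= /lam mulr_suml big_ltn //.
rewrite [X in X + _]big1 ?add0r; last first.
  move=> x _; rewrite /J [X in _ * (_ * X)](_ : _ = 0) ?mulr0 //.
  by rewrite -[RHS]u0; apply: eq_bigl => x'; rewrite lv0.
rewrite big_nat [X in _ <= X]big_nat; apply: ler_sum => k /andP[k0 kr].
have -> : \sum_x u x * (c k * J k u x) = (c k * s k) * dotp u (avg (lv k) u).
  rewrite /dotp mulr_sumr; apply: eq_bigr => x _; rewrite JE //; ring.
rewrite ler_wpM2l ?mulr_ge0 ?(ltW (s0 _)) //.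
have -> : \sum_x u x ^+ 2 = dotp u u by apply: eq_bigr => x _; rewrite expr2.
have := dotp_ge0 (dev (lv k) u).
rewrite /dev !(dotpBl, dotpBr) (avg_sqr (lv_equiv k)) (dotpC (avg _ _) u); lra.
Qed.

(** Take the least level [j] with [J j u] nonzero, which exists since [J r u = u]. Averaging the
    eigenvalue equation over level [j] classes kills the lower terms and multiplies by [lam j]. *)
Let eigen_lam (u : P -> R) (mu : R) : (exists x, u x != 0) ->
  (forall x, T u x = mu * u x) -> exists2 j, (j <= r)%N & mu = lam j.
Proof.
move=> u_n0 Tu.
have Jr x : J r u x = u x.
  by rewrite /J (big_pred1 x) // => x'; rewrite lvr eq_sym.
pose nz k := `[< exists x, J k u x != 0 >].
have ex : exists k, nz k.
  by exists r; apply/asboolP; case: u_n0 => x xn; exists x; rewrite Jr.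
case: (ex_minnP ex) => j /asboolP [x xn] jmin.
have jr : (j <= r)%N by apply: jmin; apply/asboolP; case: u_n0 => z zn; exists z; rewrite Jr.
exists j => //; apply: (mulIf xn).
have zk k : (k < j)%N -> forall z, J k u z = 0.
  move=> kj z; apply/eqP; apply: contraTT kj => h; rewrite -leqNgt.
  by apply: jmin; apply/asboolP; exists z.
have JJ k : (j <= k <= r)%N -> avg (lv j) (J k u) x = s k * avg (lv j) u x.
  move=> /andP[jk kr].
  have -> : avg (lv j) (J k u) x = avg (lv j) (fun z => s k * avg (lv k) u z) x.
    by congr (avg _ _ _); apply: funext => z; rewrite JE.
  rewrite -(avg_coarser u (lv_equiv k) (lv_equiv j)); last by move=> ? ?; apply: lv_le.
  by rewrite /avg -mulr_sumr mulrA.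
have AT : avg (lv j) (T u) x = lam j * avg (lv j) u x.
  rewrite {1}/avg /T exchange_big /= mulr_suml /lam mulr_suml.
  rewrite (big_cat_nat _ (n := j)) //=; last exact: leqW.
  rewrite [X in X + _]big_nat big1 ?add0r => [|k /andP[_ kj]]; last first.
    by rewrite big1 ?mul0r // => z _; rewrite zk ?mulr0.
  rewrite big_nat [RHS]big_nat; apply: eq_bigr => k /andP[jk kr].
  by rewrite -mulr_sumr -mulrA -mulrA -JJ ?jk.
have AT2 : avg (lv j) (T u) x = mu * avg (lv j) u x.
  by rewrite /avg (eq_bigr _ (fun z _ => Tu z)) -mulr_sumr mulrA.
by rewrite JE // mulrCA -AT2 AT mulrCA.
Qed.

(** For j > 0 an eigenfunction is the difference of the indicators of two level [j] classes inside
    one class of level [j - 1]. *)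
Let lam_eigen j : (j <= r)%N -> exists2 u : P -> R, (exists x, u x != 0) &
  forall x, T u x = lam j * u x.
Proof.
move=> jr.
have key (u : P -> R) : (forall k, (k < j)%N -> forall x, J k u x = 0) ->
    constant_along (lv j) u -> forall x, T u x = lam j * u x.
  move=> z cu x; rewrite /T /lam mulr_suml (big_cat_nat _ (n := j)) //=; last exact: leqW.
  rewrite [X in X + _]big_nat big1 ?add0r => [|k /andP[_ kj]]; last by rewrite z ?mulr0.
  rewrite big_nat [RHS]big_nat; apply: eq_bigr => k /andP[jk kr].
  rewrite JE // avg_id ?mulrA // => a b ab; apply: cu; exact: lv_le ab.
have /card_gt0P [x0 _] : (0 < #|P|)%N by rewrite cardP muln_gt0 addn1 /= expn_gt0 ltnW.
case: j jr key => [|j] jr key.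
  exists (fun=> 1); first by exists x0; rewrite oner_eq0.
  by apply: key.
have sj : s j.+1 < s j.
  rewrite /s /=; case: (j) jr => [|i] ir /=; last first.
    by rewrite ltr_eXn2l ?ltr1n //; lia.
  rewrite subn1; set a := q%:R ^+ _.
  have a0 : 0 < a by rewrite exprn_gt0 // ltr0n ltnW.
  have : 0 < (q%:R ^+ 2 + q%:R : R) by rewrite addr_gt0 ?exprn_gt0 // ltr0n ltnW.
  by move=> b0; have := mulr_gt0 b0 a0; lra.
have [x1 l1 nl1] : exists2 x1, lv j x0 x1 & ~~ lv j.+1 x0 x1.
  have : ~~ ([set x' | lv j x0 x'] \subset [set x' | lv j.+1 x0 x']).
    apply: contraTN sj => /subset_leq_card; rewrite -leNgt -(ler_nat R) !cardE //.
    exact: ltnW.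
  by case/subsetPn => x1; rewrite !inE; exists x1.
pose u x : R := (lv j.+1 x0 x)%:R - (lv j.+1 x1 x)%:R.
exists u.
  exists x0; rewrite /u (class_refl (lv_equiv _)) (class_sym (lv_equiv _)) (negPf nl1).
  by rewrite subr0 oner_eq0.
apply: key => [k kj x|a b ab]; last first.
  by rewrite /u !(class_sym (lv_equiv _) _ a) !(class_sym (lv_equiv _) _ b)
      !(class_eq (lv_equiv _) ab).
have cnt z : \sum_(x' | lv k x x') (lv j.+1 z x')%:R = (lv k x z)%:R * s j.+1.
  rewrite -(cardE z jr) -natr_sum -big_mkcondr sum1_card -natrM; congr (_%:R).
  have [xz|xz] := boolP (lv k x z).
    rewrite mul1n; apply: eq_card => y; rewrite !inE.
    apply/andP/idP => [[]//|zy]; split => //.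
    by rewrite (class_eq (lv_equiv _) xz); apply: lv_le zy; apply: ltnW.
  rewrite mul0n; apply/eqP/pred0P => y; apply/negbTE; apply: contra xz => /andP[/= xy zy].

  have zy' : lv k z y by apply: lv_le zy; apply: ltnW.
  by rewrite (class_eq (lv_equiv _) xy) (class_sym (lv_equiv _)).
rewrite /J /u sumrB !cnt (_ : lv k x x1 = lv k x x0) ?subrr //.
have l1' : lv k x0 x1 by apply: lv_le l1; rewrite -ltnS.
by rewrite !(class_sym (lv_equiv _) x) (class_eq (lv_equiv _) l1').
Qed.

Let lam_gt0 j : (j <= r)%N -> 0 < lam j.
Proof.
have q0 : 0 < q%:R :> R by rewrite ltr0n ltnW.
case: j => [|j] jr.
  by rewrite lam0E exprn_gt0 // ltr0n muln_gt0 /= expn_gt0 (ltnW q1).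
have e : (r - (r - j.+1) = j.+1)%N by lia.
by rewrite -e lamE ?exprn_gt0 //; lia.
Qed.

Let cardPQ : #|P| = #|Q|.
Proof.
have A : (\sum_(x : P) #|[set y | E x y]| = \sum_(y : Q) #|[set x | E x y]|)%N.
  under eq_bigr do rewrite -sum1dep_card.
  under [RHS]eq_bigr do rewrite -sum1dep_card.
  by rewrite (exchange_big_dep xpredT).
move: A; under eq_bigr do rewrite degP; under [RHS]eq_bigr do rewrite degQ.
have K0 : (0 < q.+1 * q ^ r.-1)%N by rewrite muln_gt0 /= expn_gt0 (ltnW q1).
by rewrite !sum_nat_const => /eqP; rewrite eqn_pmul2r // => /eqP.
Qed.

(** The incidence matrix has trivial kernel on the [P] side because all [lam j] are positive, and it
    is square by double counting, hence invertible. This excludes the eigenvalue 0. *)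
Let pull_inj (w : Q -> R) : (forall x, pull w x = 0) -> forall y, w y = 0.
Proof.
move=> w0.
pose N : 'M[R]_(#|P|, #|Q|) := \matrix_(i, j) (E (enum_val i) (enum_val j))%:R.
have /row_freeP [B NB] : row_free N.
  apply/negPn/negP => nf.
  have /rowV0Pn [v /sub_kermxP vN vn0] : kermx N != 0 by rewrite kermx_eq0.
  pose u x := v 0 (enum_rank x).
  have pu0 y : push u y = 0.
    have /rowP/(_ (enum_rank y)) := vN; rewrite !mxE => <-.
    rewrite (reindex (@enum_rank P)) /=; last first.
      by exists enum_val => x _; rewrite ?enum_valK ?enum_rankK.
    rewrite /push big_mkcond; apply: eq_bigr => x _ /=; rewrite mxE !enum_rankK.
    by case: ifP; rewrite ?mulr1 ?mulr0.
  have [] := @eigen_lam u 0.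
  - have [i vi] : exists i, v 0 i != 0.
      apply/existsP; apply: contraNT vn0; rewrite negb_exists => /forallP H.
      by apply/eqP/rowP => i; rewrite mxE; apply/eqP; have := H i; rewrite negbK.
    by exists (enum_val i); rewrite /u enum_valK.
  - by move=> x; rewrite -pull_pushE mul0r /pull big1.
  by move=> j jr z; have := lam_gt0 jr; rewrite -z ltxx.
have /row_fullP [B' BN] : row_full N.
  rewrite /row_full eqn_leq rank_leq_col /= (leq_trans (eq_leq (esym cardPQ))) //.
  by have := mxrankM_maxl N B; rewrite NB mxrank1.
pose W : 'cV[R]_#|Q| := \col_j w (enum_val j).
have NW : N *m W = 0.
  apply/colP => i; rewrite !mxE -[RHS](w0 (enum_val i)) /pull [RHS]big_mkcond /=.
  rewrite [RHS](reindex (@enum_val Q Q)) /=; last first.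
    by exists enum_rank => x _; rewrite ?enum_valK ?enum_rankK.
  apply: eq_bigr => j _; rewrite !mxE; by case: ifP; rewrite ?mul1r ?mul0r.
have W0 : W = 0 by rewrite -[W]mul1mx -BN -mulmxA NW mulmx0.
by move=> y; have /colP/(_ (enum_rank y)) := W0; rewrite !mxE enum_rankK.
Qed.

Let sqr_pm (a b : R) : a ^+ 2 = b ^+ 2 <-> a = b \/ a = - b.
Proof.
rewrite (rwP eqP) eqf_sqr; split; first by case/orP=> /eqP ->; [left | right].
by case=> ->; rewrite eqxx ?orbT.
Qed.

Let power_link_spectrumP (a : R) :
  power_link_spectrum q r a <-> exists2 j, (j <= r)%N & a ^+ 2 = lam j.
Proof.
have sq i : Num.sqrt (q%:R ^+ i : R) ^+ 2 = q%:R ^+ i by rewrite sqr_sqrtr ?exprn_ge0.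
have lamS j : (0 < j <= r)%N -> lam j = q%:R ^+ (2 * r - j).
  move=> jr; have e : (r - (r - j) = j)%N by lia.
  by rewrite -{1}e lamE; [congr (_ ^+ _); lia | lia].
split.
  case=> [->|->|[i /andP[ri ir] ai]].
  - by exists 0%N => //; rewrite lam0E.
  - by exists 0%N => //; rewrite lam0E sqrrN.
  - exists (2 * r - i)%N; first by lia.
    rewrite lamS; last by lia.
    by rewrite (_ : 2 * r - (2 * r - i) = i)%N; [rewrite -sq; apply/sqr_pm | lia].
case=> [[|j] jr].
  by rewrite lam0E => /sqr_pm [->|->]; [apply: Or31 | apply: Or32].
rewrite lamS // -sq => /sqr_pm H; apply: Or33; exists (2 * r - j.+1)%N => //; lia.
Qed.

(** The eigenvalues of the bipartite graph are the numbers whose square is an eigenvalue of [T]. *)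
Theorem bipartite_spectrum (a : R) :
  (exists u w, [/\ (exists x, u x != 0) \/ (exists y, w y != 0),
     forall x, pull w x = a * u x & forall y, push u y = a * w y]) <->
  power_link_spectrum q r a.
Proof.
rewrite power_link_spectrumP; split.
  case=> u [w [n0 pw pu]].
  have a0 : a != 0.
    apply/eqP => a0; have w0 : forall y, w y = 0.
      by apply: pull_inj => x; rewrite pw a0 mul0r.
    case: n0 => [ux|[y]]; last by rewrite w0 eqxx.
    have [|j jr z] := @eigen_lam u 0 ux.
      by move=> x; rewrite -pull_pushE mul0r /pull big1 // => y _; rewrite pu a0 mul0r.
    by have := lam_gt0 jr; rewrite -z ltxx.
  apply: (@eigen_lam u).
    case: n0 => // -[y wy]; apply/not_existsP => H.
    have := pu y; rewrite /push big1 => [/esym/eqP|x _]; last first.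
      by apply/eqP/negPn/negP => h; apply: (H x).
    by rewrite mulf_eq0 (negPf a0) (negPf wy).
  move=> x; rewrite -pull_pushE /pull (eq_bigr _ (fun y _ => pu y)) -mulr_sumr.
  by rewrite -/(pull w x) pw mulrA.
case=> j jr aj; have [u [x ux] Tu] := lam_eigen jr.
have a0 : a != 0 by rewrite -sqrf_eq0 aj gt_eqF // lam_gt0.
exists (fun x => a * u x), (push u); split.
- by left; exists x; rewrite mulf_neq0.
- by move=> z; rewrite pull_pushE Tu -aj mulrA.
- by move=> y; rewrite /push -mulr_sumr.
Qed.

End Hjelmslev.

(** * The valuation ring and its residue map *)

Section Valuation.
Variable F : localField.
Implicit Types (x y : F) (k l : int).

Lemma ord_one : ord (1 : F) = 0.
Proof.
have := ordM (oner_neq0 F) (oner_neq0 F); rewrite mulr1 => H.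
by apply: (addIr (ord (1 : F))); rewrite -H add0r.
Qed.

Lemma ordN x : ord (- x) = ord x.
Proof.
have [->|x0] := eqVneq x 0; first by rewrite oppr0.
have m0 : -1 != 0 :> F by rewrite oppr_eq0 oner_eq0.
have E : ord (-1 : F) = 0.
  have := ordM m0 m0; rewrite mulrNN mulr1 ord_one; lia.
by rewrite -mulN1r ordM // E add0r.
Qed.

Lemma ordV x : x != 0 -> ord x^-1 = - ord x.
Proof.
move=> x0; have := ordM x0 (invr_neq0 x0); rewrite mulfV // ord_one; lia.
Qed.

Lemma ordX x n : x != 0 -> ord (x ^+ n) = ord x * n%:Z.
Proof.
move=> x0; elim: n => [|n IH]; first by rewrite expr0 ord_one mulr0.
by rewrite exprS ordM ?expf_neq0 // IH; lia.
Qed.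

Lemma ordge0 k : ordge ord k (0 : F). Proof. by rewrite /ordge eqxx. Qed.

Lemma ordge_le k l x : l <= k -> ordge ord k x -> ordge ord l x.
Proof. by move=> lk /orP[/eqP->|kx]; rewrite /ordge ?eqxx // (le_trans lk) ?orbT. Qed.

Lemma ordgeD k x y : ordge ord k x -> ordge ord k y -> ordge ord k (x + y).
Proof.
rewrite /ordge; have [->|x0] := eqVneq x 0; first by rewrite add0r.
have [->|y0 /= kx ky] := eqVneq y 0; first by rewrite addr0 (negPf x0).
have [//|xy0 /=] := eqVneq (x + y) 0.
by apply: le_trans (ordD x0 y0 xy0); rewrite le_min kx.
Qed.

Lemma ordgeM k l x y : ordge ord k x -> ordge ord l y -> ordge ord (k + l) (x * y).
Proof.
rewrite /ordge; have [->|x0] := eqVneq x 0; first by rewrite mul0r eqxx.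
have [->|y0 /= kx ly] := eqVneq y 0; first by rewrite mulr0 eqxx.
by rewrite ordM // lerD ?orbT.
Qed.

Lemma ordgeN k x : ordge ord k (- x) = ordge ord k x.
Proof. by rewrite /ordge oppr_eq0 ordN. Qed.

Definition vring_pred : {pred F} := fun x => ordge ord 0 x.

Lemma vring_subring : subring_closed vring_pred.
Proof.
split; rewrite /vring_pred ?unfold_in //=.
- by rewrite /ordge ord_one lexx orbT.
- by move=> x y; rewrite !unfold_in => hx hy; rewrite ordgeD ?ordgeN.
- by move=> x y; rewrite !unfold_in => hx hy; rewrite -[0]addr0 ordgeM.
Qed.

HB.instance Definition _ := GRing.isSubringClosed.Build F vring_pred vring_subring.

Record vring := VRing { vval :> F; vvalP : vval \in vring_pred }.
HB.instance Definition _ := [isSub of vring for vval].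
HB.instance Definition _ := [Choice of vring by <:].
HB.instance Definition _ := [SubChoice_isSubComNzRing of vring by <:].

Definition vunit : {pred vring} := fun a => (val a != 0) && (ord (val a) == 0).

Definition vinv (a : vring) : vring :=
  if vunit a then insubd a ((val a)^-1) else a.

Lemma vval_inv a : vunit a -> val (vinv a) = (val a)^-1.
Proof.
move=> ua; rewrite /vinv ua val_insubd ifT //.
case/andP: ua => a0 /eqP o0.
by rewrite unfold_in /ordge ordV // o0 oppr0 lexx orbT.
Qed.

Lemma vmulVx : {in vunit, left_inverse 1 vinv *%R}.
Proof.
move=> a ua; apply: val_inj; rewrite rmorphM /= vval_inv // mulVf ?rmorph1 //.
by case/andP: ua.
Qed.

Lemma vunitPl (a b : vring) : b * a = 1 -> vunit a.
Proof.
move=> ba; have E : val b * val a = 1 by rewrite -rmorphM ba rmorph1.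
have b0 : val b != 0 by apply/eqP => z; move: E (oner_neq0 F); rewrite z mul0r => <-; rewrite eqxx.
have a0 : val a != 0 by apply/eqP => z; move: E (oner_neq0 F); rewrite z mulr0 => <-; rewrite eqxx.
rewrite /vunit a0 andTb.
have oa : 0 <= ord (val a) by have := valP a; rewrite unfold_in /ordge (negPf a0).
have ob : 0 <= ord (val b) by have := valP b; rewrite unfold_in /ordge (negPf b0).
by have := ordM b0 a0; rewrite E ord_one; lia.
Qed.

Lemma vinv_out : {in [predC vunit], vinv =1 id}.
Proof. by move=> a h; rewrite /vinv ifN. Qed.

HB.instance Definition _ := GRing.ComNzRing_hasMulInverse.Build vring
  vmulVx vunitPl vinv_out.

Lemma vring_unitE (a : vring) : (a \is a GRing.unit) = (val a != 0) && (ord (val a) == 0).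
Proof. by []. Qed.

Lemma vringP (a : vring) : ordge ord 0 (val a). Proof. exact: (valP a). Qed.

Lemma vring_ex x : ordge ord 0 x -> exists a : vring, val a = x.
Proof. by move=> hx; exists (VRing hx). Qed.

Lemma ordge_unif x : ordge ord 0 (unif : F).
Proof. by rewrite /ordge ord_unif orbT. Qed.

Definition vunif : vring := VRing (ordge_unif 0).

Lemma vunifX_neq0 n : val (vunif ^+ n) != 0.
Proof. by rewrite rmorphXn expf_neq0 // unif_neq0. Qed.

Lemma ord_vunifX n : ord (val (vunif ^+ n)) = n%:Z.
Proof. by rewrite rmorphXn /= ordX ?unif_neq0 // ord_unif mul1r. Qed.

(* Divisibility by a power of the uniformizer. *)
Lemma ordge_dvd n (a : vring) :
  ordge ord n%:Z (val a) <-> exists b : vring, a = vunif ^+ n * b.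
Proof.
split; last first.
  case=> b ->; rewrite rmorphM -[n%:Z]addr0 ordgeM ?vringP //.
  by rewrite /ordge ord_vunifX lexx orbT.
move=> h; have [|b bE] := @vring_ex (val a / val (vunif ^+ n)).
  rewrite -(subrr n%:Z) ordgeM // /ordge ordV ?vunifX_neq0 // ord_vunifX lexx orbT //.
by exists b; apply: val_inj; rewrite rmorphM /= bE mulrCA mulfV ?mulr1 ?vunifX_neq0.
Qed.

Definition vres (a : vring) : residue F := res (val a).

Lemma vres_additive : {morph vres : a b / a - b}.
Proof.
have add (a b : vring) : vres (a + b) = vres a + vres b.
  by rewrite /vres rmorphD /= resD ?vringP.
move=> a b; have := add (a - b) b; rewrite subrK => ->; ring.
Qed.

Lemma vres_multiplicative : (vres 1 = 1) * {morph vres : a b / a * b}.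
Proof.
split; first by rewrite /vres rmorph1 res1.
by move=> a b; rewrite /vres rmorphM /= resM ?vringP.
Qed.

HB.instance Definition _ := GRing.isZmodMorphism.Build vring (residue F) vres vres_additive.
HB.instance Definition _ := GRing.isMonoidMorphism.Build vring (residue F) vres
  vres_multiplicative.

Lemma vres_eq0 a : (vres a == 0) = ordge ord 1 (val a).
Proof. by rewrite res_eq0 ?vringP. Qed.

Lemma vres_unit a : (a \is a GRing.unit) = (vres a != 0).
Proof.
rewrite vres_eq0 vring_unitE /ordge negb_or; have := vringP a.
by rewrite /ordge; case: eqP => //= _ h; lia.
Qed.

Lemma vres_surj c : exists a, vres a = c.
Proof.
have [x hx xc] := res_surj c.
by exists (VRing hx).
Qed.

End Valuation.

(** * The finite quotient O / pi^r *)

Section Truncation.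
Variables (F : localField) (r : nat).
Local Open Scope quotient_scope.

(** The exponent [r.-1.+1] equals [r] for r > 0 and is positive in all cases, so the ideal is
    proper. *)
Definition trunc_pred : {pred vring F} := fun a => ordge ord r.-1.+1%:Z (val a).

Lemma trunc_ideal : idealr_closed trunc_pred.
Proof.
split; rewrite ?unfold_in.
- exact: ordge0.
- by rewrite /ordge rmorph1 oner_eq0 ord_one.
move=> a u v; rewrite !unfold_in => hu hv.
rewrite rmorphD rmorphM ordgeD // -[_%:Z]add0r ordgeM //; exact: vringP.
Qed.

HB.instance Definition _ := isIdealr.Build (vring F) trunc_pred trunc_ideal.

Definition trunc := {ideal_quot trunc_pred}.
HB.instance Definition _ := GRing.ComNzRing.on trunc.
HB.instance Definition _ := Quotient.on trunc.

Definition vtrunc (a : vring F) : trunc := \pi_trunc a.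

Lemma vtrunc_additive : {morph vtrunc : a b / a - b}.
Proof. by move=> a b; rewrite /vtrunc !piE. Qed.

Lemma vtrunc_multiplicative : (vtrunc 1 = 1) * {morph vtrunc : a b / a * b}.
Proof. by split=> [|a b]; rewrite /vtrunc !piE. Qed.

HB.instance Definition _ := GRing.isZmodMorphism.Build (vring F) trunc vtrunc vtrunc_additive.
HB.instance Definition _ := GRing.isMonoidMorphism.Build (vring F) trunc vtrunc
  vtrunc_multiplicative.

Lemma vtrunc_eq0 a : (vtrunc a == 0) = ordge ord r.-1.+1%:Z (val a).
Proof.
rewrite -(raddf0 vtrunc) /vtrunc -Quotient.idealrBE subr0.
by rewrite unfold_in.
Qed.

Lemma vtrunc_surj (a : trunc) : exists x, vtrunc x = a.
Proof. by exists (repr a); rewrite /vtrunc reprK. Qed.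

Let lift (c : residue F) : vring F := projT1 (cid (vres_surj c)).
Let liftK c : vres (lift c) = c. Proof. exact: projT2 (cid (vres_surj c)). Qed.

(** Expansions in powers of the uniformizer with chosen lifts of residues as digits; finitely many
    digits represent every class, which makes the quotient finite. *)
Let digits (s : seq (residue F)) : vring F :=
  foldr (fun c x => lift c + vunif F * x) 0 s.

Let digits_approx m (x : vring F) : exists s : m.-tuple (residue F),
  ordge ord m%:Z (val (x - digits s)).
Proof.
elim: m x => [|m IH] x; first by exists [tuple]; apply: vringP.
have : ordge ord 1 (val (x - lift (vres x))).
  by rewrite -vres_eq0 rmorphB /= liftK subrr.
case/(ordge_dvd 1) => y; rewrite expr1 => xy.
have [s ys] := IH y.
exists [tuple of vres x :: s].
have -> : x - digits [tuple of vres x :: s] = vunif F * (y - digits s).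
  transitivity (x - (lift (vres x) + vunif F * digits s)) => //.
  by rewrite opprD addrA xy mulrBr.
have -> : m.+1%:Z = 1 + m%:Z by lia.
by rewrite rmorphM ordgeM // /ordge ord_unif lexx orbT.
Qed.

Let code_ex (a : trunc) : exists s : (r.-1.+1).-tuple (residue F), vtrunc (digits s) = a.
Proof.
have [x <-] := vtrunc_surj a; have [s xs] := digits_approx r.-1.+1 x.
by exists s; apply/eqP; rewrite eq_sym -subr_eq0 -rmorphB vtrunc_eq0.
Qed.

Let code a := projT1 (cid (code_ex a)).
Let decode (s : (r.-1.+1).-tuple (residue F)) := vtrunc (digits s).
Let codeK : cancel code decode. Proof. by move=> a; apply: (projT2 (cid (code_ex a))). Qed.

HB.instance Definition _ : isCountable trunc := CanIsCountable codeK.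
HB.instance Definition _ : isFinite trunc := CanIsFinite codeK.

Definition tunit : {pred trunc} := fun a => [exists b, b * a == 1].
Definition tinv (a : trunc) : trunc := odflt a [pick b | b * a == 1].

Lemma tmulVx : {in tunit, left_inverse 1 tinv *%R}.
Proof.
move=> a /existsP [b ba]; rewrite /tinv; case: pickP => [c /eqP //|H].
by have := H b; rewrite ba.
Qed.

Lemma tunitPl (a b : trunc) : b * a = 1 -> tunit a.
Proof. by move=> ba; apply/existsP; exists b; apply/eqP. Qed.

Lemma tinv_out : {in [predC tunit], tinv =1 id}.
Proof.
move=> a /existsP na; rewrite /tinv; case: pickP => // b ba; case: na; exists b.
exact: ba.
Qed.

HB.instance Definition _ := GRing.ComNzRing_hasMulInverse.Build trunc
  tmulVx tunitPl tinv_out.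

End Truncation.

Lemma truncated_ring (F : localField) (r : nat) : (0 < r)%N ->
  exists (A : finComUnitRingType) (rho : {rmorphism vring F -> A}),
    (forall a, exists x, rho x = a) /\
    (forall x, (rho x == 0) = ordge ord r%:Z (val x)).
Proof.
move=> r0; exists (trunc F r : finComUnitRingType).
exists (@vtrunc F r : {rmorphism vring F -> trunc F r}).
split; first exact: vtrunc_surj.
by move=> x; rewrite [LHS]vtrunc_eq0 prednK.
Qed.

(** * Linear algebra and counting over the chain ring O / pi^r *)

(** The matrix is the identity with row [i] replaced by [v], written as a rank one update. *)
Lemma det_replace_row (A : comNzRingType) (n : nat) (i : 'I_n) (v : 'rV[A]_n) :
  \det (1%:M + delta_mx i 0 *m (v - delta_mx 0 i)) = v 0 i.
Proof.
have := det_scalar_add_rank1 1 (delta_mx i 0 : 'cV_n) (v - delta_mx 0 i).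
rewrite mul1r expr1n mulr1 => ->.
rewrite -colE !mxE !eqxx /=; ring.
Qed.

Lemma replace_rowE (A : comNzRingType) (n : nat) (i k : 'I_n) (v : 'rV[A]_n) :
  row k (1%:M + delta_mx i 0 *m (v - delta_mx 0 i)) =
  if k == i then v else delta_mx 0 k.
Proof.
rewrite raddfD /= row1 row_mul.
have -> : row k (delta_mx i 0 : 'cV[A]_n) = (k == i)%:R%:M.
  by apply/matrixP => a b; rewrite !mxE !ord1 !eqxx andbT.
by rewrite mul_scalar_mx; case: eqP => [->|_]; rewrite ?scale1r ?scale0r ?addr0 // addrC subrK.
Qed.

Lemma card_col_family (A : finType) (n : nat) (S : 'I_n -> {set A}) :
  #|[set v : 'cV[A]_n | [forall i, v i 0 \in S i]]| = (\prod_i #|S i|)%N.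
Proof.
have -> : (\prod_i #|S i|)%N = foldr muln 1%N [seq #|S i| | i : 'I_n].
  by rewrite foldrE big_map big_enum.
rewrite -(card_family (fun i => mem (S i))) -(card_imset _ (f := fun f : {ffun 'I_n -> A} => \col_i f i)).
  apply: eq_card => v; rewrite inE; apply/forallP/imsetP => [vS|[f fS ->] i].
    exists [ffun i => v i 0]; first by apply/familyP => i; rewrite ffunE.
    by apply/colP => i; rewrite mxE ffunE.
  by rewrite mxE; move/familyP: fS.
by move=> f g /colP fg; apply/ffunP => i; have := fg i; rewrite !mxE.
Qed.

Section ChainRing.
Variables (F : localField) (r : nat) (A : finComUnitRingType).
Variable rho : {rmorphism vring F -> A}.
Hypothesis r_gt0 : (0 < r)%N.
Hypothesis rho_surj : forall a, exists x, rho x = a.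
Hypothesis rho_eq0 : forall x, (rho x == 0) = ordge ord r%:Z (val x).
Local Notation q := #|residue F|.
Local Notation pi := (rho (vunif F)).

Definition mulset (k : nat) : {set A} := [set pi ^+ k * a | a : A].

Lemma mulsetP k a : reflect (exists b, a = pi ^+ k * b) (a \in mulset k).
Proof.
apply: (iffP imsetP) => [[b _ ->]|[b ->]]; first by exists b.
by exists b.
Qed.

Lemma mulset0 : mulset 0 = [set: A].
Proof. by apply/setP => a; rewrite inE; apply/mulsetP; exists a; rewrite mul1r. Qed.

Lemma pi_r : pi ^+ r = 0.
Proof.
by apply/eqP; rewrite -rmorphXn rho_eq0; apply/(ordge_dvd r); exists 1; rewrite mulr1.
Qed.

Lemma mulset_r : mulset r = [set 0].
Proof.
apply/setP => a; rewrite inE; apply/mulsetP/eqP => [[b ->]|->].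
  by rewrite pi_r mul0r.
by exists 0; rewrite mulr0.
Qed.

Lemma mulset_le k l a : (k <= l)%N -> a \in mulset l -> a \in mulset k.
Proof.
move=> kl /mulsetP [b ->]; apply/mulsetP; exists (pi ^+ (l - k) * b).
by rewrite mulrA -exprD subnKC.
Qed.

Lemma mulset_add k a b : a \in mulset k -> b \in mulset k -> a + b \in mulset k.
Proof.
by move=> /mulsetP [c ->] /mulsetP [d ->]; apply/mulsetP; exists (c + d); rewrite mulrDr.
Qed.

Lemma mulset_mul k a b : a \in mulset k -> b * a \in mulset k.
Proof.
by move=> /mulsetP [c ->]; apply/mulsetP; exists (b * c); rewrite mulrCA.
Qed.

Lemma mulset_opp k a : (- a \in mulset k) = (a \in mulset k).
Proof.
apply/idP/idP => h; last by rewrite -mulN1r mulset_mul.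
by rewrite -[a]opprK -mulN1r mulset_mul.
Qed.

Lemma mulset_zero k : 0 \in mulset k.
Proof. by apply/mulsetP; exists 0; rewrite mulr0. Qed.

Lemma mulset_sum k (I : Type) (s : seq I) (P : pred I) (f : I -> A) :
  (forall i, P i -> f i \in mulset k) -> \sum_(i <- s | P i) f i \in mulset k.
Proof.
move=> h; elim/big_ind: _ => //; [exact: mulset_zero | by move=> *; apply: mulset_add].
Qed.

(** The annihilator of pi^k is the ideal of pi^(r-k): lift to the valuation ring, where pi^k
    cancels. *)
Lemma pi_mul_eq0 k a : (k <= r)%N -> (pi ^+ k * a == 0) = (a \in mulset (r - k)).
Proof.
move=> kr; apply/idP/mulsetP => [|[b ->]]; last first.
  by rewrite mulrA -exprD subnKC // pi_r mul0r.
have [x <-] := rho_surj a.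
rewrite -rmorphXn -rmorphM rho_eq0 => /(ordge_dvd r) [y].
rewrite -{1}(subnKC kr) exprD -mulrA => E.
exists (rho y); rewrite -rmorphXn -rmorphM; congr (rho _).
apply: val_inj; apply: (mulfI (vunifX_neq0 F k)).
by rewrite -!rmorphM E.
Qed.

Lemma one_notin_mulset : 1 \notin mulset 1.
Proof.
apply/negP => /mulsetP [b /esym]; rewrite expr1 => h.
have : pi ^+ r * b ^+ r = 1 by rewrite -exprMn h expr1n.
by rewrite pi_r mul0r => /esym/eqP; rewrite oner_eq0.
Qed.

Lemma unit_mulset a : (a \is a GRing.unit) = (a \notin mulset 1).
Proof.
have [x <-] := rho_surj a.
have [ux|nux] := boolP (x \is a GRing.unit).
  rewrite rmorph_unit //; apply/esym; apply: contra one_notin_mulset => h.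
  by rewrite -(mulVr (rmorph_unit rho ux)) mulset_mul.
have : ordge ord 1%N%:Z (val x) by move: nux; rewrite vres_unit negbK vres_eq0.
case/(ordge_dvd 1) => y xy.
have h : rho x \in mulset 1 by apply/mulsetP; exists (rho y); rewrite xy rmorphM rmorphXn.
rewrite h; apply/negbTE; apply: contra one_notin_mulset => u.
by rewrite -(mulVr u) mulset_mul.
Qed.

Let lift (c : residue F) : vring F := projT1 (cid (vres_surj c)).
Let liftK c : vres (lift c) = c. Proof. exact: projT2 (cid (vres_surj c)). Qed.

Lemma rho_lift_inj (x y : vring F) : rho x - rho y \in mulset 1 -> vres x = vres y.
Proof.
rewrite -rmorphB -[_ \in _]negbK -unit_mulset => h.
apply/eqP; rewrite -subr_eq0 -rmorphB; apply: contraNT h.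
by rewrite -vres_unit => /(rmorph_unit rho).
Qed.

(** Splitting off the digit of weight pi^k. *)
Let card_mulsetS k : (k < r)%N -> #|mulset k| = (q * #|mulset k.+1|)%N.
Proof.
move=> kr.
pose f (p : residue F * A) := pi ^+ k * rho (lift p.1) + p.2.
rewrite -cardsT -cardsX -(card_in_imset (f := f)) /=.
  apply: eq_card => a; apply/mulsetP/imsetP => [[b ->]|[[c y] /setXP[_ /= yk] ->]].
    have [x xb] := rho_surj b.
    have : ordge ord 1%N%:Z (val (x - lift (vres x))).
      by rewrite -vres_eq0 rmorphB /= liftK subrr.
    case/(ordge_dvd 1) => z xz.
    exists (vres x, pi ^+ k.+1 * rho z).
      by rewrite inE /= inE; apply/mulsetP; exists (rho z).
    rewrite /f /= exprSr -mulrA -mulrDr -rmorphM -rmorphD -xb; congr (_ * rho _).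
    by rewrite -[vunif F]expr1 -xz addrC subrK.
  case/mulsetP: yk => z ->; exists (rho (lift c) + pi * z).
  by rewrite /f /= exprSr -mulrA mulrDr.
move=> [c y] [c' y'] /setXP[_ /= /mulsetP[z ->]] /setXP[_ /= /mulsetP[z' ->]].
rewrite /f /= => E.
have cc : c = c'.
  rewrite -[c]liftK -[c']liftK; apply: rho_lift_inj.
  have : pi ^+ k * (rho (lift c) - rho (lift c') + pi * (z - z')) == 0.

    have -> : pi ^+ k * (rho (lift c) - rho (lift c') + pi * (z - z')) =
      pi ^+ k * rho (lift c) + pi ^+ k.+1 * z - (pi ^+ k * rho (lift c') + pi ^+ k.+1 * z').
      by rewrite exprSr; ring.
    by rewrite E subrr eqxx.
  rewrite pi_mul_eq0 ?(ltnW kr) // => /(mulset_le (k := 1)).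
  rewrite subn_gt0 kr => /(_ isT) h.
  have -> : rho (lift c) - rho (lift c') =
    rho (lift c) - rho (lift c') + pi * (z - z') - pi * (z - z') by ring.
  rewrite mulset_add // mulset_opp mulrC mulset_mul //.
  by apply/mulsetP; exists 1; rewrite mulr1 expr1.
by move: E; rewrite cc => /addrI ->.
Qed.

Lemma card_mulset k : (k <= r)%N -> #|mulset k| = (q ^ (r - k))%N.
Proof.
move=> kr; rewrite -{1}(subKn kr); move: (leq_subr k r); elim: (r - k)%N => [|m IH] mr.
  by rewrite subn0 mulset_r cards1.
rewrite card_mulsetS; last by lia.
by rewrite (_ : (r - m.+1).+1 = r - m)%N ?IH ?expnS //; lia.
Qed.

Lemma card_chain_ring : #|A| = (q ^ r)%N.
Proof. by rewrite -cardsT -mulset0 card_mulset // subn0. Qed.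

Definition units : {set A} := [set a | a \is a GRing.unit].

Lemma units_compl : units = ~: mulset 1.
Proof. by apply/setP => a; rewrite !inE unit_mulset. Qed.

Lemma card_units : (#|units| + q ^ r.-1 = q ^ r)%N.
Proof.
by rewrite units_compl -card_chain_ring -(cardsC (mulset 1)) addnC card_mulset // subn1.
Qed.

(** Homogeneous coordinates of points, or dually of hyperplanes, over the local ring [A]. *)
Definition unimod (n : nat) : {set 'cV[A]_n} :=
  [set v : 'cV[A]_n | [exists i, v i 0 \is a GRing.unit]].

Lemma unimodPn n (v : 'cV[A]_n) : reflect (forall i, v i 0 \in mulset 1) (v \notin unimod n).
Proof.
rewrite inE negb_exists; apply: (iffP forallP) => h i; have := h i.
  by rewrite unit_mulset negbK.
by rewrite unit_mulset negbK.
Qed.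

Lemma unimod_pairing n (v : 'cV[A]_n) (p : 'rV[A]_n) : (p *m v) 0 0 = 1 -> v \in unimod n.
Proof.
move=> pv; apply/negPn/negP => /unimodPn h.
have := one_notin_mulset; rewrite -pv mxE mulset_sum // => i _.
exact: mulset_mul.
Qed.

Lemma unimod_dual n (v : 'cV[A]_n) : v \in unimod n ->
  exists p : 'rV[A]_n, (p *m v) 0 0 = 1.
Proof.
rewrite inE => /existsP [i vi]; exists ((v i 0)^-1 *: delta_mx 0 i).
by rewrite -scalemxAl -rowE !mxE mulVr.
Qed.

Lemma unimod_mul n (g : 'M[A]_n) (v : 'cV[A]_n) : g \in unitmx ->
  (g *m v \in unimod n) = (v \in unimod n).
Proof.
move=> gu; apply/idP/idP => /unimod_dual [p pv].
  by apply: (@unimod_pairing _ _ (p *m g)); rewrite -mulmxA.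
by apply: (@unimod_pairing _ _ (p *m invmx g)); rewrite mulmxA mulmxKV.
Qed.

Lemma unimod_complete n (v : 'cV[A]_n.+1) : v \in unimod n.+1 ->
  exists2 g : 'M[A]_n.+1, g \in unitmx & col 0 g = v.
Proof.
rewrite inE => /existsP [i vi].
pose B := 1%:M + delta_mx i 0 *m (v^T - delta_mx 0 i).
have Bu : B \in unitmx by rewrite unitmxE det_replace_row mxE.
exists (xrow 0 i B)^T; first by rewrite unitmx_tr xrowE unitmx_mul unitmx_perm.
rewrite -tr_row; apply: (canLR (@trmxK _ _ _)).
have := replace_rowE i i v^T; rewrite eqxx => <-.
by apply/rowP => j; rewrite !mxE tpermL.
Qed.

Definition dot n (u v : 'cV[A]_n) : A := \sum_i u i 0 * v i 0.

Lemma dotC n (u v : 'cV[A]_n) : dot u v = dot v u.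
Proof. by apply: eq_bigr => i _; rewrite mulrC. Qed.

Lemma dotE n (u v : 'cV[A]_n) : dot u v = (u^T *m v) 0 0.
Proof. by rewrite mxE; apply: eq_bigr => i _; rewrite mxE. Qed.

Lemma dot_mull n (g : 'M[A]_n) (u v : 'cV[A]_n) : dot (g *m u) v = dot u (g^T *m v).
Proof. by rewrite !dotE trmx_mul mulmxA. Qed.

Lemma dot_delta n (i : 'I_n) (v : 'cV[A]_n) : dot (delta_mx i 0) v = v i 0.
Proof. by rewrite dotE trmx_delta -rowE mxE. Qed.

(** Equality of projective points modulo pi^k. The scalar need not be a unit here; it is one when
    [v] is unimodular and k > 0 ([level_unit]). *)
Definition level n (k : nat) (u v : 'cV[A]_n) : bool :=
  [exists a, [forall i, v i 0 - a * u i 0 \in mulset k]].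

Lemma levelP n k (u v : 'cV[A]_n) :
  reflect (exists a, exists w, v = a *: u + pi ^+ k *: w) (level k u v).
Proof.
apply: (iffP existsP) => [[a /forallP H]|[a [w ->]]].
  have /fin_all_exists [w wE] : forall i, exists b, v i 0 - a * u i 0 = pi ^+ k * b.
    by move=> i; apply/mulsetP.
  exists a; exists (\col_i w i); apply/colP => i; rewrite !mxE -wE; ring.
exists a; apply/forallP => i; rewrite !mxE.
have -> : a * u i 0 + pi ^+ k * w i 0 - a * u i 0 = pi ^+ k * w i 0 by ring.
by apply/mulsetP; exists (w i 0).
Qed.

Lemma level_mul n k (g : 'M[A]_n) (u v : 'cV[A]_n) : g \in unitmx ->
  level k (g *m u) (g *m v) = level k u v.
Proof.
move=> gu; apply/levelP/levelP => -[a [w E]]; exists a.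
  exists (invmx g *m w).
  by rewrite -[v](mulKmx gu) E mulmxDr -!scalemxAr mulKmx.
by exists (g *m w); rewrite E mulmxDr -!scalemxAr.
Qed.

Lemma level_delta n k (c : 'cV[A]_n.+1) :
  level k (delta_mx 0 0) c = [forall i, (i != 0) ==> (c i 0 \in mulset k)].
Proof.
apply/existsP/forallP => [[a /forallP H] i|H].
  apply/implyP => i0; have := H i; rewrite mxE (negPf i0) mulr0 subr0 //.
exists (c 0 0); apply/forallP => i; have /implyP := H i.
rewrite mxE eqxx andbT; case: eqP => [->|_ /(_ isT)]; last by rewrite mulr0 subr0.
by rewrite mulr1 subrr mulset_zero.
Qed.

Lemma level_refl n k (u : 'cV[A]_n) : level k u u.
Proof. by apply/levelP; exists 1; exists 0; rewrite scale1r scaler0 addr0. Qed.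

Lemma level_trans n k (u v w : 'cV[A]_n) : level k u v -> level k v w -> level k u w.
Proof.
move=> /levelP [a [x ->]] /levelP [b [y ->]]; apply/levelP.
by exists (b * a); exists (b *: x + y); apply/colP => i; rewrite !mxE; ring.
Qed.

Lemma level_unit n k (u v : 'cV[A]_n) : (0 < k)%N -> v \in unimod n -> level k u v ->
  exists2 a, a \is a GRing.unit & exists w, v = a *: u + pi ^+ k *: w.
Proof.
move=> k0 vu /levelP [a [w E]]; exists a; last by exists w.
rewrite unit_mulset; apply/negP => am; move: vu; apply/negP/unimodPn => i.
rewrite E !mxE mulset_add //; first by rewrite mulrC mulset_mul.
by apply: (mulset_le k0); apply/mulsetP; exists (w i 0).
Qed.

Lemma level_sym n k (u v : 'cV[A]_n) : u \in unimod n -> v \in unimod n ->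
  level k u v -> level k v u.
Proof.
case: k => [|k] uu vu h.
  by apply/existsP; exists 0; apply/forallP => i; rewrite mulset0 inE.
have [a au [w E]] := level_unit (ltn0Sn k) vu h.
apply/levelP; exists a^-1; exists (- a^-1 *: w); apply/colP => i.
rewrite E !mxE mulrDr mulKr // -addrA [X in _ + X](_ : _ = 0) ?addr0 //; ring.
Qed.

Lemma level_le n k l (u v : 'cV[A]_n) : (k <= l)%N -> level l u v -> level k u v.
Proof.
move=> kl /existsP [a /forallP H]; apply/existsP; exists a; apply/forallP => i.
exact: mulset_le (H i).
Qed.

Lemma level0 n (u v : 'cV[A]_n) : level 0 u v.
Proof. by apply/existsP; exists 0; apply/forallP => i; rewrite mulset0 inE. Qed.

Lemma level_r n (u v : 'cV[A]_n) : level r u v -> exists a, v = a *: u.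
Proof. by case/levelP => a [w ->]; exists a; rewrite pi_r scale0r addr0. Qed.

Let box (S0 S1 S2 : {set A}) : {set 'cV[A]_3} :=
  [set v : 'cV[A]_3 | [&& v 0 0 \in S0, v 1 0 \in S1 & v 2 0 \in S2]].

Let I3 (P : 'I_3 -> bool) : [forall i, P i] = [&& P 0, P 1 & P 2].
Proof.
apply/forallP/and3P => [H|[h0 h1 h2] [[|[|[|//]]] i3]]; first by split; apply: H.
- by rewrite (_ : Ordinal i3 = 0) //; apply: val_inj.
- by rewrite (_ : Ordinal i3 = 1) //; apply: val_inj.
- by rewrite (_ : Ordinal i3 = 2) //; apply: val_inj.
Qed.

Let card_box S0 S1 S2 : #|box S0 S1 S2| = (#|S0| * (#|S1| * #|S2|))%N.
Proof.
have := card_col_family (fun i : 'I_3 => nth finset.set0 [:: S0; S1; S2] i).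
rewrite !big_ord_recl big_ord0 muln1 /= => <-.
by apply: eq_card => v; rewrite !inE I3.
Qed.

Local Notation m := #|units|.

Let m_eq : (m = q ^ r - q ^ r.-1)%N.
Proof. by rewrite -card_units addnK. Qed.

Let q_pow k l : (q ^ k * q ^ l = q ^ (k + l))%N. Proof. by rewrite expnD. Qed.

Let r_eq : (q ^ r = q * q ^ r.-1)%N. Proof. by rewrite -expnS prednK. Qed.

Let nonunimod v : (v \in box (mulset 1) (mulset 1) (mulset 1)) = (v \notin unimod 3).
Proof.
rewrite inE -(I3 (fun i => v i 0 \in mulset 1)).
by apply/forallP/unimodPn.
Qed.

(** This and the next counts are of vectors; the factor [m], the number of units, is divided out on
    passing to points. *)
Lemma card_unimod3 : #|unimod 3| = (m * ((q ^ 2 + q + 1) * q ^ (2 * r.-1)))%N.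
Proof.
have E : unimod 3 = box [set: A] [set: A] [set: A] :\: box (mulset 1) (mulset 1) (mulset 1).
  apply/setP => v; rewrite finset.in_setD nonunimod negbK.
  by rewrite (_ : v \in box _ _ _) ?andbT // inE !finset.in_setT.
have := cardsID (box (mulset 1) (mulset 1) (mulset 1)) (box [set: A] [set: A] [set: A]).
rewrite -E (finset.setIidPr _); last by apply/fintype.subsetP => v; rewrite !inE.
rewrite !card_box !cardsT card_chain_ring card_mulset // subn1.
rewrite m_eq r_eq (mulnC 2) expnM; set a := (q ^ r.-1)%N.
move=> H; apply: (@addnI (a * (a * a))); rewrite H.
have : (a <= q * a)%N by rewrite leq_pmull // (leq_trans _ (max_card (pred1 0))) ?card1.
move/subnKC; move: (q * a - a)%N => b; nia.
Qed.

Let card_transform n (g : 'M[A]_n) (P : pred 'cV[A]_n) : g \in unitmx ->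
  #|[set v | P (g *m v)]| = #|[set v | P v]|.
Proof.
move=> gu; rewrite -(card_imset [set v | P (g *m v)] (f := mulmx g)); last first.
  by move=> v w e; rewrite -[v](mulKmx gu) e mulKmx.
apply: eq_card => v; rewrite inE; apply/imsetP/idP => [[w + ->]|Pv]; first by rewrite inE.
by exists (invmx g *m v); rewrite ?inE mulKVmx.
Qed.

Let col0_delta (u : 'cV[A]_3) : u \in unimod 3 ->
  exists2 g : 'M[A]_3, g \in unitmx & u = g *m delta_mx 0 0.
Proof. by case/unimod_complete => g gu <-; exists g; rewrite // colE. Qed.

(** A change of basis makes [u] the first basis vector, and incidence becomes the vanishing of the
    first coordinate. *)
Lemma card_lines_through (u : 'cV[A]_3) : u \in unimod 3 ->
  #|[set v in unimod 3 | dot u v == 0]| = (m * (q.+1 * q ^ r.-1))%N.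
Proof.
case/col0_delta => g gu ->.
have gtu : g^T \in unitmx by rewrite unitmx_tr.
transitivity #|[set w : 'cV[A]_3 | (w \in unimod 3) && (w 0 0 == 0)]|.
  rewrite -(card_transform (fun w => (w \in unimod 3) && (w 0 0 == 0)) gtu).
  by apply: eq_card => v; rewrite [LHS]inE [RHS]inE unimod_mul // dot_mull dot_delta.
have E : [set w : 'cV[A]_3 | (w \in unimod 3) && (w 0 0 == 0)] =
    box [set 0] [set: A] [set: A] :\: box (mulset 1) (mulset 1) (mulset 1).
  apply/setP => v; rewrite finset.in_setD nonunimod negbK [LHS]inE; congr (_ && _).
  by rewrite inE !finset.in_setT !andbT finset.in_set1.
have := cardsID (box (mulset 1) (mulset 1) (mulset 1)) (box [set 0] [set: A] [set: A]).
rewrite -E.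
have -> : box [set 0] [set: A] [set: A] :&: box (mulset 1) (mulset 1) (mulset 1) =
    box [set 0] (mulset 1) (mulset 1).
  apply/setP => v; rewrite finset.in_setI ![_ \in box _ _ _]inE !finset.in_setT !andbT finset.in_set1.
  by case: eqP => // ->; rewrite mulset_zero.
rewrite !card_box !cardsT !cards1 !mul1n card_chain_ring card_mulset // subn1.
rewrite m_eq r_eq; set a := (q ^ r.-1)%N.
move=> H; apply: (@addnI (a * a)); rewrite H.
have : (a <= q * a)%N by rewrite leq_pmull // (leq_trans _ (max_card (pred1 0))) ?card1.
move/subnKC; move: (q * a - a)%N => b; nia.
Qed.

Lemma card_level_class k (u : 'cV[A]_3) : (0 < k <= r)%N -> u \in unimod 3 ->
  #|[set v in unimod 3 | level k u v]| = (m * q ^ (2 * (r - k)))%N.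
Proof.
case/andP=> k0 kr /col0_delta [g gu ->].
transitivity #|box units (mulset k) (mulset k)|; last first.
  by rewrite card_box card_mulset // -expnD addnn -mul2n.
have giu : invmx g \in unitmx by rewrite unitmx_inv.
pose P w := (w \in unimod 3) && level k (delta_mx 0 0) w.
transitivity #|[set w | P w]|.
  rewrite -(card_transform P giu); apply: eq_card => v; rewrite [LHS]inE [RHS]inE /P.
  by rewrite unimod_mul // -[level k _ (invmx g *m v)](level_mul k _ _ gu) mulKVmx.
apply: eq_card => w; rewrite [LHS]inE [RHS]inE /P level_delta I3 /=.
have -> : w 0 0 \in units = (w 0 0 \notin mulset 1) by rewrite inE unit_mulset.
rewrite -[w \in _]negbK -nonunimod inE.
case k1: (w 1 0 \in mulset k); case k2: (w 2 0 \in mulset k); rewrite ?andbF //=.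
by rewrite (mulset_le k0 k1) (mulset_le k0 k2) !andbT.
Qed.

(** With [u] the first basis vector, [v] is a multiple of [u] plus pi^k times some [b] with a unit
    coordinate [i]. Taking the pairing with [b] as new coordinate [i], the conditions read: first
    coordinate zero, coordinate [i] in the ideal of pi^(r-k), which has q^k elements. Unimodularity
    then makes the third coordinate a unit. *)
Lemma card_common_lines k (u v : 'cV[A]_3) : (k < r)%N ->
  u \in unimod 3 -> v \in unimod 3 -> level k u v -> ~~ level k.+1 u v ->
  #|[set w in unimod 3 | (dot u w == 0) && (dot v w == 0)]| = (m * q ^ k)%N.
Proof.
move=> kr /col0_delta [g gu ->] _.
rewrite -[v](mulKVmx gu); set c := invmx g *m v; clearbody c.
rewrite !level_mul // !level_delta => /forallP lk.
have cE i : i != 0 -> exists b, c i 0 = pi ^+ k * b.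
  by move=> i0; apply/mulsetP; have /implyP := lk i; apply.
case/forallPn => i; rewrite negb_imply => /andP[i0 nci].
have /fin_all_exists [b bE] : forall j, exists b, (j != 0 -> c j 0 = pi ^+ k * b) /\ (j = 0 -> b = 0).
  move=> j; case: (eqVneq j 0) => [->|j0]; first by exists 0.
  by have [x xE] := cE j j0; exists x; split => // z; rewrite z eqxx in j0.
have bi : b i \is a GRing.unit.
  rewrite unit_mulset; apply: contra nci => /mulsetP [x]; rewrite expr1 => bx.
  by rewrite (bE i).1 // bx mulrA -exprSr; apply/mulsetP; exists x.
pose B := 1%:M + delta_mx i 0 *m (\row_j b j - delta_mx 0 i).
have Bu : B \in unitmx by rewrite unitmxE det_replace_row mxE.
have gtu : g^T \in unitmx by rewrite unitmx_tr.
have Bgu : B *m g^T \in unitmx by rewrite unitmx_mul Bu.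
have rowB (l : 'I_3) (x : 'cV[A]_3) : (B *m x) l 0 = (row l B *m x) 0 0.
  by rewrite -row_mul [RHS]mxE.
pose P (w : 'cV[A]_3) := (w \in unimod 3) && ((w 0 0 == 0) && (pi ^+ k * w i 0 == 0)).
transitivity #|[set w | P w]|.
  rewrite -(card_transform P Bgu); apply: eq_card => w; rewrite [LHS]inE [RHS]inE /P.
  rewrite unimod_mul // !dot_mull dot_delta -mulmxA; set y := g^T *m w; congr (_ && _).
  have -> : (B *m y) 0 0 = y 0 0.
    by rewrite rowB replace_rowE eq_sym (negPf i0) -rowE mxE.
  have [y0|//] := eqVneq (y 0 0) 0; rewrite !andTb; congr (_ == _).
  rewrite rowB replace_rowE eqxx mxE mulr_sumr /dot; apply: eq_bigr => j _.
  rewrite mxE mulrA; have [->|j0] := eqVneq j 0; first by rewrite y0 !mulr0.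
  by rewrite (bE j).1.
have rk : (0 < r - k)%N by rewrite subn_gt0.
have bx l : l \in mulset (r - k) -> l \in mulset 1 by apply: mulset_le.
have bz : 0 \in mulset 1 := mulset_zero 1.
have i12 : i = 1 \/ i = 2.
  by case: (i) i0 => [[|[|[|//]]] i3] // _; [left | right]; apply: val_inj.
case: i12 => ei; rewrite ei in P *.
  transitivity #|box [set 0] (mulset (r - k)) units|; last first.
    by rewrite card_box cards1 mul1n card_mulset ?leq_subr // subKn ?(ltnW kr) // mulnC.
  apply: eq_card => w; rewrite [LHS]inE [RHS]inE /P pi_mul_eq0 ?(ltnW kr) // finset.in_set1.
  rewrite -[w \in _]negbK -nonunimod inE.
  have -> : w 2 0 \in units = (w 2 0 \notin mulset 1) by rewrite inE unit_mulset.
  case: eqP => [->|]; rewrite ?andbF //.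
  by case h: (w 1 0 \in mulset (r - k)); rewrite ?andbF // bz (bx _ h) /= andbT.
transitivity #|box [set 0] units (mulset (r - k))|; last first.
  by rewrite card_box cards1 mul1n card_mulset ?leq_subr // subKn ?(ltnW kr).
apply: eq_card => w; rewrite [LHS]inE [RHS]inE /P pi_mul_eq0 ?(ltnW kr) // finset.in_set1.
rewrite -[w \in _]negbK -nonunimod inE.
have -> : w 1 0 \in units = (w 1 0 \notin mulset 1) by rewrite inE unit_mulset.
case: eqP => [->|]; rewrite ?andbF //.
by case h: (w 2 0 \in mulset (r - k)); rewrite ?andbF // bz (bx _ h) /= !andbT.
Qed.

End ChainRing.

(** * From homogeneous coordinates to vertices naming points and lines *)

Lemma sum_sig (R : nmodType) (V : finType) (P : {set V}) (f : V -> R) :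
  \sum_(x : {x | x \in P}) f (val x) = \sum_(x in P) f x.
Proof.
rewrite [RHS](reindex_omap (val : {x | x \in P} -> V) insub).
  by apply: eq_bigl => x; have xP : val x \in P := valP x; rewrite xP valK eqxx.
by move=> x xP; rewrite insubT.
Qed.

Section ProjectivePlane.
Variables (R : realType) (F : localField) (r : nat) (A : finComUnitRingType).
Variable rho : {rmorphism vring F -> A}.
Hypothesis r_gt0 : (0 < r)%N.
Hypothesis rho_surj : forall a, exists x, rho x = a.
Hypothesis rho_eq0 : forall x, (rho x == 0) = ordge ord r%:Z (val x).
Local Notation q := #|residue F|.
Local Notation U := (unimod A 3).
Local Notation level := (level rho).
Local Notation m := #|units A|.

Let m_gt0 : (0 < m)%N.
Proof. by apply/card_gt0P; exists 1; rewrite inE unitr1. Qed.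

Section Points.
Variables (V : finType) (X : 'cV[A]_3 -> V).
Hypothesis X_eq : {in U &, forall u u', X u = X u' <-> level r u u'}.

Definition point_set : {set V} := X @: U.
Local Notation pt := {x : V | x \in point_set}.

Lemma point_rep (x : pt) : exists u, u \in U /\ X u = val x.
Proof. by case: x => x /= /imsetP [u uU ->]; exists u. Qed.

Definition rep (x : pt) : 'cV[A]_3 := projT1 (cid (point_rep x)).

Lemma repU x : rep x \in U. Proof. by case: (projT2 (cid (point_rep x))). Qed.
Lemma repK x : X (rep x) = val x. Proof. by case: (projT2 (cid (point_rep x))). Qed.

Lemma level_rep_unit (x : pt) u : u \in U -> X u = val x ->
  exists2 a, a \is a GRing.unit & u = a *: rep x.
Proof.
move=> uU; rewrite -repK => /esym/(X_eq (repU x) uU) h.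
have [a au [w ->]] := level_unit rho_surj rho_eq0 r_gt0 uU h.
by exists a; rewrite // (pi_r rho_eq0) scale0r addr0.
Qed.

Lemma card_fiber (x : pt) : #|[set u in U | X u == val x]| = m.
Proof.
rewrite -(card_in_imset (f := fun a => a *: rep x)); last first.
  move=> a b _ _ /colP ab; have := repU x; rewrite inE => /existsP [i ui].
  by have := ab i; rewrite !mxE => /(mulIr ui).
apply: eq_card => u; rewrite [LHS]inE; apply/andP/imsetP => [[uU /eqP Xu]|[a au ->]].
  by have [a au ->] := level_rep_unit uU Xu; exists a => //; rewrite inE.
rewrite inE in au.
have aU : a *: rep x \in U.
  have := repU x; rewrite !inE => /existsP [i ui]; apply/existsP; exists i.
  by rewrite mxE unitrM au.
split=> //; apply/eqP; rewrite -repK; apply/esym/(X_eq (repU x) aU)/levelP.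
by exists a; exists 0; rewrite scaler0 addr0.
Qed.

(** Each point has exactly [m] coordinate vectors, so counts of vectors become counts of points. *)
Lemma card_points (p : pred pt) (z : pred 'cV[A]_3) :
  (forall (x : pt) u, u \in U -> X u = val x -> z u = p x) ->
  (m * #|[set x | p x]| = #|[set u in U | z u]|)%N.
Proof.
move=> zp.
rewrite -[RHS]sum1_card.
transitivity (\sum_(u in U | z u) \sum_(x : pt | val x == X u) 1)%N; last first.
  apply: eq_big => [u|u /andP[uU _]]; first by rewrite !inE.
  have xP : X u \in point_set by apply/imsetP; exists u.
  by rewrite (big_pred1 (Sub (X u) xP)).
rewrite (exchange_big_dep p) /=; last first.
  by move=> u x /andP[uU zu] /eqP xu; rewrite -(zp x u).
rewrite mulnC -sum_nat_const; apply: eq_big => [x|x px]; first by rewrite inE.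
rewrite inE in px.
rewrite sum1dep_card -(card_fiber x); apply: eq_card => u; rewrite !inE.
rewrite (eq_sym (val x)); case: (X u =P val x) => [e|_]; last by rewrite !andbF.
rewrite !andbT; case uU: [exists _, _] => //=.
by rewrite (zp x u) // inE.
Qed.

(** Levels are cut off at [r], where the relation is equality, so that the family is nested for
    every [k]. *)
Definition ptlevel k (x x' : pt) := level (minn k r) (rep x) (rep x').

Lemma ptlevel_equiv k : equivalence_rel (ptlevel k).
Proof.
move=> x y z; split; first exact: level_refl.
move=> xy; rewrite /ptlevel; apply/idP/idP => h.
  by apply: level_trans h; apply: (level_sym rho_surj rho_eq0) xy; rewrite ?repU.
exact: level_trans xy h.
Qed.

Lemma ptlevel0 x x' : ptlevel 0 x x'.
Proof. by rewrite /ptlevel min0n level0. Qed.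

Lemma ptlevel_r x x' : ptlevel r x x' = (x == x').
Proof.
rewrite /ptlevel minnn; apply/idP/eqP => [h|->]; last exact: level_refl.
by apply: val_inj; rewrite -!repK; apply/X_eq; rewrite ?repU.
Qed.

Lemma ptlevel_dec k x x' : ptlevel k.+1 x x' -> ptlevel k x x'.
Proof. apply: level_le; lia. Qed.

Lemma ptlevel_card k x : (0 < k <= r)%N ->
  #|[set x' | ptlevel k x x']| = (q ^ (2 * (r - k)))%N.
Proof.
case/andP=> k0 kr; apply/eqP; rewrite -(eqn_pmul2l m_gt0); apply/eqP.
rewrite -(card_level_class r_gt0 rho_surj rho_eq0 (k := k) (u := rep x)) ?k0 ?repU //.
apply: card_points => y u uU Xu; rewrite /ptlevel (minn_idPl kr).
have [a au ->] := level_rep_unit uU Xu.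
apply/idP/idP => h; apply: level_trans h _; apply/levelP.
  by exists a^-1; exists 0; rewrite scaler0 addr0 scalerA mulVr ?scale1r.
by exists a; exists 0; rewrite scaler0 addr0.
Qed.

Lemma card_all_points : #|{: pt}| = ((q ^ 2 + q + 1) * q ^ (2 * r.-1))%N.
Proof.
apply/eqP; rewrite -(eqn_pmul2l m_gt0); apply/eqP.
rewrite -(card_unimod3 r_gt0 rho_surj rho_eq0).
transitivity (m * #|[set x : pt | true]|)%N.
  by congr (_ * _)%N; apply: eq_card => x; rewrite inE.
rewrite (card_points (z := xpredT)) //; apply: eq_card => u.
by rewrite !inE andbT.
Qed.

End Points.

Section Incidence.
Variables (V : finType) (X Y : 'cV[A]_3 -> V) (E : rel V).
Hypothesis X_eq : {in U &, forall u u', X u = X u' <-> level r u u'}.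
Hypothesis Y_eq : {in U &, forall u u', Y u = Y u' <-> level r u u'}.
Hypothesis E_dot : {in U &, forall u v, E (X u) (Y v) = (dot u v == 0)}.
Local Notation P := (point_set X).
Local Notation Q := (point_set Y).
Local Notation ptX := {x : V | x \in P}.
Local Notation ptY := {x : V | x \in Q}.
Local Notation K := (q.+1 * q ^ r.-1)%N.

Let inc (x : ptX) (y : ptY) := E (val x) (val y).

Let incE x y : inc x y = (dot (rep x) (rep y) == 0).
Proof. by rewrite /inc -!repK E_dot ?repU. Qed.

Let dot_scale a (u v : 'cV[A]_3) : dot u (a *: v) = a * dot u v.
Proof. by rewrite /dot mulr_sumr; apply: eq_bigr => i _; rewrite mxE mulrCA. Qed.

Let dot_rep (u : 'cV[A]_3) (y : ptY) v : v \in U -> Y v = val y ->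
  (dot u v == 0) = (dot u (rep y) == 0).
Proof.
move=> vU Yv; have [a au ->] := level_rep_unit Y_eq vU Yv.
rewrite dot_scale; apply/eqP/eqP => [h|->]; last by rewrite mulr0.
by apply: (mulrI au); rewrite h mulr0.
Qed.

Let dot_rep' (u : 'cV[A]_3) (x : ptX) v : v \in U -> X v = val x ->
  (dot v u == 0) = (dot (rep x) u == 0).
Proof.
move=> vU Xv; have [a au ->] := level_rep_unit X_eq vU Xv.
rewrite !(dotC _ u) dot_scale; apply/eqP/eqP => [h|->]; last by rewrite mulr0.
by apply: (mulrI au); rewrite h mulr0.
Qed.

Let degX x : #|[set y | inc x y]| = K.
Proof.
apply/eqP; rewrite -(eqn_pmul2l m_gt0); apply/eqP.
rewrite -(card_lines_through r_gt0 rho_surj rho_eq0 (repU x)).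
by apply: (card_points Y_eq) => y v vU Yv; rewrite incE (dot_rep _ vU Yv).
Qed.

Let degY y : #|[set x | inc x y]| = K.
Proof.
apply/eqP; rewrite -(eqn_pmul2l m_gt0); apply/eqP.
rewrite -(card_lines_through r_gt0 rho_surj rho_eq0 (repU y)).
by apply: (card_points X_eq) => x u uU Xu; rewrite incE dotC (dot_rep' _ uU Xu).
Qed.

Let codeg k x x' : (k < r)%N -> ptlevel k x x' -> ~~ ptlevel k.+1 x x' ->
  #|[set y | inc x y && inc x' y]| = (q ^ k)%N.
Proof.
move=> kr; rewrite /ptlevel (minn_idPl (ltnW kr)) (minn_idPl kr) => l nl.
apply/eqP; rewrite -(eqn_pmul2l m_gt0); apply/eqP.
rewrite -(card_common_lines r_gt0 rho_surj rho_eq0 kr (repU x) (repU x') l nl).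
by apply: (card_points Y_eq) => y v vU Yv; rewrite !incE !(dot_rep _ vU Yv).
Qed.

Let q_gt1 : (1 < q)%N.
Proof.
rewrite -cardsT; apply: leq_trans (subset_leq_card (finset.subsetT [set 0; 1])).
by rewrite cards2 eq_sym oner_eq0.
Qed.

Let card_sub (S : {set V}) (p : pred V) :
  #|[set x : {x | x \in S} | p (val x)]| = #|[set x in S | p x]|.
Proof.
rewrite -!sum1dep_card.
transitivity (\sum_(x : {x | x \in S}) (p (val x) : nat))%N.
  by rewrite big_mkcond; apply: eq_bigr => x _; case: (p _).
rewrite (sum_sig S (fun x => (p x : nat))) [RHS]big_mkcondr.
by apply: eq_bigr => x _; case: (p _).
Qed.

Lemma plane_degX x : x \in P -> #|[set y in Q | E x y]| = K.
Proof. by move=> xP; rewrite -(degX (exist _ x xP)) /inc card_sub. Qed.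

Lemma plane_degY y : y \in Q -> #|[set x in P | E x y]| = K.
Proof. by move=> yQ; rewrite -(degY (exist _ y yQ)) /inc (card_sub _ (fun x => E x y)). Qed.

Let pushE (u : V -> R) (y : ptY) :
  push inc (fun x : ptX => u (val x)) y = \sum_(x in P | E x (val y)) u x.
Proof. by rewrite /push big_mkcond [RHS]big_mkcondr -(sum_sig P). Qed.

Let pullE (w : V -> R) (x : ptX) :
  pull inc (fun y : ptY => w (val y)) x = \sum_(y in Q | E (val x) y) w y.
Proof. by rewrite /pull big_mkcond [RHS]big_mkcondr -(sum_sig Q). Qed.

Lemma plane_bound (u : V -> R) : \sum_(x in P) u x = 0 ->
  \sum_(y in Q) (\sum_(x in P | E x y) u x) ^+ 2 <=
  q%:R ^+ (2 * r).-1 * \sum_(x in P) u x ^+ 2.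
Proof.
move=> u0.
have := @push_bound R _ _ inc q r (@ptlevel V X) q_gt1 r_gt0 (@ptlevel_equiv _ _)
  (@ptlevel0 _ _) (ptlevel_r X_eq) (@ptlevel_dec _ _) (ptlevel_card X_eq)
  (card_all_points X_eq) degX codeg (fun x => u (val x)).
rewrite (sum_sig P) => /(_ u0).
rewrite (sum_sig P (fun x => u x ^+ 2)).
by under eq_bigr do rewrite pushE; rewrite (sum_sig Q (fun y => (\sum_(x in P | E x y) u x) ^+ 2)).
Qed.

Theorem plane_spectrum (a : R) :
  (exists u w : V -> R, [/\ (exists2 x, x \in P & u x != 0) \/ (exists2 y, y \in Q & w y != 0),
     {in P, forall x, \sum_(y in Q | E x y) w y = a * u x} &
     {in Q, forall y, \sum_(x in P | E x y) u x = a * w y}]) <->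
  power_link_spectrum q r a.
Proof.
rewrite -(@bipartite_spectrum R _ _ inc q r (@ptlevel V X) q_gt1 r_gt0 (@ptlevel_equiv _ _)
  (@ptlevel0 _ _) (ptlevel_r X_eq) (@ptlevel_dec _ _) (ptlevel_card X_eq)
  (card_all_points X_eq) degX degY codeg a).
split=> [[u [w [n0 pw pu]]]|[u [w [n0 pw pu]]]].
  exists (fun x => u (val x)), (fun y => w (val y)); split.
  - case: n0 => [[x xP ux]|[y yQ wy]]; first by left; exists (exist _ x xP).
    by right; exists (exist _ y yQ).
  - by move=> x; rewrite pullE pw //; apply: (valP x).
  - by move=> y; rewrite pushE pu //; apply: (valP y).
pose ext (S : {set V}) (f : {x : V | x \in S} -> R) (x : V) : R :=
  if insub x is Some z then f z else 0.
have extE (S : {set V}) (f : {x : V | x \in S} -> R) (z : {x : V | x \in S}) : ext S f (val z) = f z by rewrite /ext valK.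
exists (ext P u), (ext Q w); split.
- case: n0 => [[x ux]|[y wy]]; first by left; exists (val x); rewrite ?extE //; apply: (valP x).
  by right; exists (val y); rewrite ?extE //; apply: (valP y).
- move=> x xP; rewrite -[x]/(val (exist (fun x => x \in P) x xP)) extE -pw -pullE.
  by apply: eq_bigr => y _; rewrite extE.
- move=> y yQ; rewrite -[y]/(val (exist (fun x => x \in Q) y yQ)) extE -pu -pushE.
  by apply: eq_bigr => x _; rewrite extE.
Qed.

End Incidence.
End ProjectivePlane.

(** * Lattices, colors and adjacency *)

Section Lattices.
Variables (F : localField) (n : nat).
Implicit Types (g h : 'M[F]_n) (x z : 'cV[F]_n) (c : F).
Local Notation O := (vring F).
Local Notation emb M := (map_mx (val : O -> F) M).

Lemma lattP g x : latt g x <-> exists y : 'cV[O]_n, x = g *m emb y.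
Proof.
split=> [[y iy ->]|[y ->]]; last first.
  by exists (emb y) => // i; rewrite mxE; apply: vringP.
have /fin_all_exists [y' y'E] : forall i, exists a : O, val a = y i ord0.
  by move=> i; apply: vring_ex.
exists (\col_i y' i); congr (_ *m _); apply/colP => i; rewrite !mxE.
by rewrite -[RHS]/(val (y' i)) y'E.
Qed.

Lemma lattD g x z : latt g x -> latt g z -> latt g (x + z).
Proof.
move=> /lattP [a ->] /lattP [b ->]; apply/lattP; exists (a + b).
by rewrite map_mxD mulmxDr.
Qed.

Lemma latt_mul g (a : O) x : latt g x -> latt g (val a *: x).
Proof.
move=> /lattP [y ->]; apply/lattP; exists (a *: y).
by rewrite map_mxZ scalemxAr.
Qed.

Lemma lattN g x : latt g x -> latt g (- x).
Proof. by move=> /(latt_mul (-1)); rewrite rmorphN rmorph1 scaleN1r. Qed.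

Lemma lattB g x z : latt g x -> latt g z -> latt g (x - z).
Proof. by move=> gx gz; apply: lattD => //; apply: lattN. Qed.

Lemma latt0 g : latt g 0.
Proof. by apply/lattP; exists 0; rewrite map_mx0 mulmx0. Qed.

Lemma latt_sum g (I : Type) (s : seq I) (P : pred I) (f : I -> 'cV[F]_n) :
  (forall i, P i -> latt g (f i)) -> latt g (\sum_(i <- s | P i) f i).
Proof. by move=> h; elim/big_ind: _ => //; [exact: latt0 | exact: lattD]. Qed.

Lemma latt_emb g (M : 'M[O]_n) x : latt (g *m emb M) x -> latt g x.
Proof.
by move=> /lattP [y ->]; apply/lattP; exists (M *m y); rewrite map_mxM mulmxA.
Qed.

Lemma latt_subP g h : (latt g `<=` latt h)%classic <-> exists M : 'M[O]_n, g = h *m emb M.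
Proof.
split=> [sub|[M ->]]; last by move=> x; apply: latt_emb.
have /fin_all_exists [y yE] : forall j, exists y : 'cV[O]_n, col j g = h *m emb y.
  move=> j; apply/lattP/sub/lattP; exists (delta_mx j 0).
  by rewrite map_delta_mx -colE.
exists (\matrix_(i, j) y j i 0); apply/matrixP => i j.
have /colP/(_ i) := yE j; rewrite !mxE => ->.
by apply: eq_bigr => k _; rewrite !mxE.
Qed.

Lemma emb_inj m p : injective (fun M : 'M[O]_(m, p) => emb M).
Proof.
move=> M N /matrixP MN; apply/matrixP => i j; apply: val_inj.
by have := MN i j; rewrite !mxE.
Qed.

Lemma det_emb (M : 'M[O]_n) : \det (emb M) = val (\det M).
Proof. exact: det_map_mx. Qed.

Lemma emb_unit (M : 'M[O]_n) : M \in unitmx -> emb M \in unitmx.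
Proof.
by rewrite !unitmxE det_emb => u; apply: rmorph_unit.
Qed.

Lemma latt_eqP g h : h \in unitmx ->
  latt g = latt h <-> exists2 M : 'M[O]_n, M \in unitmx & g = h *m emb M.
Proof.
move=> hu; split=> [E|[M Mu ->]].
  have /latt_subP [M gM] : (latt g `<=` latt h)%classic by rewrite E.
  have /latt_subP [N hN] : (latt h `<=` latt g)%classic by rewrite E.
  exists M => //.
  have : h *m emb (M *m N) = h *m emb 1%:M.
    by rewrite map_mxM mulmxA -gM -hN map_mx1 mulmx1.
  by move=> /(can_inj (mulKmx hu))/emb_inj /mulmx1_unit [].
apply/seteqP; split=> x; first exact: latt_emb.
move=> /lattP [y ->]; apply/lattP; exists (invmx M *m y).
by rewrite -mulmxA -map_mxM mulKVmx.
Qed.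

Lemma color_emb g (M : 'M[O]_n) : g \in unitmx -> g *m emb M \in unitmx ->
  color (g *m emb M) = color g + ord (val (\det M)).
Proof.
rewrite unitmx_mul => gu /andP[_]; rewrite unitmxE unitfE det_emb => M0.
rewrite /color det_mulmx ordM ?det_emb //.
by rewrite -unitfE -unitmxE.
Qed.

Lemma color_latt_le g h : g \in unitmx -> h \in unitmx ->
  (latt g `<=` latt h)%classic -> color h <= color g.
Proof.
move=> gu hu /latt_subP [M gM]; rewrite gM color_emb -?gM // lerDl.
have := gu; rewrite gM unitmx_mul => /andP[_]; rewrite unitmxE unitfE det_emb => M0.
by have := vringP (\det M); rewrite /ordge (negPf M0).
Qed.

(** Equal colors make the determinant of the integral transition matrix a unit. *)
Lemma color_latt_eq g h : g \in unitmx -> h \in unitmx ->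
  (latt g `<=` latt h)%classic -> color g = color h -> latt g = latt h.
Proof.
move=> gu hu /latt_subP [M gM] E; apply/(latt_eqP _ hu); exists M => //.
have := gu; rewrite gM unitmx_mul => /andP[_]; rewrite unitmxE unitfE det_emb => M0.
rewrite unitmxE vring_unitE M0 /=.
move: E; rewrite {1}gM color_emb -?gM // => /eqP.
by rewrite -subr_eq0 addrAC subrr add0r.
Qed.

Lemma latt_color g h : g \in unitmx -> h \in unitmx -> latt g = latt h -> color g = color h.
Proof.
by move=> gu hu E; apply/eqP; rewrite eq_le !color_latt_le // E.
Qed.

Lemma unitmx_scale c g : c != 0 -> (c *: g \in unitmx) = (g \in unitmx).
Proof.
by move=> c0; rewrite !unitmxE detZ unitrM unitrX // unitfE.
Qed.

Lemma color_scale c g : c != 0 -> g \in unitmx -> color (c *: g) = color g + ord c * n%:Z.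
Proof.
move=> c0 gu; rewrite /color detZ ordM ?expf_neq0 //; last by rewrite -unitfE -unitmxE.
by rewrite ordX // addrC.
Qed.

Lemma latt_scaleE c g x : c != 0 -> latt (c *: g) x <-> latt g (c^-1 *: x).
Proof.
move=> c0; split=> /lattP [y E]; apply/lattP; exists y.
  by rewrite E -scalemxAl scalerA mulVf // scale1r.
by rewrite -scalemxAl -E scalerA mulfV // scale1r.
Qed.

Lemma latt_scale c g h : (latt g `<=` latt h)%classic -> (latt (c *: g) `<=` latt (c *: h))%classic.
Proof.
move=> /latt_subP [M ->]; apply/latt_subP; exists M.
by rewrite scalemxAl.
Qed.

Lemma latt_scale_eq c g h : latt g = latt h -> latt (c *: g) = latt (c *: h).
Proof. by move=> E; apply/seteqP; split; apply: latt_scale; rewrite E. Qed.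

Lemma latt_mull (x g h : 'M[F]_n) : (latt g `<=` latt h)%classic ->
  (latt (x *m g) `<=` latt (x *m h))%classic.
Proof. by move=> /latt_subP [M ->]; apply/latt_subP; exists M; rewrite mulmxA. Qed.

Lemma latt_mull_eq (x g h : 'M[F]_n) : latt g = latt h -> latt (x *m g) = latt (x *m h).
Proof. by move=> E; apply/seteqP; split; apply: latt_mull; rewrite E. Qed.

Lemma same_refl g : same_vertex g g.
Proof. by exists 1; rewrite ?oner_eq0 // scale1r. Qed.

Lemma same_latt g h : latt g = latt h -> same_vertex g h.
Proof. by move=> E; exists 1; rewrite ?oner_eq0 // scale1r. Qed.

Lemma same_scale c g : c != 0 -> same_vertex (c *: g) g.
Proof. by move=> c0; exists c. Qed.

Lemma same_sym g h : same_vertex g h -> same_vertex h g.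
Proof.
case=> c c0 E; exists c^-1; first by rewrite invr_eq0.
by rewrite (latt_scale_eq _ E) scalerA mulVf // scale1r.
Qed.

Lemma same_trans g h k : same_vertex g h -> same_vertex h k -> same_vertex g k.
Proof.
case=> c c0 E [c' c'0 E']; exists (c * c'); first by rewrite mulf_neq0.
by rewrite E (latt_scale_eq _ E') scalerA.
Qed.

Lemma same_mull (x g h : 'M[F]_n) : same_vertex g h -> same_vertex (x *m g) (x *m h).
Proof. by case=> c c0 E; exists c => //; rewrite (latt_mull_eq x E) scalemxAr. Qed.

Lemma adjacentP g h : adjacent g h <-> exists2 c, c != 0 &
  (latt (unif *: g) `<` latt (c *: h))%classic /\ (latt (c *: h) `<` latt g)%classic.
Proof.
have sc (a : F) (k l : 'M[F]_n) : a != 0 -> (latt k `<` latt l)%classic -> (latt (a *: k) `<` latt (a *: l))%classic.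
  move=> a0 [s ns]; split; first exact: latt_scale.
  move=> /(@latt_scale a^-1); rewrite !scalerA mulVf // !scale1r; exact: ns.
split=> [[a [b [a0 b0 s1 s2]]]|[c c0 [s1 s2]]]; last first.
  by exists 1, c; rewrite oner_eq0 scale1r.
exists (a^-1 * b); first by rewrite mulf_neq0 ?invr_eq0.
have a0' : a^-1 != 0 by rewrite invr_eq0.
split.
  have := sc _ _ _ a0' s1.
  by rewrite !scalerA (mulrAC a^-1) mulVf // mul1r.
have := sc _ _ _ a0' s2.
by rewrite !scalerA mulVf // scale1r.
Qed.

Lemma adjacent_same g g' h h' : same_vertex g g' -> same_vertex h h' ->
  adjacent g h -> adjacent g' h'.
Proof.
move=> /same_sym [c c0 E] /same_sym [c' c'0 E'] [a [b [a0 b0 s1 s2]]].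
have e : latt ((a / c) *: g') = latt (a *: g).
  by rewrite (latt_scale_eq _ E) scalerA divfK.
have e' : latt ((b / c') *: h') = latt (b *: h).
  by rewrite (latt_scale_eq _ E') scalerA divfK.
exists (a / c), (b / c'); split; rewrite ?mulf_neq0 ?invr_eq0 //.
  by rewrite (latt_scale_eq _ e) e'.
by rewrite e e'.
Qed.

Lemma adjacent_sym g h : adjacent g h -> adjacent h g.
Proof.
case=> a [b [a0 b0 s1 s2]]; exists b, (unif * a); split => //.
- by rewrite mulf_neq0 ?unif_neq0.
- case: s2 => s ns; rewrite -scalerA; split; first exact: latt_scale.
  move=> /(@latt_scale unif^-1); rewrite !scalerA mulVf ?unif_neq0 // !mul1r -?scalerA.
  by rewrite ?scale1r.
- by rewrite -scalerA.
Qed.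

Lemma adjacent_mull (x g h : 'M[F]_n) : x \in unitmx -> adjacent g h -> adjacent (x *m g) (x *m h).
Proof.
move=> xu [a [b [a0 b0 [s1 n1] [s2 n2]]]].
have back (k l : 'M[F]_n) : (latt (x *m k) `<=` latt (x *m l))%classic -> (latt k `<=` latt l)%classic.
  by move=> /(@latt_mull (invmx x)); rewrite !mulKmx.
exists a, b; split => //; rewrite !scalemxAr; split; try exact: latt_mull.
  by move=> /back.
by move=> /back.
Qed.

End Lattices.

(** * Diagonal matrices, walks in the building, and chains of lattices *)

Section Chains.
Variables (F : localField) (n : nat).
Implicit Types (g h : 'M[F]_n) (w x z : 'cV[F]_n).
Local Notation O := (vring F).
Local Notation emb M := (map_mx (val : O -> F) M).

Definition dg (f : 'I_n -> nat) : 'M[O]_n := diag_mx (\row_j vunif F ^+ f j).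

Lemma dg_mul f f' : dg f *m dg f' = dg (fun j => (f j + f' j)%N).
Proof.
rewrite /dg mulmx_diag; congr diag_mx; apply/rowP => j.
by rewrite !mxE exprD.
Qed.

Lemma eq_dg f f' : f =1 f' -> dg f = dg f'.
Proof. by move=> e; rewrite /dg; congr diag_mx; apply/rowP => j; rewrite !mxE e. Qed.

Lemma det_dg f : \det (dg f) = vunif F ^+ (\sum_j f j).
Proof.
by rewrite /dg det_diag -prodrXr; apply: eq_bigr => j _; rewrite mxE.
Qed.

Lemma dg_unit f : emb (dg f) \in unitmx.
Proof. by rewrite unitmxE det_emb det_dg unitfE vunifX_neq0. Qed.

Lemma gdg_unit g f : (g *m emb (dg f) \in unitmx) = (g \in unitmx).
Proof. by rewrite unitmx_mul dg_unit andbT. Qed.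

Lemma color_dg g f : g \in unitmx -> color (g *m emb (dg f)) = color g + (\sum_j f j)%:Z.
Proof. by move=> gu; rewrite color_emb ?gdg_unit // det_dg ord_vunifX. Qed.

Lemma dg_const g k : g *m emb (dg (fun=> k)) = (unif ^+ k) *: g.
Proof.
apply/matrixP => i j; rewrite mxE (bigD1 j) //= big1 ?addr0 => [|l lj].
  rewrite !mxE eqxx mulr1n mulrC; congr (_ * _); exact: (rmorphXn (val : O -> F)).
by rewrite !mxE (negPf lj) mulr0n; apply: mulr0.
Qed.

Lemma latt_dg_le g f f' : (forall j, (f j <= f' j)%N) ->
  (latt (g *m emb (dg f')) `<=` latt (g *m emb (dg f)))%classic.
Proof.
move=> le; apply/latt_subP; exists (dg (fun j => f' j - f j)%N).
by rewrite -mulmxA -map_mxM dg_mul; congr (_ *m emb _); apply: eq_dg => j; rewrite subnKC.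
Qed.

Lemma latt_dg_lt g f f' : g \in unitmx -> (forall j, (f j <= f' j)%N) -> (exists j, f j != f' j) ->
  (latt (g *m emb (dg f')) `<` latt (g *m emb (dg f)))%classic.
Proof.
move=> gu le [j ne]; split; first exact: latt_dg_le.
move=> /color_latt_le; rewrite !gdg_unit !color_dg // => /(_ gu gu).
rewrite lerD2l lez_nat; apply/negP; rewrite -ltnNge.
rewrite (bigD1 j) //= [X in (_ < X)%N](bigD1 j) //= -addSn leq_add //.
  by rewrite ltn_neqAle ne le.
exact: leq_sum.
Qed.

Lemma adjacent_dg g f f' : g \in unitmx -> (forall j, (f j <= f' j <= (f j).+1)%N) ->
  (exists j, f' j != f j) -> (exists j, f' j != (f j).+1) ->
  adjacent (g *m emb (dg f)) (g *m emb (dg f')).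
Proof.
move=> gu le [j nj] [k nk]; apply/adjacentP; exists 1; rewrite ?oner_eq0 // scale1r.
split; last first.
  by apply: latt_dg_lt => // [i|]; [case/andP: (le i) | exists j; rewrite eq_sym].
rewrite -[unif]expr1 -dg_const -mulmxA -map_mxM dg_mul.
apply: latt_dg_lt => //; first by move=> i; rewrite addn1; case/andP: (le i).
by exists k; rewrite addn1.
Qed.

(** Walks of a given length in the one-skeleton, with matrices taken up to homothety; the length is
    what [displacement_gt] controls. *)
Inductive near : nat -> 'M[F]_n -> 'M[F]_n -> Prop :=
| near0 g h : g \in unitmx -> h \in unitmx -> same_vertex g h -> near 0 g h
| nearS l g h k : near l g h -> k \in unitmx -> adjacent h k -> near l.+1 g k.

Lemma near_unit l g h : near l g h -> g \in unitmx /\ h \in unitmx.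
Proof. by elim=> // {}l {}g {}h k _ [gu hu] ku _. Qed.

Lemma near_same l g h k : near l g h -> k \in unitmx -> same_vertex h k -> near l g k.
Proof.
case=> [g' h' gu hu s ku s'|l' g' h' k' N k'u a ku s].
  by apply: near0 => //; apply: same_trans s s'.
by apply: nearS N ku _; apply: adjacent_same a => //; apply: same_refl.
Qed.

Lemma near_trans l l' g h k : near l g h -> near l' h k -> near (l + l') g k.
Proof.
move=> N N'; elim: N' g N => [{}h {}k hu ku s|{}l' {}h k' {}k _ IH ku a] g N.
  by rewrite addn0; apply: near_same N ku s.
by rewrite addnS; apply: nearS ku a; apply: IH.
Qed.

Lemma near_adj g h : g \in unitmx -> h \in unitmx -> adjacent g h -> near 1 g h.
Proof. by move=> gu hu a; apply: nearS hu a; apply: near0 => //; apply: same_refl. Qed.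

Lemma near_sym l g h : near l g h -> near l h g.
Proof.
elim=> [{}g {}h gu hu s|{}l {}g {}h k N IH ku a]; first by apply: near0 => //; apply: same_sym.
have [gu hu] := near_unit N.
by rewrite -add1n; apply: near_trans IH; apply: near_adj => //; apply: adjacent_sym.
Qed.

Lemma near_walk l g h : near l g h -> exists w : nat -> GL F n,
  [/\ forall i, (i < l)%N -> adjacent (val (w i)) (val (w i.+1)),
      same_vertex g (val (w 0%N)) & val (w l) = h].
Proof.
elim=> [{}g {}h gu hu s|{}l {}g {}h k N [w [wa w0 wl]] ku a].
  by exists (fun=> exist _ h hu).
exists (fun i => if (i <= l)%N then w i else exist _ k ku); split => //.
- move=> i; rewrite ltnS => il; rewrite il; case: ltnP => li; first exact: wa.
  have -> : i = l by apply/eqP; rewrite eqn_leq il.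
  by rewrite wl.
- by rewrite ltnn.
Qed.

Lemma near_mull l (x g h : 'M[F]_n) : x \in unitmx -> near l g h -> near l (x *m g) (x *m h).
Proof.
move=> xu; elim=> [{}g {}h gu hu s|{}l {}g {}h k N IH ku a].
  by apply: near0; rewrite ?unitmx_mul ?xu //; apply: same_mull.
by apply: nearS IH _ _; rewrite ?unitmx_mul ?xu //; apply: adjacent_mull.
Qed.

Lemma displacement_near G m l (x g h : 'M[F]_n) : displacement_gt G m -> G x -> near l g h ->
  (l <= m)%N -> same_vertex (x *m g) h -> is_scalar_mx x.
Proof.
move=> disp Gx /near_walk [w [wa w0 wl]] lm s.
apply/negPn/negP => ns; have := disp x Gx ns l w wa.
rewrite wl => /(_ _); rewrite ltnNge lm => H; suff // : false by [].
apply: H; apply: same_trans s; apply: same_mull; exact: same_sym.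
Qed.

(* The lattice generated by g O^n and w has a basis: replace a column of g
   along which the coordinate of w has minimal valuation. *)
Lemma latt_adjoin g w : g \in unitmx -> exists2 h, h \in unitmx &
  forall x, latt h x <-> exists (c : O) z, latt g z /\ x = val c *: w + z.
Proof.
move=> gu; pose y := invmx g *m w.
have gy : g *m y = w by rewrite mulKVmx.
clearbody y.
case: (pselect (latt g w)) => [gw|ngw].
  exists g => // x; split=> [gx|[c [z [gz ->]]]]; last by apply: lattD => //; apply: latt_mul.
  by exists 0, x; rewrite rmorph0 scale0r add0r.
have [j0 yj0] : exists j, ~~ ordge ord 0 (y j 0).
  apply/existsP; apply: contra_notT ngw; rewrite negb_exists => /forallP H.
  by rewrite -gy; exists y => // i; have := H i; rewrite negbK.
have neg i : ~~ ordge ord 0 (y i 0) -> ord (y i 0) < 0.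
  by rewrite /ordge negb_or -ltNge => /andP[].
have [j yj jmin] : exists2 j, ~~ ordge ord 0 (y j 0) &
    forall i, ~~ ordge ord 0 (y i 0) -> ord (y j 0) <= ord (y i 0).
  case: (@arg_maxnP _ j0 (fun j => ~~ ordge ord 0 (y j 0)) (fun j => absz (ord (y j 0)))) => // j yj jmax.
  by exists j => // i yi; have := jmax i yi; have := neg i yi; have := neg j yj; lia.
have yj0' : y j 0 != 0 by apply: contra yj => /eqP ->; apply: ordge0.
have oj : ord (y j 0) < 0 by exact: neg.
have quo i : ordge ord 0 (y i 0 / y j 0).
  have [->|yi0] := eqVneq (y i 0) 0; first by rewrite mul0r ordge0.
  rewrite /ordge ordM ?invr_eq0 // ordV // subr_ge0; apply/orP; right.
  have [|H] := boolP (ordge ord 0 (y i 0)); last exact: jmin.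
  by rewrite /ordge (negPf yi0) /= => h; apply: le_trans h; apply: ltW.
have inv : ordge ord 0 (y j 0)^-1.
  by rewrite /ordge ordV // oppr_ge0 ltW ?orbT.
(* The identity with column [j] replaced by [y]. *)
pose E : 'M[F]_n := (1%:M + delta_mx j 0 *m (y^T - delta_mx 0 j))^T.
have Eu : E \in unitmx by rewrite unitmx_tr unitmxE det_replace_row mxE unitfE.
have Ez (v : 'cV[F]_n) i : (E *m v) i 0 = if i == j then y j 0 * v j 0 else v i 0 + y i 0 * v j 0.
  have -> : E *m v = v + v j 0 *: (y - delta_mx j 0).
    rewrite /E raddfD /= trmx1 trmx_mul raddfB /= trmxK !trmx_delta mulmxDl mul1mx -mulmxA -rowE.
    by rewrite [row j v]mx11_scalar mul_mx_scalar mxE.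
  rewrite !mxE eqxx andbT; case: eqP => [->|_]; rewrite ?mulr1n ?mulr0n; ring.
have hu : g *m E \in unitmx by rewrite unitmx_mul gu.
exists (g *m E) => // x; split.
  move=> [v vi ->].
  have [a aE] := vring_ex (vi j).
  exists a, (g *m (v - v j 0 *: delta_mx j 0)); split.
    exists (v - v j 0 *: delta_mx j 0) => // i; rewrite !mxE eqxx andbT.
    case: eqP => [->|_]; first by rewrite mulr1 subrr ordge0.
    by rewrite mulr0 subr0; apply: vi.
  rewrite aE -mulmxA -gy scalemxAr -mulmxDr; congr (_ *m _); apply/colP => i.
  rewrite Ez !mxE eqxx andbT; case: eqP => [->|_]; rewrite ?mulr1 ?mulr0; ring.
case=> c [z [[v vi ->] ->]].
pose u : 'cV[F]_n := \col_i (if i == j then val c + v j 0 / y j 0 else v i 0 - y i 0 / y j 0 * v j 0).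
exists u.
  move=> i; rewrite mxE; case: eqP => _.
    by rewrite ordgeD ?vringP // -[0]addr0 ordgeM //; apply: vi.
  by rewrite ordgeD ?vi // ordgeN -[0]addr0 ordgeM // ?quo //; apply: vi.
rewrite -mulmxA -gy scalemxAr -mulmxDr; congr (_ *m _); apply/colP => i.
rewrite Ez !mxE eqxx; case: eqP => [->|_]; field; exact: yj0'.
Qed.

(* An index q sublattice is maximal. *)
Lemma latt_color_one g h w : g \in unitmx -> h \in unitmx ->
  (latt h `<=` latt g)%classic -> color h = color g + 1 ->
  latt g w -> ~ latt h w ->
  forall x, latt g x -> exists (c : O) z, latt h z /\ x = val c *: w + z.
Proof.
move=> gu hu sub ch gw nhw x gx.
have [k ku kE] := latt_adjoin w hu.
have kg : (latt k `<=` latt g)%classic.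
  by move=> v /kE [c [z [hz ->]]]; apply: lattD; [apply: latt_mul | apply: sub].
have hk : (latt h `<=` latt k)%classic.
  by move=> v hv; apply/kE; exists 0, v; rewrite rmorph0 scale0r add0r.
have kw : latt k w.
  by apply/kE; exists 1, 0; rewrite rmorph1 scale1r addr0; split => //; apply: latt0.
have c1 := color_latt_le ku gu kg; have c2 := color_latt_le hu ku hk.
have c3 : color h != color k.
  by apply/eqP => e; apply: nhw; rewrite (color_latt_eq hu ku hk e).
have e : color k = color g by lia.
by apply/kE; rewrite (color_latt_eq ku gu kg e).
Qed.

(** The determinant of the transition matrix has valuation one, so [unif] times its inverse is a
    unit times the adjugate, which is integral. *)
Lemma latt_color_one_unif g h : g \in unitmx -> h \in unitmx ->
  (latt h `<=` latt g)%classic -> color h = color g + 1 ->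
  (latt (unif *: g) `<=` latt h)%classic.
Proof.
move=> gu hu /latt_subP [M hM] ch.
have o1 : ord (val (\det M)) = 1.
  by apply: (addrI (color g)); rewrite -color_emb -?hM // ch.
have d0 : val (\det M) != 0.
  by have := hu; rewrite hM unitmx_mul => /andP[_]; rewrite unitmxE unitfE det_emb.
have [u uE] : exists u : O, val u = unif / val (\det M).
  apply: vring_ex; rewrite /ordge ordM ?unif_neq0 ?invr_eq0 //.
  by rewrite ordV // ord_unif o1 subrr lexx orbT.
apply/latt_subP; exists (u *: \adj M).
rewrite hM -mulmxA -map_mxM -scalemxAr mul_mx_adj map_mxZ map_scalar_mx.
rewrite -scalemxAr mul_mx_scalar scalerA; congr (_ *: _).
by rewrite -[X in _ = X * _]/(val u) uE divfK.
Qed.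

(** Take [w] in the first lattice but not in the second. Because the chain does not fold,
    [unif ^+ i *: w] lies in [G i] but not in [G i.+1], and so generates each successive
    quotient. *)
Lemma geodesic_cyclic (r : nat) (G : nat -> 'M[F]_n) : (0 < r)%N ->
  (forall i, (i <= r)%N -> G i \in unitmx) ->
  (forall i, (i < r)%N -> (latt (G i.+1) `<=` latt (G i))%classic /\
     color (G i.+1) = color (G i) + 1) ->
  (forall i, (i.+2 <= r)%N -> ~ (latt (unif *: G i) `<=` latt (G i.+2))%classic) ->
  exists2 w, latt (G 0%N) w &
    forall x, latt (G 0%N) x -> exists (c : O) z, latt (G r) z /\ x = val c *: w + z.
Proof.
move=> r0 Gu Gs Gc.
have [w w0 nw1] : exists2 w, latt (G 0%N) w & ~ latt (G 1%N) w.
  apply: contrapT => H; have [s c] := Gs 0%N r0.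
  have : (latt (G 0%N) `<=` latt (G 1%N))%classic.
    by move=> x gx; apply: contrapT => nx; apply: H; exists x.
  by move=> /(color_latt_le (Gu 0%N isT) (Gu 1%N r0)); rewrite c; lia.
pose v i : 'cV[F]_n := unif ^+ i *: w.
have vi i : (i < r)%N -> latt (G i) (v i) /\ ~ latt (G i.+1) (v i).
  elim: i => [|i IH] ir; first by rewrite /v expr0 scale1r.
  have [gi ngi] := IH (ltnW ir).
  have [s c] := Gs i (ltnW ir).
  have [s' c'] := Gs i.+1 ir.
  have u0 : G i \in unitmx by apply: Gu; lia.
  have u1 : G i.+1 \in unitmx by apply: Gu; lia.
  have u2 : G i.+2 \in unitmx by apply: Gu; lia.
  have vS : v i.+1 = unif *: v i by rewrite /v exprS scalerA.
  have pi1 := latt_color_one_unif u0 u1 s c.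
  have un x k : latt k x -> latt (unif *: k) (unif *: x).
    by move=> kx; apply/latt_scaleE; rewrite ?unif_neq0 // scalerA mulVf ?unif_neq0 // scale1r.
  split; first by rewrite vS; apply: pi1; apply: un.
  (* Otherwise [G i.+2] would contain [unif *: v i] and [unif *: G i.+1], which together generate
     [unif *: G i]. *)
  move=> bad; apply: (Gc i ir) => x /(latt_scaleE _ _ (unif_neq0 F)) gx.
  have [a [z [gz E]]] := latt_color_one u0 u1 s c gi ngi gx.
  have -> : x = val a *: v i.+1 + unif *: z.
    rewrite vS -[x](scale1r x) -(mulfV (unif_neq0 F)) -scalerA E scalerDr !scalerA.
    by rewrite (mulrC unif).
  apply: lattD; first exact: latt_mul.
  by apply: (latt_color_one_unif u1 u2 s' c'); apply: un.
exists w => //.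
have key i : (i <= r)%N -> forall x, latt (G 0%N) x ->
    exists (c : O) z, latt (G i) z /\ x = val c *: w + z.
  elim: i => [|i IH] ir x gx.
    by exists 0, x; rewrite rmorph0 scale0r add0r.
  have [a [z [gz ->]]] := IH (ltnW ir) x gx.
  have [s c] := Gs i ir; have [gi ngi] := vi i ir.
  have [b [z' [gz' ->]]] := latt_color_one (Gu i (ltnW ir)) (Gu i.+1 ir) s c gi ngi gz.
  exists (a + b * vunif F ^+ i), z'; split=> //.
  by rewrite addrA rmorphD rmorphM rmorphXn scalerDl /v scalerA.
exact: key.
Qed.

End Chains.

(** * A basis adapted to a closed chain of lattices *)

Section StandardForm.
Variables (F : localField) (n : nat).
Local Notation O := (vring F).
Local Notation emb M := (map_mx (val : O -> F) M).

Definition flag_dg (r i : nat) : 'M[O]_n := dg F (fun j : 'I_n => if (j < i)%N then r else 0%N).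

Lemma sum_ltn (r i : nat) : (i <= n)%N ->
  (\sum_(j < n) (if (j < i)%N then r else 0) = i * r)%N.
Proof.
by move=> ilen; rewrite -big_mkcond (big_ord_narrow ilen) sum_nat_const card_ord.
Qed.

Lemma color_flag (g : 'M[F]_n) r i : g \in unitmx -> (i <= n)%N ->
  color (g *m emb (flag_dg r i)) = color g + (i * r)%N%:Z.
Proof. by move=> gu ilen; rewrite color_dg // sum_ltn. Qed.

(* Nakayama's lemma for O^n modulo unif^r. *)
Lemma det_unit_mod (r : nat) (a C Y : 'M[O]_n) : (0 < r)%N ->
  a *m C + vunif F ^+ r *: Y = 1%:M -> a \in unitmx.
Proof.
move=> r0 E; rewrite unitmxE vres_unit.
have : map_mx (@vres F) a *m map_mx (@vres F) C = 1%:M.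
  have z : vres (vunif F ^+ r) = 0.
    by apply/eqP; rewrite vres_eq0 /ordge ord_vunifX lez_nat r0 orbT.
  rewrite -map_mxM -(map_mx1 (@vres F)) -E map_mxD.
  by rewrite (_ : map_mx _ (_ *: Y) = 0) ?addr0 // map_mxZ /= z scale0r.
move=> /(congr1 determinant); rewrite det_mulmx det1 !det_map_mx => h.
have h' : vres (\det a) * vres (\det C) = 1 := h.
by apply/eqP => z; move: h'; rewrite z mul0r => /esym/eqP; rewrite oner_eq0.
Qed.

(** Generators of the successive cyclic quotients span [G 0] modulo [G n], which is [unif ^+ r]
    times [G 0]; by Nakayama they form a basis. Each [G i] is spanned by the generators from the
    [i]-th on together with [G n]. *)
Lemma standard_form (r : nat) (G : nat -> 'M[F]_n) : (0 < r)%N ->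
  (forall i, (i <= n)%N -> G i \in unitmx) ->
  (forall i, (i < n)%N -> (latt (G i.+1) `<=` latt (G i))%classic) ->
  (forall i, (i < n)%N -> exists2 w, latt (G i) w &
    forall x, latt (G i) x -> exists (c : O) z, latt (G i.+1) z /\ x = val c *: w + z) ->
  latt (G n) = latt (unif ^+ r *: G 0%N) ->
  exists2 W, W \in unitmx & forall i, (i <= n)%N -> latt (G i) = latt (W *m emb (flag_dg r i)).
Proof.
move=> r0 Gu Gs Gw Gn.
have /fin_all_exists [w wE] : forall i : 'I_n, exists w, latt (G i) w /\
    forall x, latt (G i) x -> exists (c : O) z, latt (G i.+1) z /\ x = val c *: w + z.
  by move=> i; have [w] := Gw i (ltn_ord i); exists w.
have nested i j : (i <= j <= n)%N -> (latt (G j) `<=` latt (G i))%classic.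
  case/andP=> /subnKC <-; elim: (j - i)%N => [|m IH] mn; first by rewrite addn0.
  rewrite addnS; move=> x /Gs h; apply: IH; first by lia.
  by apply: h; lia.
pose W : 'M[F]_n := \matrix_(i, j) w j i 0.
have We (c : 'cV[F]_n) : W *m c = \sum_j c j 0 *: w j.
  apply/colP => i; rewrite mxE summxE; apply: eq_bigr => j _.
  by rewrite !mxE mulrC.
(* Here [m] counts from the end of the chain: only the last [m] generators are needed modulo
   [G n]. *)
have key m x : (m <= n)%N -> latt (G (n - m)%N) x -> exists c : 'cV[O]_n, exists z,
    [/\ forall j : 'I_n, (j < n - m)%N -> c j 0 = 0, latt (G n) z & x = W *m emb c + z].
  elim: m x => [|m IH] x mn gx.
    exists 0, x; split; first by move=> j _; rewrite mxE.
    - by rewrite subn0 in gx.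
    - by rewrite map_mx0 mulmx0 add0r.
  have lt : (n - m.+1 < n)%N by lia.
  have S : ((n - m.+1).+1 = n - m)%N by lia.
  have [wg H] := wE (Ordinal lt).
  have [c [z [gz ->]]] := H x gx.
  rewrite /= S in gz.
  have [d [z' [d0 gz' ->]]] := IH z (ltnW mn) gz.
  exists (d + c *: delta_mx (Ordinal lt) 0), z'; split => //.
    move=> j jm; rewrite !mxE d0; last by lia.
    rewrite add0r (_ : j == Ordinal lt = false) ?mulr0 //.
    by apply/negbTE; rewrite neq_ltn jm.
  rewrite map_mxD map_mxZ map_delta_mx mulmxDr -scalemxAr addrA; congr (_ + _).
  rewrite addrC; congr (_ + _ *: _); rewrite -colE; apply/colP => i.
  by rewrite !mxE.
have G0u : G 0%N \in unitmx by apply: Gu.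
have piG0 x : latt (G n) x -> exists y : 'cV[O]_n, x = G 0%N *m emb (vunif F ^+ r *: y).
  rewrite Gn => /lattP [y ->]; exists y.
  by rewrite map_mxZ rmorphXn /= -scalemxAr scalemxAl.
have WG0 : (latt W `<=` latt (G 0%N))%classic.
  move=> x /lattP [y ->]; rewrite We; apply: latt_sum => j _; rewrite mxE; apply: latt_mul.
  by apply: (nested 0%N j); [rewrite /= ltnW | have [] := wE j].
have /latt_subP [a Wa] := WG0.
have /fin_all_exists [cy cyE] : forall j : 'I_n, exists p : 'cV[O]_n * 'cV[O]_n,
    col j (1%:M) = a *m p.1 + vunif F ^+ r *: p.2.
  move=> j; have : latt (G (n - n)%N) (G 0%N *m emb (col j 1%:M)).
    by rewrite subnn; apply/lattP; exists (col j 1%:M).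
  case/(key n _ (leqnn n)) => c [z [_ /piG0 [y ->] E]].
  exists (c, y) => /=; apply: (@emb_inj F n 1); apply: (can_inj (mulKmx G0u)).
  by rewrite E Wa map_mxD map_mxM mulmxDr mulmxA.
have au : a \in unitmx.
  apply: (@det_unit_mod r a (\matrix_(i, j) (cy j).1 i 0) (\matrix_(i, j) (cy j).2 i 0) r0).
  apply/matrixP => i j; have /colP/(_ i) := cyE j; rewrite !mxE => ->.
  by congr (_ + _); apply: eq_bigr => k _; rewrite !mxE.
have WE : latt W = latt (G 0%N) by apply/latt_eqP => //; exists a.
exists W; first by rewrite Wa unitmx_mul G0u emb_unit.
move=> i ilen; apply/seteqP; split=> x.
  rewrite -{1}(subKn ilen) => /(key (n - i)%N _ (leq_subr i n)) [c [z [c0 /piG0 [y zE] ->]]].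
  rewrite subKn // in c0.
  apply: lattD.
    apply/lattP; exists c; rewrite -mulmxA -map_mxM; congr (_ *m emb _).
    apply/colP => j; rewrite mul_diag_mx !mxE; case: ifP => [/c0 ->|_]; first by rewrite mulr0.
    by rewrite mul1r.
  have : latt W (G 0%N *m emb y) by rewrite WE; apply/lattP; exists y.
  case/lattP => y' yE; apply/lattP.
  exists (\col_j (if (j < i)%N then y' j 0 else vunif F ^+ r * y' j 0)).
  rewrite zE map_mxZ -scalemxAr yE scalemxAr -map_mxZ -mulmxA -map_mxM; congr (_ *m emb _).
  by apply/colP => j; rewrite mul_diag_mx !mxE; case: ifP => _; rewrite ?expr0 ?mul1r.
move=> /lattP [y ->].
rewrite -mulmxA -map_mxM We; apply: latt_sum => j _.
rewrite mxE mul_diag_mx !mxE; case: ltnP => ji.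
  rewrite mulrC rmorphM -scalerA; apply: latt_mul.
  apply: (nested i n); first by rewrite ilen leqnn.
  rewrite Gn rmorphXn /=; apply/latt_scaleE; rewrite ?expf_neq0 ?unif_neq0 //.
  rewrite scalerA mulVf ?expf_neq0 ?unif_neq0 // scale1r.
  by apply: (nested 0%N j); [rewrite /= ltnW | have [] := wE j].
by apply: latt_mul; apply: (nested i j); [rewrite ji ltnW | have [] := wE j].
Qed.

End StandardForm.

(** * Comparison of lattices in a common basis *)

Section Diagonal.
Variables (F : localField) (n : nat).
Implicit Types (g h W : 'M[F]_n) (f : 'I_n -> nat).
Local Notation O := (vring F).
Local Notation emb M := (map_mx (val : O -> F) M).

Lemma latt_dg_leP W f f' : W \in unitmx ->
  (latt (W *m emb (dg F f)) `<=` latt (W *m emb (dg F f')))%classic ->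
  forall j, (f' j <= f j)%N.
Proof.
move=> Wu /latt_subP [M]; rewrite -mulmxA -map_mxM => /(can_inj (mulKmx Wu))/emb_inj E j.
have /matrixP/(_ j j) := E; rewrite mul_diag_mx !mxE eqxx mulr1n => Ej.
have : ordge ord (f' j)%:Z (val (vunif F ^+ f j)) by apply/ordge_dvd; exists (M j j).
by rewrite /ordge (negPf (vunifX_neq0 _ _)) ord_vunifX.
Qed.

Lemma latt_scale_unit c g : c != 0 -> ord c = 0 -> latt (c *: g) = latt g.
Proof.
move=> c0 oc; have [u uE] : exists u : O, val u = c.
  by apply: vring_ex; rewrite /ordge oc lexx orbT.
have [v vE] : exists v : O, val v = c^-1.
  by apply: vring_ex; rewrite /ordge ordV // oc oppr0 lexx orbT.
apply/seteqP; split=> x.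
  by move=> /(latt_scaleE _ _ c0)/(latt_mul u); rewrite uE scalerA mulfV // scale1r.
by move=> gx; apply/latt_scaleE => //; rewrite -vE; apply: latt_mul.
Qed.

Lemma latt_scale_ord c g (k : nat) : c != 0 -> ord c = k%:Z ->
  latt (c *: g) = latt (unif ^+ k *: g).
Proof.
move=> c0 oc; have u0 : (unif : F) ^+ k != 0 by rewrite expf_neq0 ?unif_neq0.
have -> : c *: g = (c / unif ^+ k) *: (unif ^+ k *: g) by rewrite scalerA divfK.
apply: latt_scale_unit; first by rewrite mulf_neq0 ?invr_eq0.
by rewrite ordM ?invr_eq0 // ordV // ordX ?unif_neq0 // ord_unif oc mul1r subrr.
Qed.

Lemma same_dg W f f' : W \in unitmx -> same_vertex (W *m emb (dg F f)) (W *m emb (dg F f')) ->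
  exists k : nat, (forall j, f j = f' j + k)%N \/ (forall j, f' j = f j + k)%N.
Proof.
have up a b : W \in unitmx -> forall k c, c != 0 -> ord c = k%:Z ->
    latt (W *m emb (dg F a)) = latt (c *: (W *m emb (dg F b))) -> forall j, (a j = b j + k)%N.
  move=> Wu k c c0 oc; rewrite (latt_scale_ord _ c0 oc) -dg_const -mulmxA -map_mxM dg_mul => E j.
  apply/eqP; rewrite eqn_leq.
  have h1 := @latt_dg_leP W a (fun j => b j + k)%N Wu; have h2 := @latt_dg_leP W (fun j => b j + k)%N a Wu.
  by rewrite h1 ?h2 // E.
move=> Wu [c c0 E].
case oc : (ord c) => [k|k]; first by exists k; left; apply: up oc E.
exists k.+1; right; apply: (@up f' f Wu k.+1 c^-1); rewrite ?invr_eq0 //.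
  by rewrite ordV // oc NegzE opprK.
by rewrite (latt_scale_eq _ E) scalerA mulVf // scale1r.
Qed.

Lemma adjacent_color g h : g \in unitmx -> h \in unitmx -> adjacent g h ->
  exists2 c, c != 0 & [/\ (latt (unif *: g) `<=` latt (c *: h))%classic,
    (latt (c *: h) `<=` latt g)%classic & color g < color (c *: h) < color g + n%:Z].
Proof.
move=> gu hu /adjacentP [c c0 [[s1 n1] [s2 n2]]]; exists c => //; split => //.
have chu : c *: h \in unitmx by rewrite unitmx_scale.
have ugu : unif *: g \in unitmx by rewrite unitmx_scale ?unif_neq0.
have cu : color (unif *: g) = color g + n%:Z.
  by rewrite color_scale ?unif_neq0 // ord_unif mul1r.
rewrite -cu !lt_neqAle !color_latt_le // !andbT; apply/andP; split; apply/eqP => e.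
  by apply: n2; rewrite (color_latt_eq chu gu s2 (esym e)).
by apply: n1; rewrite (color_latt_eq ugu chu s1 (esym e)).
Qed.

Lemma adjacent_of_color g h : g \in unitmx -> h \in unitmx ->
  (latt (unif *: g) `<=` latt h)%classic -> (latt h `<=` latt g)%classic ->
  color g < color h < color g + n%:Z -> adjacent g h.
Proof.
move=> gu hu s1 s2 /andP[c1 c2]; apply/adjacentP; exists 1; rewrite ?oner_eq0 // scale1r.
have ugu : unif *: g \in unitmx by rewrite unitmx_scale ?unif_neq0.
have cu : color (unif *: g) = color g + n%:Z.
  by rewrite color_scale ?unif_neq0 // ord_unif mul1r.
split; split => // H.
  by have := color_latt_le hu ugu H; rewrite cu leNgt c2.
by have := color_latt_le gu hu H; rewrite leNgt c1.
Qed.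

Lemma same_color g h : g \in unitmx -> h \in unitmx -> same_vertex g h ->
  exists k : int, color g = color h + k * n%:Z.
Proof.
move=> gu hu [c c0 E]; exists (ord c).
by rewrite -color_scale //; apply: latt_color; rewrite ?unitmx_scale.
Qed.

Lemma same_color_eq g h : (0 < n)%N -> g \in unitmx -> h \in unitmx -> same_vertex g h ->
  color g = color h -> latt g = latt h.
Proof.
move=> n0 gu hu [c c0 E] e; rewrite E; apply: latt_scale_unit => //.
have : color g = color h + ord c * n%:Z.
  by rewrite -color_scale //; apply: latt_color; rewrite ?unitmx_scale.
rewrite e => /eqP; rewrite eq_sym -subr_eq0 addrAC subrr add0r mulf_eq0.
by case/orP => /eqP //; lia.
Qed.

(** The exponents in places [i] to [j - 1] are raised together, one unit at a time, so the length is
    [r] whatever [j - i] is. *)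
Lemma near_flag W (r i j : nat) : W \in unitmx -> (i < j <= n)%N -> (j - i < n)%N ->
  near r (W *m emb (flag_dg F n r i)) (W *m emb (flag_dg F n r j)).
Proof.
move=> Wu /andP[ij jn] jin.
pose f m (l : 'I_n) := (if l < i then r else if l < j then m else 0)%N.
have H m : (m <= r)%N -> near m (W *m emb (dg F (f 0%N))) (W *m emb (dg F (f m))).
  elim: m => [|m IH] mr; first by apply: near0; rewrite ?gdg_unit //; apply: same_refl.
  apply: nearS (IH (ltnW mr)) _ _; first by rewrite gdg_unit.
  apply: adjacent_dg => //.
  - by move=> l; rewrite /f; case: ifP => _; [lia | case: ifP => _; lia].
  - have il : (i < n)%N by lia.
    by exists (Ordinal il); rewrite /f /= ltnn ij; lia.
  - case: (posnP i) => i0.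
      have jl : (j < n)%N by lia.
      by exists (Ordinal jl); rewrite /f /= i0 ltnn.
    have zl : (0 < n)%N by lia.
    by exists (Ordinal zl); rewrite /f /= i0; lia.
have := H r (leqnn r).
rewrite (_ : dg F (f 0%N) = flag_dg F n r i); last by apply: eq_dg => l; rewrite /f; case: ifP => // _; case: ifP.
rewrite (_ : dg F (f r) = flag_dg F n r j) //; apply: eq_dg => l; rewrite /f.
by case: (ltnP l i) => // li; case: (ltnP l j) => // lj; lia.
Qed.

Lemma near_flag_neq W (r i j : nat) : W \in unitmx -> (i < n)%N -> (j < n)%N ->
  exists2 l, (l <= r)%N & near l (W *m emb (flag_dg F n r i)) (W *m emb (flag_dg F n r j)).
Proof.
move=> Wu il jl; case: (ltngtP i j) => [ij|ji|->].
- by exists r => //; apply: near_flag => //; lia.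
- by exists r => //; apply: near_sym; apply: near_flag => //; lia.
- by exists 0%N => //; apply: near0; rewrite ?gdg_unit //; apply: same_refl.
Qed.

Lemma flag0 r : flag_dg F n r 0 = 1%:M.
Proof.
apply/matrixP => i j; rewrite !mxE; case: eqP => [->|]; by rewrite ?expr0.
Qed.

Lemma flag_n W r : W *m emb (flag_dg F n r n) = unif ^+ r *: W.
Proof. by rewrite -dg_const; congr (_ *m emb _); apply: eq_dg => j; rewrite ltn_ord. Qed.

End Diagonal.

(** * Lifting geodesics from the quotient to the building *)

Section QuotientComplex.
Variables (d q r : nat) (X : AtildeComplex d q).
Hypothesis d2 : (2 <= d)%N.
Hypothesis r0 : (0 < r)%N.
Hypothesis wide : geodesically_wide X r.
Local Notation F := (At_field X).
Local Notation n := d.+1.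
Local Notation V := (At_vertex X).
Local Notation G := (@At_group d q X).
Local Notation O := (vring F).
Local Notation emb M := (map_mx (val : O -> F) M).
Implicit Types (g h W : 'M[F]_n).

(** The projection on all matrices, with the identity as default for singular ones. *)
Definition pr g : V := At_proj (insubd (exist _ 1%:M (unitmx1 F n) : GL F n) g).

Lemma prE (g : GL F n) : pr (val g) = At_proj g.
Proof. by rewrite /pr valKd. Qed.

Lemma At_unit x : G x -> x \in unitmx.
Proof. by case: (At_subgroup X) => h _ _ _; apply: h. Qed.

Lemma prP g h : g \in unitmx -> h \in unitmx ->
  pr g = pr h <-> exists2 x, G x & same_vertex (x *m g) h.
Proof.
move=> gu hu; have := At_proj_eq (exist _ g gu : GL F n) (exist _ h hu).
by rewrite -!prE.
Qed.

Lemma pr_same g h : g \in unitmx -> h \in unitmx -> same_vertex g h -> pr g = pr h.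
Proof.
move=> gu hu s; apply/prP => //; exists 1%:M; last by rewrite mul1mx.
by case: (At_subgroup X) => _ + _ _; apply; rewrite oner_eq0.
Qed.

Lemma pr_mull x g : G x -> g \in unitmx -> pr (x *m g) = pr g.
Proof.
move=> Gx gu; have xu := At_unit Gx.
apply/esym/prP; rewrite ?unitmx_mul ?xu //; exists x => //; exact: same_refl.
Qed.

Lemma pr_surj v : exists2 g, g \in unitmx & pr g = v.
Proof. by have [g <-] := At_proj_surj v; exists (val g); [apply: (valP g) | rewrite prE]. Qed.

(** A group element identifying [g] with [h] moves a vertex by at most [n * r], hence is scalar. All
    alignment of lifts rests on this. *)
Lemma pr_near g h l : near l g h -> (l <= n * r)%N -> pr g = pr h -> same_vertex g h.
Proof.
move=> N ln; have [gu hu] := near_unit N => /(prP gu hu) [x Gx s].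
have /is_scalar_mxP [c xc] := displacement_near wide Gx N ln s.
have c0 : c != 0.
  apply/eqP => z; have := At_unit Gx; by rewrite xc z raddf0 unitmxE det0 unitr0.
apply: same_trans s; rewrite xc mul_scalar_mx; apply: same_sym; exact: same_scale.
Qed.

Lemma nr2 : (2 <= n * r)%N. Proof. by rewrite mulSn; nia. Qed.

Lemma same_color_lt g h : g \in unitmx -> h \in unitmx -> same_vertex g h ->
  color g < color h < color g + n%:Z -> False.
Proof.
move=> gu hu s; have [k ->] := same_color gu hu s; move: (color h) => c.
have n0 : 0 < n%:Z by [].
move: (n%:Z) n0 => m m0; case: (leP 0 k) => hk; nia.
Qed.

Lemma cells_of (f : V -> 'M[F]_n) (s : {set V}) :
  {in s, forall v, f v \in unitmx /\ pr (f v) = v} ->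
  {in s &, forall v w, v != w -> adjacent (f v) (f w)} -> s \in At_cells X.
Proof.
move=> fs fa; rewrite inE; apply/asboolP.
pose e : GL F n := exist _ 1%:M (unitmx1 F n).
exists (fun v => insubd e (f v)); split.
  by move=> v /fs [_ fv]; rewrite -[RHS]fv.
by move=> v w vs ws vw; have [vu _] := fs v vs; have [wu _] := fs w ws; rewrite !insubdK //; apply: fa.
Qed.

Lemma cellsP (s : {set V}) : s \in At_cells X -> exists f : V -> 'M[F]_n,
  {in s, forall v, f v \in unitmx /\ pr (f v) = v} /\
  {in s &, forall v w, v != w -> adjacent (f v) (f w)}.
Proof.
rewrite inE => /asboolP [f [fs fa]]; exists (fun v => val (f v)); split.
  by move=> v vs; split; [apply: (valP (f v)) | rewrite prE fs].
exact: fa.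
Qed.

(** Translate a lifted edge so that it starts at [g], and rescale its end to lie strictly between
    [unif *: g] and [g]. Its color exceeds that of [g] by less than [n] and is known modulo [n],
    hence exceeds it by exactly 1. *)
Lemma edge_lift v w g : g \in unitmx -> pr g = v -> edge_color v w 1 ->
  exists h, [/\ h \in unitmx, pr h = w, (latt h `<=` latt g)%classic & color h = color g + 1].
Proof.
move=> gu gv [g' [h' [g'v h'w adj col]]].
have [g'u h'u] := (valP g', valP h').
have [x Gx s] : exists2 x, G x & same_vertex (x *m val g') g.
  by apply/prP => //; rewrite prE g'v gv.
have xu := At_unit Gx.
have xh'u : x *m val h' \in unitmx by rewrite unitmx_mul xu.
have a : adjacent g (x *m val h').
  by apply: adjacent_same (adjacent_mull xu adj) => //; apply: same_refl.
have [c c0 [_ s2 cc]] := adjacent_color gu xh'u a.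
exists (c *: (x *m val h')); split => //.
- by rewrite unitmx_scale.
- rewrite (pr_same (h := x *m val h')) ?unitmx_scale //; last exact: same_scale.
  by rewrite pr_mull // prE.
have cm y z : y \in unitmx -> z \in unitmx -> color (y *m z) = ord (\det y) + color z :> int.
  by move=> yu zu; rewrite /color det_mulmx ordM // -unitfE -unitmxE.
move: cc; rewrite color_scale // cm //.
have [k] : exists k, color (x *m val g') = color g + k * n%:Z.
  by apply: same_color s => //; rewrite unitmx_mul xu.
rewrite cm //; set A := color (val g') in col *; set B := color (val h') in col *.
set D := ord (\det x); move=> e.
have := divz_eq (B - A) n%:Z; rewrite col.
rewrite (_ : (1 %% n%:Z)%Z = 1); last by rewrite modz_small //; lia.
set m := (_ %/ _)%Z => e' bnd.
have E : D + B + ord c * n%:Z = color g + 1 + (k + m + ord c) * n%:Z.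
  have -> : B = A + (B - A) by ring.
  by rewrite e'; move: e => /eqP; rewrite -subr_eq => /eqP <-; ring.
move: bnd; rewrite E; move: (k + m + ord c) (color g) => t C.
have n2 : 2 < n%:Z by lia.
move: (n%:Z) n2 => N n2 bnd.
have [t1|t1] := leP 1 t; first by nia.
have [t2|t2] := leP t (-1); first by nia.
have -> : t = 0 by lia.
by rewrite mul0r addr0.
Qed.

(** A geodesic in terms of lattices. The last clause says that three consecutive vertices do not
    span a triangle. *)
Definition geochain (Gs : nat -> 'M[F]_n) : Prop :=
  [/\ forall i, (i <= r)%N -> Gs i \in unitmx,
      forall i, (i < r)%N -> (latt (Gs i.+1) `<=` latt (Gs i))%classic /\
        color (Gs i.+1) = color (Gs i) + 1
    & forall i, (i.+2 <= r)%N -> ~ (latt (unif *: Gs i) `<=` latt (Gs i.+2))%classic].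

Lemma color_one_adjacent g h : g \in unitmx -> h \in unitmx ->
  (latt h `<=` latt g)%classic -> color h = color g + 1 -> adjacent g h.
Proof.
move=> gu hu s c; apply: adjacent_of_color => //; first exact: latt_color_one_unif.
by rewrite c; lia.
Qed.

Lemma color_two_adjacent g h : g \in unitmx -> h \in unitmx ->
  (latt (unif *: g) `<=` latt h)%classic -> (latt h `<=` latt g)%classic ->
  color h = color g + 2 -> adjacent g h.
Proof. by move=> gu hu s1 s c; apply: adjacent_of_color => //; rewrite c; lia. Qed.

(** The point is that the quotient creates no new triangle: a triangle on the images lifts, and
    [pr_near] aligns its lift with the chain. *)
Lemma geochain_geodesic Gs : geochain Gs -> geodesic r (fun i => pr (Gs i)).
Proof.
case=> Gu Gs1 Gc.
have adj i : (i < r)%N -> adjacent (Gs i) (Gs i.+1).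
  by move=> ir; have [s c] := Gs1 i ir; apply: color_one_adjacent => //; apply: Gu; lia.
have neq i : (i < r)%N -> pr (Gs i) != pr (Gs i.+1).
  move=> ir; apply/eqP => /(pr_near (near_adj (Gu i (ltnW ir)) (Gu i.+1 ir) (adj i ir))).
  have := nr2 => /ltnW h /(_ h) s; apply: (same_color_lt _ _ s); rewrite ?Gu //; first by lia.
  by rewrite (Gs1 i ir).2; lia.
split=> [i ir|i ir].
  split.
    rewrite inE cards2 neq // andbT.
    apply: (cells_of (f := fun v => if v == pr (Gs i) then Gs i else Gs i.+1)).
      move=> v; rewrite !inE => /orP[] /eqP ->; first by rewrite eqxx Gu // ltnW.
      by rewrite eq_sym (negPf (neq i ir)) Gu.
    move=> v w; rewrite !inE => /orP[] /eqP -> /orP[] /eqP ->; rewrite ?eqxx //.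
      by rewrite (eq_sym (pr (Gs i.+1))) (negPf (neq i ir)) => _; apply: adj.
    by rewrite (eq_sym (pr (Gs i.+1))) (negPf (neq i ir)) => _; apply/adjacent_sym/adj.
  have iu := Gu i (ltnW ir); have iu' := Gu i.+1 ir.
  exists (exist _ (Gs i) iu), (exist _ (Gs i.+1) iu'); split.
  - by rewrite -prE.
  - by rewrite -prE.
  - exact: adj.
  - by rewrite /= (Gs1 i ir).2 addrAC subrr add0r.
have i0 : (i < r)%N by lia.
have u0 : Gs i \in unitmx by apply: Gu; lia.
have u1 : Gs i.+1 \in unitmx by apply: Gu; lia.
have u2 : Gs i.+2 \in unitmx by apply: Gu; lia.
have [s1 c1] := Gs1 i i0; have [s2 c2] := Gs1 i.+1 ir.
have a1 := adj i i0; have a2 := adj i.+1 ir.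
have N2 : near 2 (Gs i) (Gs i.+2) by apply: nearS (near_adj u0 u1 a1) u2 a2.
split.
  apply/eqP => /esym e; have s := pr_near N2 nr2 e.
  by apply: (same_color_lt u0 u2 s); rewrite c2 c1; lia.
rewrite inE negb_and; apply/orP; left; apply/negP => /cellsP [f [fu fa]].
set A := pr (Gs i) in fu fa; set B := pr (Gs i.+1) in fu fa; set C := pr (Gs i.+2) in fu fa.
have [au aA] : f A \in unitmx /\ pr (f A) = A by apply: fu; rewrite !inE eqxx.
have [bu bB] : f B \in unitmx /\ pr (f B) = B by apply: fu; rewrite !inE eqxx !orbT.
have [cu cC] : f C \in unitmx /\ pr (f C) = C by apply: fu; rewrite !inE eqxx !orbT.
have AB : A != B by apply: neq.
have BC : B != C by apply: neq.
have AC : A != C.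
  by apply/eqP => e; have s := pr_near N2 nr2 e; apply: (same_color_lt u0 u2 s); rewrite c2 c1; lia.
have fab : adjacent (f A) (f B) by apply: fa; rewrite ?inE ?eqxx ?orbT.
have fbc : adjacent (f B) (f C) by apply: fa; rewrite ?inE ?eqxx ?orbT.
have fac : adjacent (f A) (f C) by apply: fa; rewrite ?inE ?eqxx ?orbT.
(* Translate the lifted triangle to start at [Gs i]; its other two vertices then match step by
   step. *)
have [x Gx sA] : exists2 x, G x & same_vertex (x *m f A) (Gs i) by apply/prP.
have xu := At_unit Gx.
have xbu : x *m f B \in unitmx by rewrite unitmx_mul xu.
have xcu : x *m f C \in unitmx by rewrite unitmx_mul xu.
have step y (g h : 'M[F]_n) : y \in unitmx -> g \in unitmx -> h \in unitmx -> adjacent g (x *m y) ->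
    adjacent g h -> pr y = pr h -> same_vertex (x *m y) h.
  move=> yu gu hu ay ah e; apply: (@pr_near _ _ 2) nr2 _; last by rewrite pr_mull.
  apply: nearS hu ah; apply: near_adj => //; first by rewrite unitmx_mul xu.
  exact: adjacent_sym.
have sB : same_vertex (x *m f B) (Gs i.+1).
  apply: (step _ (Gs i)) => //.
  by apply: adjacent_same (adjacent_mull xu fab) => //; apply: same_refl.
have sC : same_vertex (x *m f C) (Gs i.+2).
  apply: (step _ (Gs i.+1)) => //.
  by apply: adjacent_same (adjacent_mull xu fbc) => //; apply: same_refl.
have aac : adjacent (Gs i) (Gs i.+2) by apply: adjacent_same (adjacent_mull xu fac).
have [c c0 [sub _ col]] := adjacent_color u0 u2 aac.
apply: (Gc i ir); rewrite (_ : latt (Gs i.+2) = latt (c *: Gs i.+2)) //.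
apply/esym/latt_scale_unit => //.
by move: col; rewrite color_scale // c2 c1; nia.
Qed.

(** Lift edge by edge. A fold of the lift would give a 2-cell on three consecutive vertices of the
    geodesic. *)
Lemma geodesic_geochain (v : nat -> V) g : geodesic r v -> g \in unitmx -> pr g = v 0%N ->
  exists Gs, [/\ geochain Gs, Gs 0%N = g & forall i, (i <= r)%N -> pr (Gs i) = v i].
Proof.
case=> ve vt gu g0.
have [Gs [G0 Gu Gv G1]] : exists Gs : nat -> 'M[F]_n, [/\ Gs 0%N = g,
    forall i, (i <= r)%N -> Gs i \in unitmx, forall i, (i <= r)%N -> pr (Gs i) = v i
    & forall i, (i < r)%N -> (latt (Gs i.+1) `<=` latt (Gs i))%classic /\
        color (Gs i.+1) = color (Gs i) + 1].
  suff H m : (m <= r)%N -> exists Gs : nat -> 'M[F]_n, [/\ Gs 0%N = g,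
    forall i, (i <= m)%N -> Gs i \in unitmx, forall i, (i <= m)%N -> pr (Gs i) = v i
    & forall i, (i < m)%N -> (latt (Gs i.+1) `<=` latt (Gs i))%classic /\
        color (Gs i.+1) = color (Gs i) + 1] by exact: (H r).
  elim: m => [_|m IH mr].
    by exists (fun=> g); split => // i; rewrite leqn0 => /eqP ->.
  have [Gs [G0 Gu Gv G1]] := IH (ltnW mr).
  have [h [hu hv hs hc]] := edge_lift (Gu m (leqnn m)) (Gv m (leqnn m)) (ve m mr).2.
  exists (fun i => if (i <= m)%N then Gs i else h); split => //.
  - by move=> i; rewrite leq_eqVlt ltnS => /orP[/eqP->|im]; rewrite ?ltnn // im Gu.
  - by move=> i; rewrite leq_eqVlt ltnS => /orP[/eqP->|im]; rewrite ?ltnn // im Gv.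
  - move=> i; rewrite ltnS => im; rewrite im; move: (im); rewrite leq_eqVlt => /orP[/eqP->|im'].
      by rewrite ltnn.
    by rewrite im'; apply: G1.
exists Gs; split => //; split => // i ir bad.
have [vne nface] := vt i ir.
have i0 : (i < r)%N by lia.
have [s1 c1] := G1 i i0; have [s2 c2] := G1 i.+1 ir.
have u0 : Gs i \in unitmx by apply: Gu; lia.
have u1 : Gs i.+1 \in unitmx by apply: Gu; lia.
have u2 : Gs i.+2 \in unitmx by apply: Gu; lia.
have a01 := color_one_adjacent u0 u1 s1 c1.
have a12 := color_one_adjacent u1 u2 s2 c2.
have a02 : adjacent (Gs i) (Gs i.+2).
  apply: color_two_adjacent => //; last by rewrite c2 c1; lia.
  by move=> x /s2/s1.
have ne m : (m < r)%N -> v m != v m.+1.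
  by move=> mr; have := (ve m mr).1; rewrite inE cards2 => /andP[_]; case: (v m == _).
have n01 := ne i i0; have n12 := ne i.+1 ir.
move/negP: nface; apply; rewrite inE; apply/andP; split; last first.
  by rewrite finset.setUC cardsU1 cards2 !inE n01 negb_or vne (eq_sym (v i.+2)) n12.
have p0 : pr (Gs i) = v i by apply: Gv; lia.
have p1 : pr (Gs i.+1) = v i.+1 by apply: Gv; lia.
have p2 : pr (Gs i.+2) = v i.+2 by apply: Gv; lia.
apply: (cells_of (f := fun x => if x == v i then Gs i else if x == v i.+1 then Gs i.+1 else Gs i.+2)).
  move=> x; rewrite !inE => /orP[/orP[]|] /eqP ->.
  - by rewrite eqxx.
  - by rewrite eq_sym (negPf n01) eqxx.
  - by rewrite (negPf vne) eq_sym (negPf n12).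
have e10 : (v i.+1 == v i) = false by rewrite eq_sym (negPf n01).
have e21 : (v i.+2 == v i.+1) = false by rewrite eq_sym (negPf n12).
have e20 := negPf vne.
move=> x y; rewrite !inE => /orP[/orP[]|] /eqP -> /orP[/orP[]|] /eqP ->;
  rewrite ?eqxx ?e10 ?e20 ?e21 // => _; try exact: adjacent_sym.
Qed.

End QuotientComplex.

(** * Chambers as images of adapted bases *)

Section Chambers.
Variables (d q r : nat) (X : AtildeComplex d q).
Hypothesis d2 : (2 <= d)%N.
Hypothesis r0 : (0 < r)%N.
Hypothesis wide : geodesically_wide X r.
Local Notation F := (At_field X).
Local Notation n := d.+1.
Local Notation V := (At_vertex X).
Local Notation G := (@At_group d q X).
Local Notation O := (vring F).
Local Notation emb M := (map_mx (val : O -> F) M).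
Local Notation D i := (emb (flag_dg F d.+1 r i)).
Implicit Types (g h W : 'M[F]_n) (f : 'I_n -> V).

Definition chamber f : Prop := forall i, geodesic_joined r (f i) (f (ordS i)).

Lemma geodesic_lift (v w : V) g : geodesic_joined r v w -> g \in unitmx -> pr g = v ->
  exists h, [/\ h \in unitmx, pr h = w, (latt h `<=` latt g)%classic & near r g h] /\
    [/\ color h = color g + r%:Z &
      exists2 x, latt g x & forall y, latt g y ->
        exists (c : O) z, latt h z /\ y = val c *: x + z].
Proof.
case=> p [pg p0 pr_] gu gv.
have [Gs [GC G0 Gv]] := geodesic_geochain d2 r0 pg gu (etrans gv (esym p0)).
case: (GC) => Gu G1 Gc.
have N m : (m <= r)%N -> near m g (Gs m).
  elim: m => [_|m IH mr]; first by rewrite G0; apply: near0 => //; apply: same_refl.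
  apply: nearS (IH (ltnW mr)) (Gu _ mr) _.
  by have [s c] := G1 m mr; apply: (color_one_adjacent d2 r0) => //; apply: Gu; lia.
have S m : (m <= r)%N -> (latt (Gs m) `<=` latt g)%classic.
  elim: m => [_|m IH mr]; first by rewrite G0.
  by move=> x /(G1 m mr).1; apply: IH; apply: ltnW.
have C m : (m <= r)%N -> color (Gs m) = color g + m%:Z.
  elim: m => [_|m IH mr]; first by rewrite G0 addr0.
  by rewrite (G1 m mr).2 IH; lia.
exists (Gs r); split; split.
- exact: Gu.
- by rewrite Gv.
- exact: S.
- exact: N.
- exact: C.
- have [x] := geodesic_cyclic r0 Gu G1 Gc; rewrite G0; by exists x.
Qed.

(** The geodesic raises the exponent of the [i]-th basis vector from 0 to [r]. *)
Lemma geodesic_step W i : W \in unitmx -> (i < n)%N ->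
  geodesic_joined r (pr (W *m D i)) (pr (W *m D i.+1)).
Proof.
move=> Wu iln.
pose f m (l : 'I_n) := ((if (l < i)%N then r else 0) + (if l == Ordinal iln then m else 0))%N.
have fsum m : (\sum_l f m l = i * r + m)%N.
  by rewrite big_split /= sum_ltn 1?ltnW // -big_mkcond big_pred1_eq.
exists (fun m => pr (W *m emb (dg F (f m)))); split.
- apply: (geochain_geodesic d2 r0 wide); split.
  + by move=> m _; rewrite gdg_unit.
  + move=> m mr; split; first by apply: latt_dg_le => l; rewrite /f; case: ifP; case: ifP => _ _; lia.
    by rewrite !color_dg // !fsum; lia.
  + move=> m mr; rewrite -[unif]expr1 -dg_const -mulmxA -map_mxM dg_mul.
    move=> /(latt_dg_leP Wu)/(_ (Ordinal iln)); rewrite /f /= ltnn eqxx; lia.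
- congr pr; congr (_ *m emb _); apply: eq_dg => l; rewrite /f; by case: ifP; case: ifP => _ _; lia.
- congr pr; congr (_ *m emb _); apply: eq_dg => l; rewrite /f ltnS -val_eqE /=.
  by case: (ltngtP l i); rewrite ?addn0.
Qed.

Lemma pr_flag_n W : W \in unitmx -> pr (W *m D n) = pr (W *m D 0) :> V.
Proof.
move=> Wu; rewrite flag_n flag0 map_mx1 mulmx1.
apply: pr_same; rewrite ?unitmx_scale ?expf_neq0 ?unif_neq0 //.
by apply: same_scale; rewrite expf_neq0 ?unif_neq0.
Qed.

Lemma chamber_flag W : W \in unitmx -> chamber (fun i => pr (W *m D i)).
Proof.
move=> Wu i; have := geodesic_step Wu (ltn_ord i).
case: (ltnP i.+1 n) => iS; first by rewrite /= modn_small.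
have id : i.+1 = n by apply/eqP; rewrite eqn_leq iS (ltn_ord i).
have -> : nat_of_ord (ordS i) = 0%N by rewrite /= id modnn.
by rewrite id pr_flag_n.
Qed.

Lemma flag_inj W i j : W \in unitmx -> (i < n)%N -> (j < n)%N ->
  pr (W *m D i) = pr (W *m D j) :> V -> i = j.
Proof.
move=> Wu iln jln e.
have [l lr N] := near_flag_neq r Wu iln jln.
have s : same_vertex (W *m D i) (W *m D j).
  by apply: (pr_near wide N) e; apply: leq_trans lr _; rewrite leq_pmull.
have di : (d < i)%N = false by lia.
have dj : (d < j)%N = false by lia.
have [k [] H] := same_dg Wu s.
  have := H ord_max; rewrite /= di dj => k0.
  have := H (Ordinal iln); have := H (Ordinal jln); rewrite /= !ltnn.
  by case: (ltngtP i j) => //; lia.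
have := H ord_max; rewrite /= di dj => k0.
have := H (Ordinal iln); have := H (Ordinal jln); rewrite /= !ltnn.
by case: (ltngtP i j) => //; lia.
Qed.

(** The lifted walk has length [n * r] and ends over its starting vertex, so [pr_near] closes it up
    to homothety. The color grew by [n * r], so the homothety factor has valuation [r], and
    [standard_form] applies. *)
Lemma chamber_lift f g : chamber f -> g \in unitmx -> pr g = f ord0 ->
  exists W, [/\ W \in unitmx, latt W = latt g & forall i, f i = pr (W *m D i)].
Proof.
move=> fc gu g0.
pose fn i : V := f (inord (i %% n)).
have fnS i : (i < n)%N -> geodesic_joined r (fn i) (fn i.+1).
  move=> il; rewrite /fn (modn_small il).
  have := fc (inord i); congr (geodesic_joined _ _ (f _)).
  by apply: val_inj; rewrite /= !inordK // ltn_mod.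
have [Gs [G0 Gu Gv Gs1]] : exists Gs : nat -> 'M[F]_n, [/\ Gs 0%N = g,
    forall i, (i <= n)%N -> Gs i \in unitmx, forall i, (i <= n)%N -> pr (Gs i) = fn i
    & forall i, (i < n)%N -> [/\ (latt (Gs i.+1) `<=` latt (Gs i))%classic,
        near r (Gs i) (Gs i.+1), color (Gs i.+1) = color (Gs i) + r%:Z &
        exists2 x, latt (Gs i) x & forall y, latt (Gs i) y ->
        exists (c : O) z, latt (Gs i.+1) z /\ y = val c *: x + z]].
  suff H m : (m <= n)%N -> exists Gs : nat -> 'M[F]_n, [/\ Gs 0%N = g,
    forall i, (i <= m)%N -> Gs i \in unitmx, forall i, (i <= m)%N -> pr (Gs i) = fn i
    & forall i, (i < m)%N -> [/\ (latt (Gs i.+1) `<=` latt (Gs i))%classic,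
        near r (Gs i) (Gs i.+1), color (Gs i.+1) = color (Gs i) + r%:Z &
        exists2 x, latt (Gs i) x & forall y, latt (Gs i) y ->
        exists (c : O) z, latt (Gs i.+1) z /\ y = val c *: x + z]] by exact: (H n).
  elim: m => [_|m IH mn].
    exists (fun=> g); split => // i; rewrite leqn0 => /eqP -> //.
    by rewrite g0 /fn mod0n; congr f; apply: val_inj; rewrite /= inordK.
  have [Gs [G0 Gu Gv Gs1]] := IH (ltnW mn).
  have [h [[hu hv hs hN] [hc hx]]] := geodesic_lift (fnS m mn) (Gu m (leqnn m)) (Gv m (leqnn m)).
  exists (fun i => if (i <= m)%N then Gs i else h); split => //.
  - by move=> i; rewrite leq_eqVlt ltnS => /orP[/eqP->|im]; rewrite ?ltnn // im Gu.
  - by move=> i; rewrite leq_eqVlt ltnS => /orP[/eqP->|im]; rewrite ?ltnn // im Gv.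
  - move=> i; rewrite ltnS => im; rewrite im; move: (im); rewrite leq_eqVlt => /orP[/eqP->|im'].
      by rewrite ltnn.
    by rewrite im'; apply: Gs1.
have N m : (m <= n)%N -> near (m * r) g (Gs m).
  elim: m => [_|m IH mn]; first by rewrite G0; apply: near0 => //; apply: same_refl.
  rewrite mulSn addnC; apply: near_trans (IH (ltnW mn)) _.
  by case: (Gs1 m mn).
have C m : (m <= n)%N -> color (Gs m) = color g + (m * r)%N%:Z.
  elim: m => [_|m IH mn]; first by rewrite G0 addr0.
  by case: (Gs1 m mn) => _ _ -> _; rewrite IH ?(ltnW mn) // mulSn; lia.
have sn : same_vertex (Gs n) g.
  apply: same_sym; apply: (pr_near wide (N n (leqnn n))) => //.
  by rewrite Gv // g0 /fn modnn; congr f; apply: val_inj; rewrite /= inordK.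
have Gn : latt (Gs n) = latt (unif ^+ r *: Gs 0%N).
  case: sn => c c0 E; rewrite E G0; apply: latt_scale_ord => //.
  have := latt_color (Gu n (leqnn n)) _ E; rewrite unitmx_scale // => /(_ gu).
  by rewrite C // color_scale //; nia.
have [W Wu WE] := standard_form r0 Gu (fun i il => let: And4 a _ _ _ := Gs1 i il in a)
  (fun i il => let: And4 _ _ _ a := Gs1 i il in a) Gn.
exists W; split => //.
  by rewrite -G0 WE // flag0 map_mx1 mulmx1.
move=> i.
have il : (i <= n)%N by apply: ltnW.
transitivity (pr (Gs i)).
  by rewrite Gv // /fn modn_small //; congr f; apply: val_inj; rewrite /= inordK.
apply: pr_same; rewrite ?gdg_unit ?Gu //.
by apply: same_latt; rewrite WE.
Qed.

Lemma chamberP f : chamber f <-> exists2 W, W \in unitmx & forall i, f i = pr (W *m D i).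
Proof.
split=> [fc|[W Wu fE]].
  have [g gu g0] := pr_surj (f ord0).
  by have [W [Wu _ fE]] := chamber_lift fc gu g0; exists W.
rewrite (_ : f = fun i => pr (W *m D i)); first exact: chamber_flag.
exact: funext.
Qed.

Lemma chamber_inj f : chamber f -> injective f.
Proof.
move=> /chamberP [W Wu fE] i j; rewrite !fE => /(flag_inj Wu (ltn_ord i) (ltn_ord j)).
exact: val_inj.
Qed.

Lemma chamber_rot f k : chamber f -> chamber (fun i => f (iter k (@ordS n) i)).
Proof. by move=> fc i; rewrite -iterSr iterS; apply: fc. Qed.

Lemma iter_ordS k (i : 'I_n) : val (iter k (@ordS n) i) = ((i + k) %% n)%N.
Proof.
elim: k => [|k IH]; first by rewrite addn0 modn_small.
by rewrite iterS /= IH -[((i + k) %% n).+1]addn1 modnDml addn1 addnS.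
Qed.

Lemma iter_ordS_inj k : injective (iter k (@ordS n)).
Proof. by elim: k => // k IH x y; rewrite !iterS => /(can_inj (@ordSK n))/IH. Qed.

(* Chambers through a common vertex have lifts through a common lattice; the
   bound 2 r <= n r on the displacement then aligns all common vertices. *)
Lemma chamber_align f W : chamber f -> W \in unitmx -> f ord0 = pr W ->
  exists W', [/\ W' \in unitmx, latt W' = latt W, forall i, f i = pr (W' *m D i) &
    forall i j : 'I_n, f i = pr (W *m D j) -> i = j /\ latt (W' *m D i) = latt (W *m D j)].
Proof.
move=> fc Wu f0; have [W' [W'u WW fE]] := chamber_lift fc Wu (esym f0).
exists W'; split => // i j; rewrite fE => e.
have N (U : 'M[F]_n) k : U \in unitmx -> (k < n)%N -> exists2 l, (l <= r)%N & near l U (U *m D k).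
  move=> Uu kn; have [l lr] := near_flag_neq r Uu (ltn0Sn d) kn.
  by rewrite flag0 map_mx1 mulmx1; exists l.
have [l1 l1r N1] := N W' i W'u (ltn_ord i); have [l2 l2r N2] := N W j Wu (ltn_ord j).
have s : same_vertex (W' *m D i) (W *m D j).
  apply: (@pr_near d q r X wide _ _ (l1 + l2)) e; last by nia.
  apply: near_trans (near_sym N1) _.
  by rewrite -[l2]add0n; apply: near_trans N2; apply: near0 => //; apply: same_latt.
(* The last basis vector is not scaled by [D k] for k <= d, so it detects the factor [c]; applied in
   both directions, this gives [ord c = 0]. *)
have cint (U U' : 'M[F]_n) c (k k' : 'I_n) : U \in unitmx -> latt U = latt U' ->
    latt (U' *m D k') = latt (c *: (U *m D k)) -> ordge ord 0 c.
  move=> Uu UU E.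
  have : latt U (c *: (U *m D k *m delta_mx ord_max 0)).
    rewrite UU; apply: (@latt_emb _ _ _ (flag_dg F n r k')); rewrite E.
    apply/lattP; exists (delta_mx ord_max 0).
    by rewrite map_delta_mx scalemxAl.
  have -> : U *m D k *m (delta_mx ord_max 0 : 'cV_n) = U *m delta_mx ord_max 0.
    rewrite -mulmxA; congr (_ *m _); apply/colP => a.
    rewrite -colE !mxE eqxx andbT; case: eqP => [->|_]; last by rewrite mulr0n; apply: rmorph0.
    have dk : (d < k)%N = false by have := ltn_ord k; lia.
    by rewrite dk mulr1n; apply: rmorph1.
  case/lattP => y; rewrite scalemxAr => /(can_inj (mulKmx Uu))/colP/(_ ord_max).
  by rewrite !mxE !eqxx mulr1 => ->; apply: vringP.
have [c c0 E] := s.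
have oc : ord c = 0.
  have := cint W W' c j i Wu (esym WW) E.
  have := cint W' W c^-1 i j W'u WW; rewrite (latt_scale_eq _ E) scalerA mulVf // scale1r => /(_ erefl).
  by rewrite /ordge invr_eq0 (negPf c0) /= ordV //; lia.
rewrite latt_scale_unit // in E; split => //.
have := latt_color _ _ E; rewrite !gdg_unit !color_flag ?(ltnW (ltn_ord _)) // => /(_ W'u Wu).
rewrite (latt_color W'u Wu WW) => /addrI [] /eqP; rewrite eqn_pmul2r // => /eqP.
exact: val_inj.
Qed.

End Chambers.

(** * Changes of basis that preserve members of a flag *)

Lemma outside_lt_pred i j k : (0 < k)%N -> ((i <= j) && (i != k) || (k < i))%N ->
  (j <= k.-1)%N -> ~~ (j < i <= k.-1)%N.
Proof. lia. Qed.

Lemma outside_pred_le i j k : (0 < k)%N -> ((i <= j) && (i != k) || (k < i))%N ->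
  (j <= k)%N -> ~~ (k.-1 < i <= j)%N.
Proof. lia. Qed.

Lemma outside_pred_neq i k : (0 < k)%N -> i != k -> ~~ (k.-1 < i <= k)%N.
Proof. lia. Qed.

Lemma outside_ge i j k : (0 < k)%N -> (k <= i)%N -> ~~ (j < i <= k.-1)%N.
Proof. lia. Qed.

Lemma ord_outside (n i : nat) (l m : 'I_n) : (l < i)%N -> (i <= m)%N -> (l == m) = false.
Proof. by move=> li im; apply/negbTE; rewrite -val_eqE neq_ltn (leq_trans li im). Qed.

Section FlagMoves.
Variables (F : localField) (n r : nat).
Implicit Types (W : 'M[F]_n).
Local Notation O := (vring F).
Local Notation emb M := (map_mx (val : O -> F) M).
Local Notation D i := (emb (flag_dg F n r i)).

(** Preserving the [i]-th member means being block triangular modulo [unif ^+ r]; [flag_stable] is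
    the converse. *)
Lemma flag_entry W (a : 'M[O]_n) i (l j : 'I_n) : W \in unitmx ->
  (latt (W *m emb a *m D i) `<=` latt (W *m D i))%classic -> (l < i <= j)%N ->
  ordge ord r%:Z (val (a l j)).
Proof.
move=> Wu /latt_subP [M]; rewrite -!mulmxA -!map_mxM => /(can_inj (mulKmx Wu))/emb_inj E /andP[li ij].
have /matrixP/(_ l j) := E; rewrite mul_mx_diag mul_diag_mx !mxE li ltnNge ij /= mulr1 => ->.
by apply/ordge_dvd; exists (M l j).
Qed.

Lemma flag_stable W (b : 'M[O]_n) i : W \in unitmx -> b \in unitmx ->
  (forall l j : 'I_n, (l < i <= j)%N -> ordge ord r%:Z (val (b l j))) ->
  latt (W *m emb b *m D i) = latt (W *m D i).
Proof.
move=> Wu bu H.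
have bFu : emb b \in unitmx := emb_unit bu.
have Wbu : W *m emb b \in unitmx by rewrite unitmx_mul Wu.
apply: color_latt_eq; rewrite ?gdg_unit //; last first.
  rewrite !color_dg // color_emb //.
  by move: bu; rewrite unitmxE vring_unitE => /andP[_ /eqP ->]; rewrite addr0.
have /fin_all_exists [M ME] : forall p : 'I_n * 'I_n, exists m : O,
    (b *m flag_dg F n r i) p.1 p.2 = vunif F ^+ (if (p.1 < i)%N then r else 0%N) * m.
  case=> l j /=; rewrite mul_mx_diag !mxE.
  case: (ltnP l i) => li; last by exists (b l j * vunif F ^+ (if (j < i)%N then r else 0%N)); rewrite mul1r.
  case: (ltnP j i) => ji; first by exists (b l j); rewrite mulrC.
  have /ordge_dvd [y ->] := H l j (introT andP (conj li ji)).
  by exists y; rewrite mulr1.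
apply/latt_subP; exists (\matrix_(l, j) M (l, j)).
rewrite -!mulmxA -!map_mxM; congr (_ *m emb _); apply/matrixP => l j.
by rewrite (ME (l, j)) mul_diag_mx !mxE.
Qed.

(** Swapping two basis vectors is harmless when [D i] scales both or neither of them. *)
Lemma tperm_stable W (x y : 'I_n) i : W \in unitmx -> (x <= y)%N -> ~~ (x < i <= y)%N ->
  latt (W *m emb (tperm_mx x y) *m D i) = latt (W *m D i).
Proof.
move=> Wu xy nxy; apply: flag_stable => //; first by rewrite unitmx_perm.
move=> l j /andP[li ij]; rewrite !mxE; case: eqP => [e|_]; last first.
  by rewrite mulr0n rmorph0 ordge0.
exfalso; move: e; case: tpermP => [e1|e1|_ _] e2; subst; try by lia.
Qed.

Lemma tperm_unit W (x y : 'I_n) : W \in unitmx -> W *m emb (tperm_mx x y) \in unitmx.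
Proof. by move=> Wu; rewrite unitmx_mul Wu emb_unit // unitmx_perm. Qed.

Lemma flag_delta i (m : 'I_n) : flag_dg F n r i *m delta_mx m 0 =
  vunif F ^+ (if (m < i)%N then r else 0%N) *: delta_mx m 0 :> 'cV[O]_n.
Proof.
rewrite -colE; apply/colP => l; rewrite !mxE eqxx andbT.
by case: eqVneq => [->|_]; rewrite ?mulr1n ?mulr0n ?mulr1 ?mulr0.
Qed.

(** The [k]-th member is spanned by the next member and the [k]-th basis vector. *)
Lemma latt_flag_basis W W' (k : 'I_n) : W \in unitmx -> W' \in unitmx ->
  latt W = latt W' -> latt (W *m D k.+1) = latt (W' *m D k.+1) ->
  W *m (delta_mx k 0 : 'cV_n) = W' *m delta_mx k 0 -> latt (W *m D k) = latt (W' *m D k).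
Proof.
move=> Wu W'u WW Wk1 Wk; apply: color_latt_eq; rewrite ?gdg_unit //; last first.
  by rewrite !color_dg //; congr (_ + _); apply: latt_color.
move=> x /lattP [y ->].
have -> : W *m D k *m emb y = \sum_m (val (y m 0)) *: (W *m emb (flag_dg F n r k *m delta_mx m 0)).
  have -> : emb y = \sum_m (val (y m 0)) *: emb (delta_mx m 0).
    apply/colP => i; rewrite summxE (bigD1 i) // big1 => [|m mi].
      by rewrite [RHS]addr0 map_delta_mx mxE [RHS]mxE [delta_mx _ _ _ _]mxE !eqxx mulr1.
    by rewrite map_delta_mx mxE [delta_mx _ _ _ _]mxE eq_sym (negPf mi) mulr0.
  rewrite mulmx_sumr; apply: eq_bigr => m _.
  by rewrite map_mxM mulmxA scalemxAr.
apply: latt_sum => m _; apply: latt_mul.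
have inD (U : 'M[F]_n) e (m' : 'I_n) : (e <= m')%N -> latt (U *m D e) (U *m delta_mx m' 0).
  move=> em; apply/lattP; exists (delta_mx m' 0).
  by rewrite -mulmxA -map_mxM flag_delta ltnNge em expr0 scale1r map_delta_mx.
rewrite flag_delta; case: ltnP => mk.
  have : latt (W' *m D n) (W *m emb (vunif F ^+ r *: delta_mx m 0)).
    have -> : W *m emb (vunif F ^+ r *: delta_mx m 0 : 'cV[O]_n) =
        unif ^+ r *: (W *m emb (delta_mx m 0)).
      rewrite map_mxZ -scalemxAr; congr (_ *: _); exact: (rmorphXn (val : O -> F)).
    rewrite flag_n; apply/latt_scaleE; first by rewrite expf_neq0 ?unif_neq0.
    rewrite scalerA mulVf ?expf_neq0 ?unif_neq0 // scale1r -WW.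
    by apply/lattP; exists (delta_mx m 0).
  by apply: latt_dg_le => l; rewrite ltn_ord; case: ifP.
rewrite expr0 scale1r map_delta_mx; move: mk; rewrite leq_eqVlt => /orP[/eqP e|km].
  by rewrite (_ : m = k) ?Wk; [apply: inD | apply: val_inj].
have : latt (W *m D k.+1) (W *m delta_mx m 0) by apply: inD.
rewrite Wk1; apply: latt_dg_le => l.
by case: (ltnP l k) => lk; [rewrite (ltnW lk : (l < k.+1)%N) | case: ifP].
Qed.

End FlagMoves.

(** * Galleries with prescribed common vertices *)

Section Galleries.
Variables (d q r : nat) (X : AtildeComplex d q).
Hypothesis d2 : (2 <= d)%N.
Hypothesis r0 : (0 < r)%N.
Hypothesis wide : geodesically_wide X r.
Local Notation F := (At_field X).
Local Notation n := d.+1.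
Local Notation V := (At_vertex X).
Local Notation O := (vring F).
Local Notation emb M := (map_mx (val : O -> F) M).
Local Notation D i := (emb (flag_dg F d.+1 r i)).
Implicit Types (g h W : 'M[F]_n) (c : {ffun 'I_n -> V}) (S : {set 'I_n}).

Definition chb c : bool := `[< chamber r c >].

Definition panel (i : 'I_n) : rel {ffun 'I_n -> V} :=
  fun c c' => [forall j, (j != i) ==> (c j == c' j)].

Definition gallery_step S : rel {ffun 'I_n -> V} :=
  fun c c' => [&& chb c, chb c' & [exists i, (i \notin S) && panel i c c']].

Let fl W : {ffun 'I_n -> V} := [ffun i : 'I_n => pr (W *m D i)].

Let chb_fl W : W \in unitmx -> chb (fl W).
Proof.
move=> Wu; apply/asboolP; rewrite (_ : (fl W : 'I_n -> V) = fun i : 'I_n => pr (W *m D i)).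
  exact: (chamber_flag d2 r0 wide).
by apply: funext => i; rewrite ffunE.
Qed.

Let fl_eq W W' (i : 'I_n) : W \in unitmx -> W' \in unitmx ->
  latt (W *m D i) = latt (W' *m D i) -> fl W i = fl W' i.
Proof.
move=> Wu W'u e; rewrite !ffunE; apply: pr_same; rewrite ?gdg_unit //; exact: same_latt.
Qed.

Let step_of S W W' (k : 'I_n) : W \in unitmx -> W' \in unitmx -> k \notin S ->
  (forall i : 'I_n, i != k -> latt (W *m D i) = latt (W' *m D i)) ->
  connect (gallery_step S) (fl W) (fl W').
Proof.
move=> Wu W'u kS H; apply: connect1; rewrite /gallery_step !chb_fl //=.
apply/existsP; exists k; rewrite kS /=; apply/forallP => i; apply/implyP => ik.
by apply/eqP/fl_eq => //; apply: H.
Qed.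

(** Induction on [k], the flags agreeing from position [k] on. To gain agreement at a position [k]
    outside [S], a new basis is reached whose [k]-th vector is that of [W']. Every intermediate
    change either keeps all positions from [k] on, and is a gallery by induction, or is a single
    step at [k]. *)
Let gallery_flags S k W W' : ord0 \in S -> (k <= n)%N -> W \in unitmx -> W' \in unitmx ->
  (forall i : 'I_n, (i \in S) || (k <= i)%N -> latt (W *m D i) = latt (W' *m D i)) ->
  connect (gallery_step S) (fl W) (fl W').
Proof.
move=> S0; elim: k W W' => [|k IH] W W' kn Wu W'u agree.
  rewrite (_ : fl W = fl W') //; apply/ffunP => i; apply: fl_eq => //.
  by apply: agree; rewrite orbT.
pose kk : 'I_n := Ordinal kn.
have [kS|kS] := boolP (kk \in S).
  apply: (IH _ _ (ltnW kn) Wu W'u) => i /orP[iS|].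
    by apply: agree; rewrite iS.
  rewrite leq_eqVlt => /orP[/eqP e|ki]; last by apply: agree; rewrite ki orbT.
  by apply: agree; rewrite (_ : i = kk) ?kS //; apply: val_inj.
have k0 : (0 < k)%N.
  rewrite lt0n; apply: contra kS => /eqP e; rewrite (_ : kk = ord0) //; exact: val_inj.
have kmn : (k.-1 < n)%N by lia.
pose km : 'I_n := Ordinal kmn.
have WW : latt W' = latt W.
  by have := agree ord0; rewrite S0 orTb => /(_ isT); rewrite flag0 map_mx1 !mulmx1.
have [a au W'E] : exists2 a : 'M[O]_n, a \in unitmx & W' = W *m emb a.
  by apply/latt_eqP.
have agreeS : latt (W *m D k.+1) = latt (W' *m D k.+1).
  move: (kn); rewrite leq_eqVlt => /orP[/eqP e|ltn].
    by rewrite e !flag_n (latt_scale_eq _ WW).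
  by apply: (agree (Ordinal ltn)); rewrite /= leqnn orbT.
(* As the members at [k + 1] agree, entry (k, k) of [invmx a *m a] reduces modulo [unif] to a sum
   over rows up to [k]; it is 1, so one of these entries of column [k] is a unit. *)
have [j jk aj] : exists2 j : 'I_n, (j <= k)%N & a j kk \is a GRing.unit.
  apply: contrapT => H.
  have nu (j : 'I_n) : (j <= k)%N -> vres (a j kk) = 0.
    move=> jk; apply/eqP/negPn/negP => h; apply: H; exists j => //.
    by rewrite vres_unit.
  have : vres ((invmx a *m a) kk kk) = 0.
    rewrite mxE rmorph_sum big1 // => j _; rewrite rmorphM.
    have [jk|kj] := leqP j k; first by rewrite /= (nu j jk) mulr0.
    have WE : W = W' *m emb (invmx a).
      by rewrite W'E -mulmxA -map_mxM mulmxV // map_mx1 mulmx1.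
    have : ordge ord r%:Z (val (invmx a kk j)).
      apply: (@flag_entry _ _ _ W' _ k.+1) => //; last by rewrite /= ltnSn kj.
      by rewrite -WE agreeS.
    move=> /(@ordge_le _ _ 1) h; have : vres (invmx a kk j) = 0.
      by apply/eqP; rewrite vres_eq0; apply: h; rewrite lez_nat.
    by move=> /= ->; rewrite mul0r.
  by rewrite mulVmx // mxE eqxx /= rmorph1 => /eqP; rewrite oner_eq0.
(* No position of [S] lies in the interval from [j + 1] to [k], so the swaps below preserve the
   members at [S]. *)
have Sj (i : 'I_n) : i \in S -> (i <= k)%N -> (i <= j)%N.
  move=> iS ik; rewrite leqNgt; apply/negP => ji.
  have : ordge ord r%:Z (val (a j kk)).
    apply: (@flag_entry _ _ _ W _ i) => //; last by rewrite ji.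
    by rewrite -W'E (agree i) ?iS.
  move=> /(@ordge_le _ _ 1) h; move: aj; rewrite vres_unit vres_eq0 h //.
have Sk (i : 'I_n) : i \in S -> (i != k :> nat).
  by move=> iS; apply: contra kS => /eqP e; rewrite (_ : kk = i) //; apply: val_inj.
(* Moves the unit entry to row [k - 1]. *)
pose W1 := W *m emb (tperm_mx j km).
have W1u : W1 \in unitmx by apply: tperm_unit.
have W1E (i : 'I_n) : (i \in S) || (k < i)%N -> latt (W1 *m D i) = latt (W *m D i).
  move=> iS; have iS' : ((i <= j) && (i != k :> nat) || (k < i))%N.
    case/orP: iS => [iS|->]; last by rewrite orbT.
    case: (leqP i k) => [ik|_]; last by rewrite orbT.
    by rewrite Sj // Sk.
  rewrite /W1; have [jm|mj] := leqP j km; first by apply: tperm_stable => //=; exact: outside_lt_pred.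
  rewrite /tperm_mx tpermC; apply: tperm_stable => //=; first exact: ltnW.
  by exact: outside_pred_le.
have C1 : connect (gallery_step S) (fl W) (fl W1).
  have [e|jk'] := eqVneq (j : nat) k.
    apply: (step_of Wu W1u kS) => i ik; apply/esym.
    have ik' : (i != k :> nat) by apply: contra ik => /eqP e'; apply/eqP/val_inj.
    rewrite /W1 /tperm_mx tpermC; apply: tperm_stable => //=; first by rewrite e leq_pred.
    by rewrite e; exact: outside_pred_neq.
  apply: (IH _ _ (ltnW kn) Wu W1u).
  move=> i /orP[iS|ki]; apply/esym; first by apply: W1E; rewrite iS.
  apply: tperm_stable => //=; first by rewrite -ltnS prednK // ltn_neqAle jk' jk.
  by exact: outside_ge.
pose a1 := tperm_mx j km *m a.
have W'E1 : W' = W1 *m emb a1.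
  rewrite /W1 /a1 map_mxM mulmxA -(mulmxA W) -map_mxM -perm_mxM tperm2 perm_mx1.
  by rewrite map_mx1 mulmx1.
clearbody W1.
have a1u : a1 km kk \is a GRing.unit by rewrite /a1 -xrowE mxE tpermR.
(* Replaces the basis vector at [k - 1] by the [k]-th vector of [W']; the unit entry keeps this a
   basis. *)
pose b : 'M[O]_n := (1%:M + delta_mx km 0 *m ((col kk a1)^T - delta_mx 0 km))^T.
have bE (l m : 'I_n) : b l m = if m == km then a1 l kk else (l == m)%:R.
  have -> : b l m = row m (1%:M + delta_mx km 0 *m ((col kk a1)^T - delta_mx 0 km)) 0 l.
    by rewrite !mxE.
  by rewrite replace_rowE; case: eqP => _; rewrite !mxE ?eqxx.
have bu : b \in unitmx by rewrite unitmx_tr unitmxE det_replace_row mxE [col _ _ _ _]mxE.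
pose W2 := W1 *m emb b.
have W2u : W2 \in unitmx by rewrite unitmx_mul W1u emb_unit.
have W2col : W2 *m (delta_mx km 0 : 'cV_n) = W' *m delta_mx kk 0.
  rewrite W'E1 /W2 -!mulmxA -!(map_delta_mx (val : O -> F)) -!map_mxM; congr (_ *m emb _).
  by rewrite -!colE; apply/colP => i; rewrite [LHS]mxE [RHS]mxE bE eqxx.
have W2E (i : 'I_n) : (i \in S) || (k <= i)%N -> latt (W2 *m D i) = latt (W1 *m D i).
  move=> iS; apply: flag_stable => // l m /andP[li im]; rewrite bE.
  case: eqP => [e|_]; last by rewrite (ord_outside li im) rmorph0 ordge0.
  have ikm : (i <= k.-1)%N by move: im; rewrite e.
  have iS' : i \in S by case/orP: iS => // ki; move: ikm; rewrite leqNgt prednK // ki.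
  apply: (@flag_entry _ _ _ W1 _ i) => //; last by rewrite li (leq_trans ikm (leq_pred k)).
  by rewrite -W'E1 -(agree i) ?iS' // W1E ?iS'.
clearbody W2.
have C2 : connect (gallery_step S) (fl W1) (fl W2).
  by apply: (IH _ _ (ltnW kn) W1u W2u) => i iS; rewrite W2E.
(* The only effect of this swap on the flag is at position [k]. *)
pose W3 := W2 *m emb (tperm_mx km kk).
have W3u : W3 \in unitmx by apply: tperm_unit.
have W3col : W3 *m (delta_mx kk 0 : 'cV_n) = W' *m delta_mx kk 0.
  rewrite -W2col /W3 -mulmxA -!(map_delta_mx (val : O -> F)) -map_mxM; congr (_ *m emb _).
  rewrite -colE; apply/colP => i; rewrite !mxE eqxx andbT; congr (_ %:R).
  by rewrite -[X in _ == X](tpermL km kk) (inj_eq perm_inj).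
have W3E (i : 'I_n) : i != kk -> latt (W3 *m D i) = latt (W2 *m D i).
  move=> ik; have ik' : (i != k :> nat) by apply: contra ik => /eqP e'; apply/eqP/val_inj.
  apply: tperm_stable => //=; first exact: leq_pred.
  by exact: outside_pred_neq.
clearbody W3.
have C3 : connect (gallery_step S) (fl W2) (fl W3).
  by apply: (step_of W2u W3u kS) => i ik; rewrite W3E.
have W3S (i : 'I_n) : (i \in S) || (k < i)%N -> latt (W3 *m D i) = latt (W' *m D i).
  move=> iS; have iS' : (i \in S) || (k <= i)%N.
    by case/orP: iS => [->//|ki]; rewrite (ltnW ki) orbT.
  have ik : i != kk.
    apply: contraTneq iS => ->; rewrite negb_or kS /= ltnn //.
  exact: (etrans (W3E i ik) (etrans (W2E i iS') (etrans (W1E i iS) (agree i iS)))).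
have W3W' : latt W3 = latt W'.
  by have := W3S ord0; rewrite S0 => /(_ isT); rewrite flag0 map_mx1 !mulmx1.
have W3k : latt (W3 *m D kk) = latt (W' *m D kk).
  apply: latt_flag_basis => //.
  move: (kn); rewrite leq_eqVlt => /orP[/eqP e|ltn].
    by rewrite [kk.+1]e !flag_n (latt_scale_eq _ W3W').
  by apply: (W3S (Ordinal ltn)); rewrite /= leqnn orbT.
apply: connect_trans C1 _; apply: connect_trans C2 _; apply: connect_trans C3 _.
apply: (IH _ _ (ltnW kn) W3u W'u).
move=> i /orP[iS|]; first by apply: W3S; rewrite iS.
rewrite leq_eqVlt => /orP[/eqP e|ki]; last by apply: W3S; rewrite ki orbT.
by rewrite (_ : i = kk) //; apply: val_inj.
Qed.

Lemma gallery_connected S c c' : ord0 \in S -> chb c -> chb c' -> {in S, c =1 c'} ->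
  connect (gallery_step S) c c'.
Proof.
move=> S0 /asboolP cc /asboolP cc' e.
have [W Wu cW] := (chamberP d2 r0 wide c).1 cc.
have c'0 : c' ord0 = pr W by rewrite -e // cW flag0 map_mx1 mulmx1.
have [W' [W'u _ c'W' al]] := chamber_align d2 r0 wide cc' Wu c'0.
have -> : c = fl W by apply/ffunP => i; rewrite ffunE cW.
have -> : c' = fl W' by apply/ffunP => i; rewrite ffunE c'W'.
apply: (gallery_flags (k := n)) => // i /orP[iS|]; last by rewrite leqNgt ltn_ord.
by case: (al i i) => //; rewrite -e // cW.
Qed.

(** A chamber at the vertex of [W] comes from [W *m emb a] with [a] integral and invertible, and
    depends only on [a] modulo [unif ^+ r]; matrices over O / pi^r bound the count. *)
Lemma chambers_at_vertex v :
  (#|[set c | chb c && (c ord0 == v)]| <= (q ^ r) ^ (n * n))%N.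
Proof.
have [A [rho [rho_surj rho_eq0]]] := truncated_ring F r0.
have cardA : #|A| = (q ^ r)%N.
  by rewrite (card_chain_ring r0 rho_surj rho_eq0) At_density.
have [W Wu Wv] := pr_surj v.
have code c : exists m : 'M[A]_n, chb c && (c ord0 == v) ->
    exists a : 'M[O]_n, [/\ a \in unitmx, m = map_mx rho a & c = fl (W *m emb a)].
  have [/andP[/asboolP cc /eqP c0]|_] := boolP (chb c && (c ord0 == v)); last by exists 0.
  have [W' [W'u e cW']] := chamber_lift d2 r0 wide cc Wu (etrans Wv (esym c0)).
  have [a au W'E] : exists2 a : 'M[O]_n, a \in unitmx & W' = W *m emb a by apply/latt_eqP.
  exists (map_mx rho a) => _; exists a; split => //.
  by apply/ffunP => i; rewrite ffunE cW' W'E.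
have [m mE] := choice code.
rewrite -cardA -card_mx -(card_in_imset (f := m)); first exact: max_card.
move=> c c'; rewrite !inE => /mE [a [au ma cE]] /mE [a' [a'u ma' cE']] e; rewrite cE cE'.
have aa' : a' = a *m (invmx a *m a') by rewrite mulKVmx.
apply/ffunP => i; apply: fl_eq; rewrite ?unitmx_mul ?Wu ?emb_unit //.
rewrite aa' map_mxM mulmxA; apply/esym/flag_stable.
- by rewrite unitmx_mul Wu emb_unit.
- by rewrite unitmx_mul unitmx_inv au.
move=> l j /andP[li ij]; rewrite -rho_eq0; apply/eqP.
have : map_mx rho (invmx a *m a') l j = (1%:M : 'M_n) l j.
  rewrite map_mxM -ma' -e ma -map_mxM mulVmx // map_mx1 //.
rewrite !mxE => ->; rewrite (_ : l == j = false) //; apply/negbTE.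
by rewrite -val_eqE /=; lia.
Qed.

End Galleries.

(* Completion of an incident point-line pair to a basis. *)
Lemma flag_complete (F : localField) (r : nat) (A : finComUnitRingType)
    (rho : {rmorphism vring F -> A}) :
  (forall a, exists x, rho x = a) -> (forall x, (rho x == 0) = ordge ord r%:Z (val x)) ->
  forall u v : 'cV[A]_3, u \in unimod A 3 -> v \in unimod A 3 -> dot u v = 0 ->
  exists h : 'M[A]_3, [/\ h \in unitmx, row 0 (invmx h) = u^T & col 2 h = v].
Proof.
move=> rs r0 u v uU vU uv.
have [g gu g0] := unimod_complete uU.
have gtu : g^T \in unitmx by rewrite unitmx_tr.
pose w := g^T *m v.
have w0 : w 0 0 = 0.
  by rewrite -uv -g0 colE dot_mull dot_delta.
have wU : w \in unimod A 3 by rewrite (unimod_mul rs r0).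
have [i i0 wi] : exists2 i : 'I_3, i != 0 & w i 0 \is a GRing.unit.
  move: wU; rewrite inE => /existsP [i wi]; exists i => //.
  by apply: contraTneq wi => ->; rewrite w0 unitr0.
pose w' := tperm_mx i 2 *m w.
have w'2 : w' 2 0 = w i 0 by rewrite /w' -xrowE mxE tpermR.
have w'0 : w' 0 0 = 0 by rewrite /w' -xrowE mxE tpermD // eq_sym.
pose B : 'M[A]_3 := (1%:M + delta_mx 2 0 *m (w'^T - delta_mx 0 2))^T.
have Bu : B \in unitmx by rewrite unitmx_tr unitmxE det_replace_row mxE w'2.
have Pu : (tperm_mx i 2 : 'M[A]_3) \in unitmx by rewrite unitmx_perm.
have col2B : col 2 B = w'.
  rewrite -tr_row replace_rowE eqxx trmxK //.
have row0B : row 0 B = delta_mx 0 0.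
  apply/rowP => j; rewrite mxE mxE.
  have -> : (1%:M + delta_mx 2 0 *m (w'^T - delta_mx 0 2)) j 0 =
    row j (1%:M + delta_mx 2 0 *m (w'^T - delta_mx 0 2)) 0 0 by rewrite [RHS]mxE.
  rewrite replace_rowE; case: eqP => [->|_]; first by rewrite [LHS]mxE w'0 [RHS]mxE.
  by rewrite !mxE eq_sym.
have PP : tperm_mx i 2 *m tperm_mx i 2 = 1%:M :> 'M[A]_3.
  by rewrite -perm_mxM tperm2 perm_mx1.
have row0P : row 0 (tperm_mx i 2 : 'M[A]_3) = delta_mx 0 0.
  apply/rowP => j; rewrite !mxE tpermD // 1?eq_sym //.
exists (invmx g^T *m (tperm_mx i 2 *m B)); split.
- by rewrite !unitmx_mul unitmx_inv gtu Pu Bu.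
- have K : u^T *m (invmx g^T *m (tperm_mx i 2 *m B)) = delta_mx 0 0.
    rewrite -g0 tr_col rowE -!mulmxA mulKVmx // !mulmxA -!rowE row0P -rowE row0B //.
  rewrite rowE -K mulmxK // !unitmx_mul unitmx_inv gtu Pu Bu //.
- rewrite colE -!mulmxA -colE col2B /w' !mulmxA -(mulmxA (invmx _)) PP mulmx1.
  by rewrite mulVmx // mul1mx.
Qed.

(** * Chambers varying at positions 1 and 2 form a Hjelmslev plane *)

Section Block.
Variables (d q r : nat) (X : AtildeComplex d q).
Hypothesis d2 : (2 <= d)%N.
Hypothesis r0 : (0 < r)%N.
Hypothesis wide : geodesically_wide X r.
Local Notation F := (At_field X).
Local Notation n := d.+1.
Local Notation V := (At_vertex X).
Local Notation O := (vring F).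
Local Notation emb M := (map_mx (val : O -> F) M).
Local Notation D i := (emb (flag_dg F d.+1 r i)).
Variable A : finComUnitRingType.
Variable rho : {rmorphism O -> A}.
Hypothesis rho_surj : forall a, exists x, rho x = a.
Hypothesis rho_eq0 : forall x, (rho x == 0) = ordge ord r%:Z (val x).
Variable W : 'M[F]_n.
Hypothesis Wu : W \in unitmx.
Local Notation U := (unimod A 3).

Let n3 : (3 <= n)%N := d2.
Let wd (l : 'I_3) : 'I_n := widen_ord n3 l.
Let i1 : 'I_n := wd 1.
Let i2 : 'I_n := wd 2.

Definition stab (a : 'M[O]_n) := a \in unitmx /\
  forall i : 'I_n, i != i1 -> i != i2 -> latt (W *m emb a *m D i) = latt (W *m D i).

Let Wa_unit a : stab a -> W *m emb a \in unitmx.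
Proof. by case=> au _; rewrite unitmx_mul Wu emb_unit. Qed.

Let al (a : 'M[O]_n) := map_mx rho a.
Let be (a : 'M[O]_n) := map_mx rho (invmx a).

Let be_al a : stab a -> be a *m al a = 1%:M.
Proof. by case=> au _; rewrite -map_mxM mulVmx // map_mx1. Qed.

Let al_be a : stab a -> al a *m be a = 1%:M.
Proof. by case=> au _; rewrite -map_mxM mulmxV // map_mx1. Qed.

Let al0 a (l j : 'I_n) : stab a -> (l < 3 <= j)%N -> al a l j = 0.
Proof.
case=> au sa lj; rewrite mxE; apply/eqP; rewrite rho_eq0.
have j3 : (3 < n)%N by case/andP: lj => _ h; apply: leq_ltn_trans h (ltn_ord j).
apply: (@flag_entry _ _ _ W _ 3) => //.
by rewrite (sa (Ordinal j3)).
Qed.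

Let be0 a (l j : 'I_n) : stab a -> (l < 3 <= j)%N -> be a l j = 0.
Proof.
move=> st lj; have [au sa] := st; rewrite mxE; apply/eqP; rewrite rho_eq0.
have j3 : (3 < n)%N by case/andP: lj => _ h; apply: leq_ltn_trans h (ltn_ord j).
apply: (@flag_entry _ _ _ (W *m emb a) _ 3) => //; first exact: Wa_unit.
by rewrite -(mulmxA W) -map_mxM mulmxV // map_mx1 mulmx1 (sa (Ordinal j3)).
Qed.

Let sum3 (f : 'I_n -> A) : (forall m : 'I_n, (3 <= m)%N -> f m = 0) ->
  \sum_m f m = \sum_(m < 3) f (wd m).
Proof.
move=> f0; rewrite -(big_ord_narrow n3) [RHS]big_mkcond /=.
by apply: eq_bigr => m _; case: ltnP => // /f0.
Qed.

(** Modulo [unif ^+ r], position 1 is the kernel of the linear form dual to the first basis vector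
    of [W *m emb a], and position 2 is generated, modulo the member at 3, by the third basis vector.
    Three coordinates suffice, by [be0] and [al0]. *)
Definition line_of (a : 'M[O]_n) : 'cV[A]_3 := \col_l be a ord0 (wd l).
Definition point_of (a : 'M[O]_n) : 'cV[A]_3 := \col_l al a (wd l) i2.

Let line_ofE a l : line_of a l 0 = be a ord0 (wd l). Proof. by rewrite mxE. Qed.
Let point_ofE a l : point_of a l 0 = al a (wd l) i2. Proof. by rewrite mxE. Qed.

Let mul3 (x y : 'M[A]_n) (l j : 'I_n) : (forall m : 'I_n, (3 <= m)%N -> x l m = 0) ->
  (x *m y) l j = \sum_(m < 3) x l (wd m) * y (wd m) j.
Proof. by move=> x0; rewrite mxE sum3 // => m /x0 ->; rewrite mul0r. Qed.

Let be_row a (l : 'I_n) : stab a -> (l < 3)%N -> forall m : 'I_n, (3 <= m)%N -> be a l m = 0.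
Proof. by move=> st l3 m m3; apply: be0 => //; rewrite l3. Qed.

(** This is entry (0, 2) of the identity [be a *m al a]. *)
Lemma incident a : stab a -> dot (line_of a) (point_of a) = 0.
Proof.
move=> st; have := mul3 (al a) i2 (@be_row a ord0 st isT).
rewrite be_al // mxE /= => /esym h; rewrite -[RHS]h.
by apply: eq_bigr => l _; rewrite !mxE.
Qed.

Lemma line_unimod a : stab a -> line_of a \in U.
Proof.
move=> st; apply: (unimod_pairing rho_surj rho_eq0 (p := \row_l al a (wd l) ord0)).
have := mul3 (al a) ord0 (@be_row a ord0 st isT); rewrite be_al // mxE eqxx mulr1n => ->.
by rewrite mxE; apply: eq_bigr => l _; rewrite !mxE mulrC.
Qed.

Lemma point_unimod a : stab a -> point_of a \in U.
Proof.
move=> st; apply: (unimod_pairing rho_surj rho_eq0 (p := \row_l be a i2 (wd l))).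
have := mul3 (al a) i2 (@be_row a i2 st isT); rewrite be_al // mxE eqxx mulr1n => ->.
by rewrite mxE; apply: eq_bigr => l _; rewrite !mxE.
Qed.

Let rho0 (x : O) : rho x = 0 -> ordge ord r%:Z (val x).
Proof. by move=> e; rewrite -rho_eq0 e. Qed.

Let rho_mat m p (M : 'M[O]_(m, p)) i j : rho (M i j) = map_mx rho M i j.
Proof. by rewrite mxE. Qed.

Let stab_same a a' i : stab a -> stab a' ->
  (forall l j : 'I_n, (l < i <= j)%N -> (be a *m al a') l j = 0) ->
  latt (W *m emb a' *m D i) = latt (W *m emb a *m D i).
Proof.
move=> st st' H; have [au _] := st; have [a'u _] := st'.
have -> : W *m emb a' = W *m emb a *m emb (invmx a *m a').
  by rewrite map_mxM mulmxA -(mulmxA W) -map_mxM mulmxV // map_mx1 mulmx1.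
apply: flag_stable; first exact: Wa_unit.
  by rewrite unitmx_mul unitmx_inv au.
by move=> l j lj; apply: rho0; rewrite rho_mat map_mxM H.
Qed.

Let same_stab a a' i (l j : 'I_n) : stab a -> stab a' ->
  latt (W *m emb a' *m D i) = latt (W *m emb a *m D i) ->
  (l < i <= j)%N -> (be a *m al a') l j = 0.
Proof.
move=> st st' E lj; have [au _] := st; have [a'u _] := st'.
rewrite -map_mxM -rho_mat; apply/eqP; rewrite rho_eq0.
apply: (@flag_entry _ _ _ (W *m emb a) _ i) => //; first exact: Wa_unit.
by rewrite map_mxM mulmxA -(mulmxA W) -map_mxM mulmxV // map_mx1 mulmx1 E.
Qed.

(** Equality at position 1 means that row 0 of [be a' *m al a] vanishes off the diagonal, that is,
    that the two linear forms are proportional. *)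
Lemma line_eq a a' : stab a -> stab a' ->
  latt (W *m emb a *m D 1) = latt (W *m emb a' *m D 1) <->
  level rho r (line_of a) (line_of a').
Proof.
move=> st st'; split=> [E|].
  apply/levelP; exists ((be a' *m al a) ord0 ord0); exists 0; rewrite scaler0 addr0.
  apply/colP => l; rewrite [RHS]mxE !line_ofE.
  have {1}-> : be a' = be a' *m al a *m be a by rewrite -mulmxA al_be // mulmx1.
  rewrite [LHS]mxE (bigD1 ord0) //= big1 ?addr0 // => m m0.
  rewrite (@same_stab a' a 1) ?mul0r //.
  by rewrite lt0n; apply: contra m0 => /eqP e; apply/eqP/val_inj.
case/(level_r rho_eq0) => c E; apply: stab_same => // l j /andP[].
rewrite ltnS leqn0 => /eqP l0 j0.
have -> : l = ord0 by apply: val_inj.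
rewrite (mul3 _ _ (@be_row a' ord0 st' isT)).
transitivity (c * (be a *m al a) ord0 j).
  rewrite (mul3 _ _ (@be_row a ord0 st isT)) mulr_sumr; apply: eq_bigr => m _.
  by have /colP/(_ m) := E; rewrite [RHS]mxE !line_ofE => ->; rewrite mulrA.
rewrite be_al // mxE (_ : ord0 == j = false) ?mulr0 //.
by apply/negbTE; rewrite -val_eqE /= eq_sym -lt0n.
Qed.

Lemma point_eq a a' : stab a -> stab a' ->
  latt (W *m emb a *m D 2) = latt (W *m emb a' *m D 2) <->
  level rho r (point_of a) (point_of a').
Proof.
move=> st st'; split=> [E|].
  apply/levelP; exists ((be a *m al a') i2 i2); exists 0; rewrite scaler0 addr0.
  apply/colP => l; rewrite [RHS]mxE !point_ofE.
  have {1}-> : al a' = al a *m (be a *m al a') by rewrite mulmxA al_be // mul1mx.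
  rewrite [LHS]mxE (bigD1 i2) //= big1 ?addr0; first by rewrite mulrC.
  move=> m m2; case: (ltnP m 2) => m3.
    by rewrite (@same_stab a a' 2) ?mulr0 // m3.
  have m4 : (2 < m)%N.
    by rewrite ltn_neqAle m3 andbT; apply: contra m2 => /eqP e; apply/eqP/val_inj.
  by rewrite al0 ?mul0r //= ltn_ord.
case/(level_r rho_eq0) => c E; apply/esym/stab_same => // l j /andP[l2 j2].
have l3 : (l < 3)%N by apply: leq_trans l2 _.
rewrite (mul3 _ _ (@be_row a l st l3)).
move: j2; rewrite leq_eqVlt => /orP[/eqP e|j3]; last first.
  rewrite big1 // => m _; rewrite (al0 st') ?mulr0 // j3 andbT; exact: (ltn_ord m).
have -> : j = i2 by apply: val_inj.
transitivity (c * (be a *m al a) l i2).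
  rewrite (mul3 _ _ (@be_row a l st l3)) mulr_sumr; apply: eq_bigr => m _.
  by have /colP/(_ m) := E; rewrite [RHS]mxE !point_ofE => ->; rewrite mulrCA.
rewrite be_al // mxE (_ : l == i2 = false) ?mulr0 //.
by apply/negbTE; rewrite -val_eqE /= neq_ltn l2.
Qed.

Let ext (M : 'M[A]_3) : 'M[A]_n :=
  \matrix_(l, j) if (l < 3)%N && (j < 3)%N then M (inord l) (inord j) else (l == j)%:R.

Let ext_mul M N : ext M *m ext N = ext (M *m N).
Proof.
apply/matrixP => l j; rewrite [RHS]mxE; have [l3|l3] := ltnP l 3; last first.
  rewrite /= mxE (bigD1 l) //= big1 ?addr0 => [|m ml].
    by rewrite !mxE ltnNge l3 /= eqxx mul1r.
  by rewrite [ext M l m]mxE ltnNge l3 /= eq_sym (negPf ml) mul0r.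
have M0 (m : 'I_n) : (3 <= m)%N -> ext M l m = 0.
  by move=> m3; rewrite mxE (ltnNge m) m3 andbF (ord_outside l3 m3).
rewrite (mul3 _ _ M0) andTb; have [j3|j3] := ltnP j 3; last first.
  rewrite (ord_outside l3 j3) big1 // => m _.
  by rewrite [ext N _ _]mxE (ltnNge j) j3 andbF (@ord_outside _ 3 (wd m) j (ltn_ord m) j3) mulr0.
rewrite mxE; apply: eq_bigr => m _; rewrite [ext M _ _]mxE [ext N _ _]mxE l3 j3 (ltn_ord m) /=.
by rewrite (_ : inord m = m) //; apply: val_inj; rewrite /= inordK.
Qed.

Let ext1 : ext 1%:M = 1%:M.
Proof.
apply/matrixP => l j; rewrite !mxE; case: ifP => // /andP[l3 j3].
by congr (_%:R); rewrite -!val_eqE /= !inordK.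
Qed.

Let rho_lift (x : A) : O := projT1 (cid (rho_surj x)).
Let rho_liftK x : rho (rho_lift x) = x. Proof. exact: projT2 (cid (rho_surj x)). Qed.

Let lft (M : 'M[A]_3) : 'M[O]_n :=
  \matrix_(l, j) if (l < 3)%N && (j < 3)%N then rho_lift (M (inord l) (inord j)) else (l == j)%:R.

Let rho_lft M : map_mx rho (lft M) = ext M.
Proof.
apply/matrixP => l j; rewrite !mxE; case: ifP => _; first exact: rho_liftK.
by rewrite rmorph_nat.
Qed.

(** Complete the incident pair to a 3 by 3 basis, extend it by the identity and lift the entries;
    the lift is invertible because it is so modulo [unif ^+ r]. *)
Lemma block_lift u v : u \in U -> v \in U -> dot u v = 0 ->
  exists a, [/\ stab a, line_of a = u & point_of a = v].
Proof.
move=> uU vU uv; have [h [hu row0 col2]] := flag_complete rho_surj rho_eq0 uU vU uv.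
pose a := lft h.
have au : a \in unitmx.
  have H (i : 'I_n * 'I_n) : exists y, (1%:M - a *m lft (invmx h)) i.1 i.2 = vunif F ^+ r * y.
    apply/ordge_dvd/rho0; rewrite rho_mat map_mxB map_mxM !rho_lft ext_mul mulmxV //.
    by rewrite ext1 map_mx1 subrr mxE.
  have /fin_all_exists [y yE] := H.
  apply: (@det_unit_mod F n r a (lft (invmx h)) (\matrix_(i, j) y (i, j)) r0).
  have -> : vunif F ^+ r *: (\matrix_(i, j) y (i, j)) = 1%:M - a *m lft (invmx h).
    by apply/matrixP => i j; rewrite [LHS]mxE [X in _ * X]mxE -(yE (i, j)).
  by rewrite addrC subrK.
have st : stab a.
  split=> // i n1 n2; apply: flag_stable => // l j /andP[li ij].
  have j3 : (3 <= j)%N.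
    apply: leq_trans ij; move: n1 n2; rewrite -!val_eqE /=.
    by case: (nat_of_ord i) li => [|[|[|]]].
  by rewrite mxE (ltnNge j) j3 andbF (ord_outside li ij) rmorph0 ordge0.
have beE : be a = ext (invmx h).
  have e1 : al a *m ext (invmx h) = 1%:M by rewrite /al rho_lft ext_mul mulmxV // ext1.
  by rewrite -[RHS]mul1mx -(be_al st) -mulmxA e1 mulmx1.
exists a; split => //; apply/colP => l.
  rewrite line_ofE beE mxE /= ltn_ord.
  have /rowP/(_ l) := row0; rewrite mxE [RHS]mxE => <-.
  by congr (invmx h _ _); apply: val_inj; rewrite /= inordK.
rewrite point_ofE /al rho_lft mxE /= ltn_ord.
have /colP/(_ l) := col2; rewrite mxE => <-.
by congr (h _ _); apply: val_inj; rewrite /= inordK.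
Qed.

Let fl (a : 'M[O]_n) : {ffun 'I_n -> V} := [ffun i : 'I_n => pr (W *m emb a *m D i)].

Definition block : {set {ffun 'I_n -> V}} :=
  [set c | chb r c && [forall i, (i != i1) ==> (i != i2) ==> (c i == pr (W *m D i))]].

Lemma block_of a : stab a -> fl a \in block.
Proof.
move=> st; rewrite inE; apply/andP; split.
  apply/asboolP; have := chamber_flag d2 r0 wide (Wa_unit st).
  by congr (chamber r _); apply: funext => i; rewrite ffunE.
apply/forallP => i; apply/implyP => n1; apply/implyP => n2; rewrite ffunE; apply/eqP.
apply: pr_same; rewrite ?gdg_unit ?(Wa_unit st) //; apply: same_latt.
by case: st => _; apply.
Qed.

Lemma blockP c : c \in block -> exists2 a, stab a & c = fl a.
Proof.
rewrite inE => /andP[/asboolP cc /forallP cW].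
have cWi i : i != i1 -> i != i2 -> c i = pr (W *m D i).
  by move=> n1 n2; have := cW i; rewrite n1 n2 => /eqP.
have c0 : c ord0 = pr W by rewrite cWi // flag0 map_mx1 mulmx1.
have [W' [W'u e cE alg]] := chamber_align d2 r0 wide cc Wu c0.
have [a au W'E] : exists2 a : 'M[O]_n, a \in unitmx & W' = W *m emb a by apply/latt_eqP.
exists a; last by apply/ffunP => i; rewrite ffunE cE W'E.
by split=> // i n1 n2; rewrite -W'E; case: (alg i i (cWi i n1 n2)).
Qed.

(** Both lattices are within [r] of the lattice of [W], and 2 r <= n r. *)
Lemma block_latt a a' (i : 'I_n) : stab a -> stab a' -> pr (W *m emb a *m D i) = pr (W *m emb a' *m D i) :> V ->
  latt (W *m emb a *m D i) = latt (W *m emb a' *m D i).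
Proof.
move=> st st' e; have uu := Wa_unit st; have uu' := Wa_unit st'.
have L (b : 'M[O]_n) : stab b -> latt (W *m emb b) = latt W.
  by case=> _ /(_ ord0 isT isT); rewrite !flag0 !map_mx1 !mulmx1.
have N (M : 'M[F]_n) : M \in unitmx -> exists2 l, (l <= r)%N & near l M (M *m D i).
  move=> Mu; have [l lr] := near_flag_neq r Mu (ltn0Sn d) (ltn_ord i).
  by rewrite flag0 map_mx1 mulmx1; exists l.
have [l1 l1r N1] := N _ uu; have [l2 l2r N2] := N _ uu'.
have s : same_vertex (W *m emb a *m D i) (W *m emb a' *m D i).
  apply: (@pr_near d q r X wide _ _ (l1 + l2)) e; last by nia.
  apply: near_trans (near_sym N1) _.
  by rewrite -[l2]add0n; apply: near_trans N2; apply: near0 => //; apply: same_latt; rewrite !L.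
apply: same_color_eq => //; rewrite ?gdg_unit //.
by rewrite !color_dg //; congr (_ + _); apply: latt_color => //; rewrite !L.
Qed.

Lemma block_maps : exists X1 X2 : 'cV[A]_3 -> V,
  (forall a, stab a -> fl a i1 = X1 (line_of a)) /\ (forall a, stab a -> fl a i2 = X2 (point_of a)).
Proof.
have mk (f : 'M[O]_n -> 'cV[A]_3) (i : 'I_n) :
    (forall a a', stab a -> stab a' -> f a = f a' -> fl a i = fl a' i) ->
    exists Z : 'cV[A]_3 -> V, forall a, stab a -> fl a i = Z (f a).
  move=> H; have /choice [Z ZE] : forall u, exists x : V, forall a, stab a -> f a = u -> fl a i = x.
    move=> u; case: (pselect (exists a, stab a /\ f a = u)) => [[a [st <-]]|no].
      by exists (fl a i) => a' st' e; apply: H.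
    by exists (pr W) => a st e; case: no; exists a.
  by exists Z => a st; apply: ZE.
have [X1 E1] : exists Z : 'cV[A]_3 -> V, forall a, stab a -> fl a i1 = Z (line_of a).
  apply: mk => a a' st st' e; rewrite !ffunE; apply: pr_same; rewrite ?gdg_unit ?Wa_unit //.
  by apply/same_latt/(line_eq st st'); rewrite e level_refl.
have [X2 E2] : exists Z : 'cV[A]_3 -> V, forall a, stab a -> fl a i2 = Z (point_of a).
  apply: mk => a a' st st' e; rewrite !ffunE; apply: pr_same; rewrite ?gdg_unit ?Wa_unit //.
  by apply/same_latt/(point_eq st st'); rewrite e level_refl.
by exists X1, X2.
Qed.

Let unimod_orth u : u \in U -> exists2 v, v \in U & dot u v = 0.
Proof.
move=> uU; have card := card_lines_through r0 rho_surj rho_eq0 uU.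
have : (0 < #|[set v in U | dot u v == 0%R]|)%N.
  rewrite card muln_gt0; apply/andP; split.
    by apply/card_gt0P; exists 1; rewrite inE unitr1.
  rewrite muln_gt0 /= expn_gt0; apply/orP; left.
  by apply/card_gt0P; exists 0.
by case/card_gt0P => v; rewrite inE => /andP[vU uv]; exists v => //; apply/eqP.
Qed.

Definition incidence (x y : V) : bool := [exists c : {ffun 'I_n -> V} in block, (c i1 == x) && (c i2 == y)].

Lemma block_plane : exists X1 X2 : 'cV[A]_3 -> V,
  [/\ {in U &, forall u u', X1 u = X1 u' <-> level rho r u u'},
      {in U &, forall u u', X2 u = X2 u' <-> level rho r u u'} &
      {in U &, forall u v, incidence (X1 u) (X2 v) = (dot u v == 0)}] /\
  (fun c : {ffun 'I_n -> V} => c i1) @: block = point_set X1 /\ (fun c : {ffun 'I_n -> V} => c i2) @: block = point_set X2.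
Proof.
have [X1 [X2 [E1 E2]]] := block_maps; exists X1, X2.
have lineS u : u \in U -> exists2 a, stab a & line_of a = u.
  move=> uU; have [v vU uv] := unimod_orth uU.
  by have [a [st lu _]] := block_lift uU vU uv; exists a.
have pointS v : v \in U -> exists2 a, stab a & point_of a = v.
  move=> vU; have [u uU uv] := unimod_orth vU; rewrite dotC in uv.
  by have [a [st _ pu]] := block_lift uU vU uv; exists a.
have eq1 : {in U &, forall u u', X1 u = X1 u' <-> level rho r u u'}.
  move=> _ _ /lineS [a st <-] /lineS [a' st' <-]; rewrite -!E1 // -line_eq // !ffunE.
  split=> [/(block_latt st st') //|e].
  by apply: pr_same; rewrite ?gdg_unit ?Wa_unit //; apply: same_latt.
have eq2 : {in U &, forall u u', X2 u = X2 u' <-> level rho r u u'}.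
  move=> _ _ /pointS [a st <-] /pointS [a' st' <-]; rewrite -!E2 // -point_eq // !ffunE.
  split=> [/(block_latt st st') //|e].
  by apply: pr_same; rewrite ?gdg_unit ?Wa_unit //; apply: same_latt.
split; last split.
- split=> // u v uU vU; apply/existsP/eqP => [[c /and3P[/blockP [a st ->]]]|uv].
    rewrite E1 // E2 // => /eqP e1 /eqP e2.
    have /(level_r rho_eq0) [x ->] := (eq1 _ _ (line_unimod st) uU).1 e1.
    have /(level_r rho_eq0) [y ->] := (eq2 _ _ (point_unimod st) vU).1 e2.
    have := incident st; rewrite /dot => e.
    transitivity (y * x * (\sum_i line_of a i 0 * point_of a i 0)); last by rewrite e mulr0.
    by rewrite mulr_sumr; apply: eq_bigr => i _; rewrite !mxE mulrACA [x * y]mulrC.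
  have [a [st lu pv]] := block_lift uU vU uv.
  by exists (fl a); rewrite block_of // E1 // E2 // lu pv !eqxx.
- apply/setP => x; apply/imsetP/imsetP => [[c /blockP [a st ->] ->]|[u /lineS [a st <-] ->]].
    by exists (line_of a); [apply: line_unimod | rewrite E1].
  by exists (fl a); [apply: block_of | rewrite E1].
- apply/setP => x; apply/imsetP/imsetP => [[c /blockP [a st ->] ->]|[u /pointS [a st <-] ->]].
    by exists (point_of a); [apply: point_unimod | rewrite E2].
  by exists (fl a); [apply: block_of | rewrite E2].
Qed.

End Block.

(** * Abstract chamber systems with cyclic symmetry *)

Section ChamberComplex.
Variables (V : finType) (d : nat).
Local Notation n := d.+1.
Local Notation chamberType := {ffun 'I_n -> V}.
Implicit Types (c b : chamberType) (S I : {set 'I_n}) (s t : {set V}) (C : {set chamberType}).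

Definition agree_off I : rel chamberType :=
  fun c c' => [forall k, (k \notin I) ==> (c k == c' k)].

Lemma agree_offP I c c' : reflect (forall k, k \notin I -> c k = c' k) (agree_off I c c').
Proof.
apply: (iffP forallP) => [H k kI|H k]; first by apply/eqP/(implyP (H k)).
by apply/implyP => kI; apply/eqP/H.
Qed.

Lemma agree_off_equiv I : equivalence_rel (agree_off I).
Proof.
move=> x y z; split=> [|/agree_offP xy]; first by apply/agree_offP.
by apply/agree_offP/agree_offP => H k kI; [rewrite -xy // H | rewrite xy // H].
Qed.

Lemma agree_off_sub I (J : {set 'I_n}) : I \subset J -> subrel (agree_off I) (agree_off J).
Proof.
move=> IJ c c' /agree_offP H; apply/agree_offP => k kJ; apply: H.
by apply: contra kJ; apply/fintype.subsetP.
Qed.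

Definition block_at C c i j : {set chamberType} := [set b in C | agree_off [set i; j] c b].

Definition block_edge C c i j : rel V :=
  fun x y => [exists b : chamberType in block_at C c i j, (b i == x) && (b j == y)].

Definition values (B : {set chamberType}) i : {set V} := (fun b : chamberType => b i) @: B.

Lemma mem_values (B : {set chamberType}) i b : b \in B -> b i \in values B i.
Proof. exact: (imset_f (fun b : chamberType => b i)). Qed.

Definition chamber_complex C : {set {set V}} :=
  [set t : {set V} | [exists c : chamberType in C, t \subset [set c i | i in [set: 'I_n]]]].

Definition gallery C S : rel chamberType :=
  fun c c' => [&& c \in C, c' \in C & [exists i, (i \notin S) && agree_off [set i] c c']].

Definition rot_chamber k c : chamberType := [ffun i => c (iter k (@ordS n) i)].

(* The incidence graph of points and lines of the Hjelmslev plane over O / pi^r. *)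
Definition hjelmslev_plane (R : realType) (q r : nat) (P Q : {set V}) (E : rel V) : Prop :=
  [/\ {in P, forall x, #|[set y in Q | E x y]| = (q.+1 * q ^ r.-1)%N},
      {in Q, forall y, #|[set x in P | E x y]| = (q.+1 * q ^ r.-1)%N},
      (forall u : V -> R, \sum_(x in P) u x = 0 ->
        \sum_(y in Q) (\sum_(x in P | E x y) u x) ^+ 2 <=
        q%:R ^+ (2 * r).-1 * \sum_(x in P) u x ^+ 2) &
      forall a : R,
        (exists u w : V -> R,
          [/\ (exists2 x, x \in P & u x != 0) \/ (exists2 y, y \in Q & w y != 0),
              {in P, forall x, \sum_(y in Q | E x y) w y = a * u x} &
              {in Q, forall y, \sum_(x in P | E x y) u x = a * w y}]) <->
        power_link_spectrum q r a].

(** Interface between lattices and the combinatorics of links. Galleries are required only around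
    position 0 and planes only at positions 1 and 2; rotation moves them elsewhere. [cs_hybrid]
    expresses that positions that are not cyclic neighbours vary independently. *)
Record chamber_system (R : realType) (q r N : nat) C : Prop := ChamberSystem {
  cs_inj : forall c, c \in C -> injective c;
  cs_rot : forall c, c \in C -> rot_chamber 1 c \in C;
  cs_position : forall c c' i j, c \in C -> c' \in C -> c ord0 = c' ord0 ->
    c i = c' j -> i = j;
  cs_gallery : forall S c c', ord0 \in S -> c \in C -> c' \in C -> {in S, c =1 c'} ->
    connect (gallery C S) c c';
  cs_bound : forall v, (#|[set c in C | c ord0 == v]| <= N)%N;
  cs_plane : forall c (i j : 'I_n), c \in C -> val i = 1%N -> val j = 2%N ->
    hjelmslev_plane R q r (values (block_at C c i j) i) (values (block_at C c i j) j)
      (block_edge C c i j);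
  cs_hybrid : forall c c' (i j : 'I_n), c \in C -> c' \in C -> i != j -> j != ordS i -> i != ordS j ->
    agree_off [set i; j] c c' -> [ffun k => if k == i then c' k else c k] \in C;
  cs_vertex : forall v, exists2 c, c \in C & c ord0 = v
}.

Local Notation sg k := (iter k (@ordS n)).

Lemma iter_ordS_inv k : exists m, cancel (sg k) (sg m) /\ cancel (sg m) (sg k).
Proof.
have H a (e : nat) (i : 'I_n) : (a + e = k * n)%N -> sg a (sg e i) = i.
  move=> ae; apply: val_inj; rewrite /= !iter_ordS modnDml -addnA (addnC e) ae.
  by rewrite addnC modnMDl modn_small.
have e : (k * d + k = k * n)%N by rewrite mulnS addnC.
by exists (k * d)%N; split=> i; apply: H => //; rewrite addnC.
Qed.

Lemma iter_ordS_to (i j : 'I_n) : exists k, sg k i = j.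
Proof.
exists (j + (n - i))%N; apply: val_inj; rewrite /= iter_ordS addnCA subnKC ?modnDr ?modn_small //.
exact: ltnW (ltn_ord i).
Qed.

Lemma iter_ordSC k (i : 'I_n) : sg k (ordS i) = ordS (sg k i).
Proof. by rewrite -iterSr. Qed.

Lemma rot_chamberE k c i : rot_chamber k c i = c (sg k i). Proof. exact: ffunE. Qed.

Lemma rot_chamberK k m : cancel (sg k) (sg m) -> cancel (rot_chamber m) (rot_chamber k).
Proof. by move=> km c; apply/ffunP => i; rewrite !rot_chamberE km. Qed.

Lemma rot_values k c : [set rot_chamber k c i | i in [set: 'I_n]] = [set c i | i in [set: 'I_n]].
Proof.
have [m [km mk]] := iter_ordS_inv k.
apply/setP => x; apply/imsetP/imsetP => [[i _ ->]|[i _ ->]].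
  by exists (sg k i); rewrite ?rot_chamberE.
by exists (sg m i) => //; rewrite rot_chamberE mk.
Qed.

Lemma agree_off_rot I k c b :
  agree_off I (rot_chamber k c) (rot_chamber k b) = agree_off (sg k @: I) c b.
Proof.
have [m [km mk]] := iter_ordS_inv k.
apply/agree_offP/agree_offP => H i iI.
  by have := H (sg m i); rewrite !rot_chamberE mk; apply; apply: contra iI => iI; rewrite -(mk i) imset_f.
by rewrite !rot_chamberE; apply: H; rewrite mem_imset //; apply: iter_ordS_inj.
Qed.

Section System.
Variables (R : realType) (q r N : nat) (C : {set chamberType}).
Hypothesis H : chamber_system R q r N C.

Lemma rot_chamber_in k c : c \in C -> rot_chamber k c \in C.
Proof.
move=> cC; elim: k => [|k IH].
  by rewrite (_ : rot_chamber 0 c = c) //; apply/ffunP => i; rewrite rot_chamberE.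
rewrite (_ : rot_chamber k.+1 c = rot_chamber 1 (rot_chamber k c)); first exact: (cs_rot H).
by apply/ffunP => i; rewrite !rot_chamberE -iterSr.
Qed.

Lemma rot_chamber_mem k c : (rot_chamber k c \in C) = (c \in C).
Proof.
have [m [km mk]] := iter_ordS_inv k; apply/idP/idP; last exact: rot_chamber_in.
by move/(rot_chamber_in m); rewrite (rot_chamberK mk).
Qed.

Lemma position c c' i0 i j : c \in C -> c' \in C -> c i0 = c' i0 -> c i = c' j -> i = j.
Proof.
move=> cC c'C e0 e; have [k kE] := iter_ordS_to ord0 i0; have [m [km mk]] := iter_ordS_inv k.
apply: (can_inj mk); apply: (cs_position H (rot_chamber_in k cC) (rot_chamber_in k c'C)).
  by rewrite !rot_chamberE kE.
by rewrite !rot_chamberE !mk.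
Qed.

Lemma gallery_exists S i0 c c' : i0 \in S -> c \in C -> c' \in C -> {in S, c =1 c'} ->
  connect (gallery C S) c c'.
Proof.
move=> S0 cC c'C e; have [k kE] := iter_ordS_to ord0 i0; have [m [km mk]] := iter_ordS_inv k.
have : connect (gallery C (sg k @^-1: S)) (rot_chamber k c) (rot_chamber k c').
  apply: (cs_gallery H); rewrite ?rot_chamber_mem ?inE ?kE //.
  by move=> i; rewrite inE => iS; rewrite !rot_chamberE e.
case/connectP => p pp; elim: p c {cC e} pp => [|b p IH] c /=.
  by move=> _ /(can_inj (rot_chamberK mk)) ->.
case/andP => /and3P[cC bC /existsP [i /andP[iS pan]]] pp lp.
rewrite -(rot_chamberK km b) in pp lp pan bC.
apply: connect_trans _ (IH _ pp lp); apply: connect1.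
rewrite /gallery -(rot_chamber_mem k c) -(rot_chamber_mem k (rot_chamber m b)) cC bC /=; apply/existsP; exists (sg k i).
by move: iS; rewrite inE => -> /=; move: pan; rewrite agree_off_rot imset_set1.
Qed.

Lemma bound_at i v : (#|[set c in C | c i == v]| <= N)%N.
Proof.
have [k kE] := iter_ordS_to ord0 i; have [m [km mk]] := iter_ordS_inv k.
apply: leq_trans (cs_bound H v); rewrite -(card_imset _ (can_inj (rot_chamberK mk))).
apply: subset_leq_card; apply/fintype.subsetP => _ /imsetP [c cC ->].
by move: cC; rewrite !inE rot_chamber_mem rot_chamberE kE.
Qed.

Lemma plane_at c i : (2 <= d)%N -> c \in C ->
  hjelmslev_plane R q r (values (block_at C c i (ordS i)) i)
    (values (block_at C c i (ordS i)) (ordS i)) (block_edge C c i (ordS i)).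
Proof.
move=> d2 cC; have n1 : (1 < n)%N by apply: leq_trans d2 _.
pose i1 : 'I_n := Ordinal n1; pose i2 : 'I_n := Ordinal (d2 : (2 < n)%N).
have s12 : ordS i1 = i2 by apply: val_inj; rewrite /= modn_small.
have [k kE] := iter_ordS_to i1 i; have [m [km mk]] := iter_ordS_inv k.
have kE2 : sg k i2 = ordS i by rewrite -s12 iter_ordSC kE.
have memB b : (rot_chamber k b \in block_at C (rot_chamber k c) i1 i2) = (b \in block_at C c i (ordS i)).
  by rewrite !inE rot_chamber_mem agree_off_rot imsetU1 imset_set1 kE kE2.
have val12 (l l' : 'I_n) : sg k l = l' ->
    values (block_at C (rot_chamber k c) i1 i2) l = values (block_at C c i (ordS i)) l'.
  move=> e; apply/setP => x; apply/imsetP/imsetP => [[b bB ->]|[b bB ->]].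
    exists (rot_chamber m b); first by rewrite -memB (rot_chamberK km).
    by rewrite rot_chamberE -e km.
  by exists (rot_chamber k b); rewrite ?memB ?rot_chamberE ?e.
rewrite -!(val12 _ _ kE) -(val12 _ _ kE2).
rewrite (_ : block_edge C c i (ordS i) = block_edge C (rot_chamber k c) i1 i2).
  by apply: (cs_plane H) => //; apply: rot_chamber_in.
apply: funext => x; apply: funext => y; apply/existsP/existsP => [[b /and3P[bB b1 b2]]|[b /and3P[bB b1 b2]]].
  by exists (rot_chamber k b); rewrite memB !rot_chamberE kE kE2 bB b1 b2.
exists (rot_chamber m b); rewrite -memB (rot_chamberK km) bB !rot_chamberE -kE2 -kE !km.
by rewrite b1 b2.
Qed.

End System.
End ChamberComplex.

(** * Links in the complex of chambers *)

Section Links.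
Variables (V : finType) (d : nat).
Local Notation n := d.+1.
Local Notation chamberType := {ffun 'I_n -> V}.
Implicit Types (c b : chamberType) (S I : {set 'I_n}) (s t : {set V}).
Variables (R : realType) (q r N : nat) (C : {set chamberType}).
Hypothesis H : chamber_system R q r N C.
Hypothesis d2 : (2 <= d)%N.
Local Notation K := (chamber_complex C).

Lemma complexP t : reflect (exists2 c : chamberType, c \in C & t \subset [set c i | i in [set: 'I_n]]) (t \in K).
Proof.
rewrite inE; apply: (iffP existsP) => [[c /andP[]]|[c cC ct]]; first by exists c.
by exists c; rewrite cC.
Qed.

Lemma complex_sub s t : s \in K -> t \subset s -> t \in K.
Proof.
by move=> /complexP [c cC cs] ts; apply/complexP; exists c => //; apply: fintype.subset_trans cs.
Qed.

Lemma complex_trace t c : t \subset [set c i | i in [set: 'I_n]] -> t = c @: (c @^-1: t).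
Proof.
move=> /fintype.subsetP tc; apply/setP => x; apply/idP/imsetP => [xt|[j]]; last by rewrite inE => ? ->.
by have /imsetP [j _ xj] := tc x xt; exists j; rewrite // inE -xj.
Qed.

Lemma rotate_onto c i j : c \in C -> exists c', [/\ c' \in C, c' i = c j &
  [set c' k | k in [set: 'I_n]] = [set c k | k in [set: 'I_n]]].
Proof.
move=> cC; have [k kE] := iter_ordS_to i j; exists (rot_chamber k c).
by rewrite rot_chamberE kE rot_values (rot_chamber_in H).
Qed.

(** Rotate [c'] until one common vertex sits in the same place in both; [position] aligns the
    others. *)
Lemma meet_agree c S i0 c' : c \in C -> c' \in C -> i0 \in S ->
  c @: S \subset [set c' i | i in [set: 'I_n]] ->
  exists b, [/\ b \in C, {in S, c =1 b} &
    [set b k | k in [set: 'I_n]] = [set c' k | k in [set: 'I_n]]].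
Proof.
move=> cC c'C iS /fintype.subsetP sub.
have /imsetP [j _ e] := sub _ (imset_f c iS).
have [b [bC b0 bv]] := rotate_onto i0 j c'C; exists b; split=> // i iS'.
have := sub _ (imset_f c iS'); rewrite -bv => /imsetP [l _ el].
by rewrite el; congr (b _); apply/esym/(position H cC bC (etrans e (esym b0)) el).
Qed.

Section OneLink.
Variables (c : chamberType) (S : {set 'I_n}) (i0 : 'I_n).
Hypothesis cC : c \in C.
Hypothesis i0S : i0 \in S.
Local Notation Y := (link K (c @: S)).
Local Notation extends b := ((b \in C) /\ {in S, c =1 b}).

Lemma extend_eq b b' i j : extends b -> extends b' -> b i = b' j -> i = j.
Proof. by move=> [bC bS] [b'C b'S]; apply: (@position _ _ _ _ _ _ _ H b b' i0) => //; rewrite -bS ?b'S. Qed.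

Lemma linkP s : s \in Y <-> exists2 b, extends b & s \subset b @: ~: S.
Proof.
split=> [/imsetP [s']|[b [bC bS] sb]].
  rewrite inE => /andP[/complexP [c' c'C sc'] cs] ->.
  have [b [bC bS bv]] := meet_agree cC c'C i0S (fintype.subset_trans cs sc').
  exists b => //; apply/fintype.subsetP => x; rewrite finset.in_setD => /andP[xn xs].
  have := fintype.subsetP sc' x xs; rewrite -bv => /imsetP [j _ xj].
  apply/imsetP; exists j => //; rewrite inE; apply: contra xn => jS.
  by rewrite xj -bS // imset_f.
have cb : c @: S = b @: S by apply: eq_in_imset.
apply/imsetP; exists (s :|: c @: S).
  rewrite inE finset.subsetUr andbT; apply/complexP; exists b => //.
  rewrite finset.subUset cb; apply/andP; split.
    by apply: fintype.subset_trans sb _; apply: imsetS; apply: finset.subsetT.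
  by apply: imsetS; apply: finset.subsetT.
apply/setP => x; rewrite finset.in_setD finset.in_setU; case: (boolP (x \in c @: S)) => [xS|]; last by rewrite orbF.
apply/negP => /(fintype.subsetP sb) /imsetP [j]; rewrite inE => jS xj.
move: xS; rewrite cb => /imsetP [l lS xl]; case/negP: jS.
by rewrite (cs_inj H bC (etrans (esym xj) xl)).
Qed.

Lemma link_vertsP x : x \in verts Y <-> exists b i, [/\ extends b, i \notin S & x = b i].
Proof.
rewrite inE; split=> [/linkP [b eb]|[b [i [eb iS ->]]]].
  move=> sx; have xb := fintype.subsetP sx x (set11 x).
  by have [l lS ->] := imsetP xb; rewrite inE in lS; exists b, l.
by apply: (linkP _).2; exists b => //; rewrite finset.sub1set imset_f // inE.
Qed.

Lemma link_skelP x y : skel Y x y <->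
  exists b i j, [/\ extends b, i \notin S, j \notin S & i != j /\ (x = b i /\ y = b j)].
Proof.
split=> [/andP[xy /linkP [b eb]]|[b [i [j [eb iS jS [ij [-> ->]]]]]]].
  rewrite finset.subUset !finset.sub1set => /andP[/imsetP [i iS xi] /imsetP [j jS yj]].
  exists b, i, j; rewrite !inE in iS jS; split=> //; split=> //.
  by apply: contra xy => /eqP e; rewrite xi yj e.
apply/andP; split; first by apply: contra ij => /eqP /(cs_inj H eb.1) ->.
by apply/linkP; exists b => //; rewrite finset.subUset !finset.sub1set !imset_f ?inE.
Qed.

Lemma link_skel_verts x y : skel Y x y -> y \in verts Y.
Proof. by move=> /link_skelP [b [i [j [eb iS jS [_ [_ ->]]]]]]; apply/link_vertsP; exists b, j. Qed.

End OneLink.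

Section CodimensionTwo.
Variables (c : chamberType) (S : {set 'I_n}) (i0 i j : 'I_n).
Hypothesis cC : c \in C.
Hypothesis i0S : i0 \in S.
Hypothesis ij : i != j.
Hypothesis compS : ~: S = [set i; j].
Local Notation Y := (link K (c @: S)).
Local Notation B := (block_at C c i j).
Local Notation P := (values B i).
Local Notation Q := (values B j).
Local Notation E := (block_edge C c i j).

Let notinS l : (l \notin S) = (l == i) || (l == j).
Proof. by rewrite -finset.in_setC compS !inE. Qed.

Let memB b : b \in B <-> b \in C /\ {in S, c =1 b}.
Proof.
rewrite inE; split=> [/andP[bC /agree_offP e]|[bC e]].
  by split=> // l lS; apply: e; rewrite !inE -notinS lS.
by rewrite bC; apply/agree_offP => l; rewrite !inE -notinS negbK; apply: e.
Qed.

Lemma block_disjoint : [disjoint P & Q].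
Proof.
apply/pred0P => x; apply/negP => /andP[/imsetP [b /memB bB xb] /imsetP [b' /memB b'B xb']].
by case/negP: ij; apply/eqP/(extend_eq i0S bB b'B); rewrite -xb -xb'.
Qed.

Lemma block_verts : verts Y = P :|: Q.
Proof.
apply/setP => x; rewrite finset.in_setU; apply/idP/orP => [/(link_vertsP cC i0S) [b [l [eb]]]|].
  by rewrite notinS => /orP[/eqP->|/eqP->] ->; [left|right]; apply: mem_values; apply/memB.
move=> xPQ; apply/(link_vertsP cC i0S).
by case: xPQ => /imsetP [b /memB bB ->]; [exists b, i | exists b, j]; split=> //; rewrite notinS eqxx ?orbT.
Qed.

Lemma block_edgeP x y : E x y <-> exists b, [/\ b \in B, x = b i & y = b j].
Proof.
split=> [/existsP [b /and3P[bB /eqP <- /eqP <-]]|[b [bB -> ->]]]; first by exists b.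
by apply/existsP; exists b; rewrite bB !eqxx.
Qed.

Lemma block_edge_in x y : E x y -> x \in P /\ y \in Q.
Proof. by move/block_edgeP => [b [bB -> ->]]; split; apply: mem_values. Qed.

Lemma block_skel x y : skel Y x y = E x y || E y x.
Proof.
apply/idP/orP => [/(link_skelP cC i0S) [b [l [m [eb]]]]|].
  have bB : b \in B by apply/memB.
  rewrite !notinS => /orP[/eqP->|/eqP->] /orP[/eqP->|/eqP->] [lm [-> ->]]; rewrite ?eqxx // in lm *.
    by left; apply/block_edgeP; exists b.
  by right; apply/block_edgeP; exists b.
case=> /block_edgeP [b [/memB bB -> ->]]; apply/(link_skelP cC i0S).
  by exists b, i, j; split; rewrite ?notinS ?eqxx ?orbT.
by exists b, j, i; split; rewrite ?notinS ?eqxx ?orbT // eq_sym.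
Qed.

Let cB : c \in B. Proof. by apply/memB. Qed.

(** The hybrid of a chamber through [x] and one through [y] contains both. *)
Lemma block_edge_product x y : j != ordS i -> i != ordS j -> E x y = (x \in P) && (y \in Q).
Proof.
move=> nij nji.
apply/idP/andP => [/block_edge_in //|[/imsetP [b bB ->] /imsetP [b' b'B ->]]].
apply/block_edgeP; exists [ffun k => if k == i then b k else b' k].
have [bC bS] := (memB _).1 bB; have [b'C b'S] := (memB _).1 b'B.
split; last 2 first.
- by rewrite ffunE eqxx.
- by rewrite ffunE eq_sym (negPf ij).
apply/memB; split; last by move=> k kS; rewrite ffunE; case: ifP => _; [apply: bS|apply: b'S].
apply: (cs_hybrid H b'C bC ij nij nji); apply/agree_offP => k.
by rewrite !inE -notinS negbK => kS; rewrite -bS ?b'S.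
Qed.

Lemma link_complete_bipartite : j != ordS i -> i != ordS j -> complete_bipartite Y.
Proof.
move=> nij nji; exists P, Q; split.
- by apply/finset.set0Pn; exists (c i); apply: mem_values.
- by apply/finset.set0Pn; exists (c j); apply: mem_values.
- exact: block_disjoint.
- by rewrite block_verts.
by move=> x y; rewrite block_skel !block_edge_product //; congr (_ || _); apply: andbC.
Qed.

Lemma block_edge_disjoint x y : E x y -> E y x = false.
Proof.
move=> /block_edge_in [xP yQ]; apply/negbTE/negP => /block_edge_in [yP xQ].
by have /pred0P/(_ x) := block_disjoint; rewrite /= xP xQ.
Qed.

End CodimensionTwo.

End Links.

(** * Spectra of the links of codimension two *)

Lemma adj_eigenvalueP (R : realType) (V : finType) (Y : {set {set V}}) (a : R) :
  eigenvalue (adj_mx R Y) a <-> exists f : V -> R,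
    (exists2 x, x \in verts Y & f x != 0) /\
    {in verts Y, forall x, \sum_(y in verts Y) (skel Y x y)%:R * f y = a * f x}.
Proof.
have sumE (g : V -> R) : \sum_(y in verts Y) g y = \sum_(j < #|verts Y|) g (enum_val j).
  by rewrite (big_enum_val g).
split=> [/eigenvalueP [v vE v0]|[f [[x xY fx] fE]]].
  have [Y0|[x0 x0Y]] := finset.set_0Vmem (verts Y).
    case/negP: v0; apply/eqP/rowP => j; have := ltn_ord j.
    by rewrite {2}Y0 finset.cards0.
  pose f x := v ord0 (enum_rank_in x0Y x); exists f; split.
    have /rV0Pn [j vj] := v0; exists (enum_val j); first exact: enum_valP.
    by rewrite /f enum_valK_in.
  move=> x xY; rewrite sumE; have /rowP/(_ (enum_rank_in x0Y x)) := vE.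
  rewrite !mxE => <-; apply: eq_bigr => j _.
  by rewrite /f enum_valK_in mxE enum_rankK_in // skel_sym mulrC.
apply/eigenvalueP; exists (\row_j f (enum_val j)).
  apply/rowP => j; rewrite !mxE -fE ?enum_valP // sumE; apply: eq_bigr => i _.
  by rewrite !mxE skel_sym mulrC.
apply: contraNneq fx => /rowP/(_ (enum_rank_in xY x)).
by rewrite !mxE enum_rankK_in // => ->.
Qed.

(** The fraction sqrt q / (q+1) of the degree is sqrt(q^(2r-1)), the largest nontrivial
    eigenvalue. *)
Lemma power_spectrum_bound (R : realType) (q r : nat) (a : R) : (0 < q)%N -> (0 < r)%N ->
  power_link_spectrum q r a -> a != (q.+1 * q ^ r.-1)%N%:R -> a != - (q.+1 * q ^ r.-1)%N%:R ->
  `|a| <= Num.sqrt (q%:R : R) / q.+1%:R * (q.+1 * q ^ r.-1)%N%:R.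
Proof.
move=> q0 r0 sp a1 a2; case: sp a1 a2 => [->|->|[j /andP[_ jr] aE] _ _]; rewrite ?eqxx //.
have q1 : 1 <= (q%:R : R) by rewrite ler1n.
have -> : `|a| = Num.sqrt (q%:R ^+ j) by case: aE => ->; rewrite ?normrN ger0_norm ?sqrtr_ge0.
have -> : Num.sqrt (q%:R : R) / q.+1%:R * (q.+1 * q ^ r.-1)%N%:R = Num.sqrt (q%:R ^+ (2 * r).-1).
  rewrite natrM mulrA divfK ?pnatr_eq0 // natrX.
  have -> : (2 * r).-1 = (1 + r.-1 * 2)%N by rewrite -(prednK r0); lia.
  by rewrite exprD expr1 sqrtrM ?ler0n // exprM sqrtr_sqr ger0_norm // exprn_ge0 ?ler0n.
by apply: ler_wsqrtr; rewrite ler_weXn2l.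
Qed.

Section PlaneLink.
Variables (V : finType) (d : nat).
Local Notation n := d.+1.
Local Notation chamberType := {ffun 'I_n -> V}.
Variables (R : realType) (q r N : nat) (C : {set chamberType}).
Hypothesis H : chamber_system R q r N C.
Hypothesis d2 : (2 <= d)%N.
Hypothesis q0 : (0 < q)%N.
Hypothesis r0 : (0 < r)%N.
Variables (c : chamberType) (S : {set 'I_n}) (i0 i : 'I_n).
Hypothesis cC : c \in C.
Hypothesis i0S : i0 \in S.
Hypothesis compS : ~: S = [set i; ordS i].
Local Notation Y := (link (chamber_complex C) (c @: S)).
Local Notation P := (values (block_at C c i (ordS i)) i).
Local Notation Q := (values (block_at C c i (ordS i)) (ordS i)).
Local Notation E := (block_edge C c i (ordS i)).

Let ij : i != ordS i.
Proof.
rewrite -val_eqE /=; apply/eqP => e; have := modn_small (ltn_ord i).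
rewrite {1}e modn_mod; have [h|h] := leqP n i.+1; last first.
  by rewrite modn_small // => e'; move: e; rewrite modn_small // => /n_Sn.
have e1 : i.+1 = n by apply/eqP; rewrite eqn_leq h ltn_ord.
by move=> _; move: e; rewrite e1 modnn => i0'; move: e1; rewrite i0' => e1; move: d2; rewrite -ltnS -e1.
Qed.

Let vertsY : verts Y = P :|: Q. Proof. exact: (block_verts H cC i0S compS). Qed.
Let disj : [disjoint P & Q]. Proof. exact: (block_disjoint H c i0S ij compS). Qed.
Let notQ x : x \in P -> (x \in Q) = false.
Proof. by move=> xP; apply/negbTE/negP => xQ; have /pred0P/(_ x) := disj; rewrite /= xP xQ. Qed.
Let skelE x y : skel Y x y = E x y || E y x. Proof. exact: (block_skel H cC i0S ij compS). Qed.
Let Ein x y : E x y -> x \in P /\ y \in Q. Proof. exact: block_edge_in. Qed.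

Let skelP x y : x \in P -> skel Y x y = (y \in Q) && E x y.
Proof.
move=> xP; rewrite skelE; case yx: (E y x); first by case: (Ein yx); rewrite notQ.
by rewrite orbF; apply/idP/andP => [h|[]//]; case: (Ein h).
Qed.

Let skelQ x y : x \in Q -> skel Y x y = (y \in P) && E y x.
Proof.
move=> xQ; rewrite skelE; case xy: (E x y); first by case: (Ein xy) => /notQ; rewrite xQ.
by apply/idP/andP => [h|[]//]; case: (Ein h).
Qed.

Let sumP (f : V -> R) x : x \in P ->
  \sum_(y in verts Y) (skel Y x y)%:R * f y = \sum_(y in Q | E x y) f y.
Proof.
move=> xP; rewrite big_mkcond [RHS]big_mkcond; apply: eq_bigr => y _.
rewrite vertsY finset.in_setU skelP //; case yQ: (y \in Q) => /=; last by rewrite mul0r if_same.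
by rewrite orbT; case: (E x y); rewrite ?mul1r ?mul0r.
Qed.

Let sumQ (f : V -> R) x : x \in Q ->
  \sum_(y in verts Y) (skel Y x y)%:R * f y = \sum_(y in P | E y x) f y.
Proof.
move=> xQ; rewrite big_mkcond [RHS]big_mkcond; apply: eq_bigr => y _.
rewrite vertsY finset.in_setU skelQ //; case yP: (y \in P) => /=; last by rewrite mul0r if_same.
by case: (E y x); rewrite ?mul1r ?mul0r.
Qed.

Lemma plane_link_spectrum (a : R) : eigenvalue (adj_mx R Y) a <-> power_link_spectrum q r a.
Proof.
have [_ _ _ sp] := plane_at H i d2 cC; rewrite -sp; clear sp; split.
  move/adj_eigenvalueP => [f [[x xY fx] fE]]; exists f, f; split.
  - by move: xY; rewrite vertsY => /setUP [xP|xQ]; [left|right]; exists x.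
  - by move=> y yP; rewrite -sumP // fE // vertsY finset.in_setU yP.
  - by move=> y yQ; rewrite -sumQ // fE // vertsY finset.in_setU yQ orbT.
move=> [u [w [n0 uE wE]]]; apply/adj_eigenvalueP.
pose f x := if x \in P then u x else w x; exists f; split.
  case: n0 => [[x xP ux]|[y yQ wy]].
    by exists x; rewrite /f ?xP // vertsY finset.in_setU xP.
  exists y; first by rewrite vertsY finset.in_setU yQ orbT.
  by rewrite /f; case: ifP => // /notQ; rewrite yQ.
move=> x xY; have /setUP [xP|xQ] : x \in P :|: Q by rewrite -vertsY.
  rewrite (sumP f) // {2}/f xP -uE //; apply: eq_bigr => y /andP[yQ _]; rewrite /f.
  by case: ifP => // /notQ; rewrite yQ.
rewrite (sumQ f) // {2}/f; case: ifP => [/notQ|_]; first by rewrite xQ.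
by rewrite -wE //; apply: eq_bigr => y /andP[yP _]; rewrite /f yP.
Qed.

Lemma plane_link_expander : expander (q.+1 * q ^ r.-1) (Num.sqrt (q%:R : R) / q.+1%:R) Y.
Proof.
have [dP dQ _ _] := plane_at H i d2 cC; split; last first.
  by move=> a /plane_link_spectrum sp a1 a2; apply: power_spectrum_bound.
move=> x; rewrite vertsY /skel_deg => /setUP [xP|xQ].
  by rewrite -(dP x xP); apply: eq_card => y; rewrite !inE -skelP // skelE.
by rewrite -(dQ x xQ); apply: eq_card => y; rewrite !inE -skelQ // skelE.
Qed.

End PlaneLink.

(** * Links of nonempty cells: connectedness and bounded size *)

Section LowerLinks.
Variables (V : finType) (d : nat).
Local Notation n := d.+1.
Local Notation chamberType := {ffun 'I_n -> V}.
Implicit Types (c b : chamberType) (S I : {set 'I_n}) (s t : {set V}).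
Variables (R : realType) (q r N : nat) (C : {set chamberType}).
Hypothesis H : chamber_system R q r N C.
Hypothesis d2 : (2 <= d)%N.
Hypothesis q0 : (0 < q)%N.
Hypothesis r0 : (0 < r)%N.
Local Notation K := (chamber_complex C).

Lemma chamber_of_cell t : t \in K -> exists c S, [/\ c \in C, t = c @: S & #|S| = #|t|].
Proof.
move/complexP => [c cC tc]; exists c, (c @^-1: t).
have e := complex_trace tc; split=> //.
by rewrite {2}e card_imset //; apply: (cs_inj H).
Qed.

Theorem codimension_two_links t : t \in faces K (d - 2) ->
  let Y := link K t in
  complete_bipartite Y \/
  (expander (q.+1 * q ^ r.-1) (Num.sqrt (q%:R : R) / q.+1%:R) Y /\
   (forall a : R, eigenvalue (adj_mx R Y) a <-> power_link_spectrum q r a)).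
Proof.
rewrite inE => /andP[/chamber_of_cell [c [S [cC -> <-]]] /eqP cardS] /=.
have /card_gt0P [i0 i0S] : (0 < #|S|)%N by rewrite cardS.
have /cards2P [i [j [ij compS]]] : #|~: S| == 2.
  by apply/eqP/(@addnI #|S|); rewrite cardsC card_ord cardS; lia.
have [ji|ji] := eqVneq j (ordS i).
  by right; subst j; split; [exact: (plane_link_expander H d2 q0 r0 cC i0S compS) | exact: (plane_link_spectrum H d2 cC i0S compS)].
have [ij'|ij'] := eqVneq i (ordS j).
  rewrite finset.setUC in compS; subst i.
  by right; split; [exact: (plane_link_expander H d2 q0 r0 cC i0S compS) | exact: (plane_link_spectrum H d2 cC i0S compS)].
by left; apply: (link_complete_bipartite H cC i0S ij compS).
Qed.

Section OneLink.
Variables (c : chamberType) (S : {set 'I_n}) (i0 : 'I_n).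
Hypothesis cC : c \in C.
Hypothesis i0S : i0 \in S.
Hypothesis Sd : (#|S| < d)%N.
Local Notation Y := (link K (c @: S)).
Local Notation extends b := ((b \in C) /\ {in S, c =1 b}).

Let card_comp : (1 < #|~: S|)%N.
Proof. by have := cardsC S; rewrite card_ord; move: Sd; lia. Qed.

(** At least two positions are free, so consecutive chambers of a gallery fixing [S] share a vertex
    outside [S]. *)
Let link_connect b b' i j : extends b -> extends b' -> i \notin S -> j \notin S ->
  connect (skel Y) (b i) (b' j).
Proof.
have same b0 l m : extends b0 -> l \notin S -> m \notin S -> connect (skel Y) (b0 l) (b0 m).
  move=> eb lS mS; have [->//|lm] := eqVneq l m; apply: connect1.
  by apply/(link_skelP H cC i0S); exists b0, l, m.
move=> eb [b'C b'S] iS jS.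
have : connect (gallery C S) b b'.
  by apply: (gallery_exists H i0S eb.1 b'C) => l lS; rewrite -b'S // -eb.2.
case/connectP => p; elim: p b i eb iS => [|b1 p IH] b i eb iS /=; first by move=> _ ->; apply: same.
case/andP => /and3P[bC b1C /existsP [k /andP[kS /agree_offP bb1]]] pp lp.
have eb1 : extends b1.
  split=> // l lS; rewrite eb.2 // bb1 // inE; by apply: contra kS => /eqP <-.
have [m mS mk] : exists2 m, m \notin S & m != k.
  have : (0 < #|~: S :\ k|)%N.
    by have := card_comp; rewrite (cardsD1 k); case: (k \in _) => //=; apply: ltnW.
  by case/card_gt0P => m; rewrite !inE => /andP[mk mS]; exists m.
have e : b m = b1 m by apply: bb1; rewrite inE.
apply: connect_trans (same _ _ _ eb iS mS) _; rewrite e; exact: IH pp lp.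
Qed.

Lemma link_skel_connected : skel_connected Y.
Proof.
move=> x y /(link_vertsP H cC i0S) [b [i [eb iS ->]]] /(link_vertsP H cC i0S) [b' [j [eb' jS ->]]].
exact: link_connect.
Qed.

Lemma link_card_verts : (1 < #|verts Y| <= n * N)%N.
Proof.
apply/andP; split.
  apply: leq_trans card_comp _; rewrite -(card_imset _ (cs_inj H cC)).
  apply/subset_leq_card/fintype.subsetP => _ /imsetP [i iS ->].
  by rewrite inE in iS; apply/(link_vertsP H cC i0S); exists c, i.
pose B := [set b in C | b i0 == c i0].
apply: (@leq_trans #|finset.setX [set: 'I_n] B|).
  apply: leq_trans (leq_imset_card (fun z : 'I_n * chamberType => z.2 z.1) _).
  apply/subset_leq_card/fintype.subsetP => x /(link_vertsP H cC i0S) [b [i [eb iS ->]]].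
  by apply/imsetP; exists (i, b); rewrite // !inE /= eb.1 (eb.2 _ i0S) eqxx.
by rewrite cardsX cardsT card_ord leq_mul2l (bound_at H) orbT.
Qed.

Lemma link_second_eigenvalue :
  exists2 mu, second_eigenvalue (nadj_mx R Y) mu &
    mu <= 1 - (((n * N)%N%:R * (n * N)%N%:R * 4 ^+ (n * N))^-1 / 2).
Proof.
apply: connected_second_eigenvalue link_skel_connected; first exact: link_card_verts.
exact: (link_skel_verts H cC i0S).
Qed.

End OneLink.
End LowerLinks.

(** * Angles in complete bipartite graphs and in planes *)

Lemma sum_const_set (R : pzSemiRingType) (T : finType) (A : {set T}) (p : pred T) (a : R) :
  \sum_(z in A | p z) a = #|[set z in A | p z]|%:R * a.
Proof. by rewrite mulr_natl -sumr_const; apply: eq_bigl => z; rewrite !inE. Qed.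

Section Pairings.
Variables (R : realType) (V : finType) (P Q : {set V}) (E : rel V).
Implicit Types (U W : V -> R).

Lemma pairing_exchange (f : V -> V -> R) :
  \sum_(y in P) \sum_(z in Q | E y z) f y z = \sum_(z in Q) \sum_(y in P | E y z) f y z.
Proof.
rewrite (exchange_big_dep (mem Q)) /=; last by move=> y z _ /andP[].
by apply: eq_bigr => z zQ; apply: eq_bigl => y; rewrite zQ.
Qed.

(** The pairing factors as a product of two sums: independent variables give orthogonality. *)
Lemma product_pairing U W : (forall y z, E y z = (y \in P) && (z \in Q)) ->
  \sum_(y in P) \sum_(z in Q | E y z) U z = 0 ->
  \sum_(y in P) \sum_(z in Q | E y z) U z * W y = 0.
Proof.
move=> EPQ.
have sumQ y (f : V -> R) : y \in P -> \sum_(z in Q | E y z) f z = \sum_(z in Q) f z.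
  by move=> yP; apply: eq_bigl => z; rewrite EPQ yP andbb.
rewrite (eq_bigr (fun=> \sum_(z in Q) U z)) => [|y yP]; last exact: sumQ.
rewrite sumr_const => /eqP; rewrite mulrn_eq0 => /orP[/eqP/finset.cards0_eq P0|/eqP U0].
  by rewrite P0 big_set0.
by rewrite big1 // => y yP; rewrite -mulr_suml sumQ // U0 mul0r.
Qed.

(** The cosine is the bound sqrt(q^(2r-1)) of the incidence operator on functions of sum zero,
    divided by the degree. *)
Lemma plane_pairing q r U W : (0 < q)%N -> (0 < r)%N -> hjelmslev_plane R q r P Q E ->
  \sum_(y in P) \sum_(z in Q | E y z) W y = 0 ->
  0 <= \sum_(y in P) \sum_(z in Q | E y z)
    (Num.sqrt (q%:R : R) / q.+1%:R * (U z ^+ 2 + W y ^+ 2) - 2 * (U z * W y)).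
Proof.
move=> q0 r0 [dP dQ bound _] W0.
set s := Num.sqrt _ / _; pose k : R := (q.+1 * q ^ r.-1)%N%:R.
have k0 : 0 < k by rewrite ltr0n muln_gt0 expn_gt0 q0.
have s0 : 0 < s by rewrite divr_gt0 ?sqrtr_gt0 ?ltr0n.
have sk : (s * k) ^+ 2 = q%:R ^+ (2 * r).-1.
  rewrite /s /k natrM mulrA divfK ?pnatr_eq0 // natrX exprMn sqr_sqrtr ?ler0n // -exprM -exprS.
  by congr (_ ^+ _); rewrite -(prednK r0); lia.
have sumP (f : V -> R) : \sum_(y in P) \sum_(z in Q | E y z) f y = k * \sum_(y in P) f y.
  by rewrite mulr_sumr; apply: eq_bigr => y yP; rewrite sum_const_set dP.
have sumQ (f : V -> R) : \sum_(y in P) \sum_(z in Q | E y z) f z = k * \sum_(z in Q) f z.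
  by rewrite pairing_exchange mulr_sumr; apply: eq_bigr => z zQ; rewrite sum_const_set dQ.
have {}W0 : \sum_(y in P) W y = 0.
  by apply/eqP; move/eqP: W0; rewrite sumP mulf_eq0 gt_eqF.
have B := bound _ W0; rewrite -sk in B.
pose S z := \sum_(y in P | E y z) W y.
have -> : \sum_(y in P) \sum_(z in Q | E y z) (s * (U z ^+ 2 + W y ^+ 2) - 2 * (U z * W y)) =
    s * k * (\sum_(z in Q) U z ^+ 2) + s * k * (\sum_(y in P) W y ^+ 2)
    - 2 * (\sum_(z in Q) U z * S z).
  transitivity (s * (\sum_(y in P) \sum_(z in Q | E y z) U z ^+ 2)
     + s * (\sum_(y in P) \sum_(z in Q | E y z) W y ^+ 2)
     - 2 * (\sum_(y in P) \sum_(z in Q | E y z) U z * W y)); last first.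
    rewrite sumP sumQ !mulrA pairing_exchange; congr (_ - _ * _).
    by apply: eq_bigr => z zQ; rewrite mulr_sumr.
  rewrite !mulr_sumr -big_split -sumrB; apply: eq_bigr => y yP /=.
  by rewrite !mulr_sumr -big_split -sumrB; apply: eq_bigr => z zQ /=; ring.
have : 0 < s * k by rewrite mulr_gt0.
move: (s * k) B => t B sk0.
(* Complete the square; what remains is nonnegative by [B]. *)
have -> : t * (\sum_(z in Q) U z ^+ 2) + t * (\sum_(y in P) W y ^+ 2)
    - 2 * (\sum_(z in Q) U z * S z) =
  t^-1 * (\sum_(z in Q) (t * U z - S z) ^+ 2 +
    (t ^+ 2 * \sum_(y in P) W y ^+ 2 - \sum_(z in Q) S z ^+ 2)).
  have -> : \sum_(z in Q) (t * U z - S z) ^+ 2 = t ^+ 2 * (\sum_(z in Q) U z ^+ 2)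
      - 2 * t * (\sum_(z in Q) U z * S z) + \sum_(z in Q) S z ^+ 2.
    by rewrite !mulr_sumr -sumrB -big_split; apply: eq_bigr => z _ /=; ring.
  by field; exact: lt0r_neq0.
by rewrite mulr_ge0 ?invr_ge0 ?(ltW sk0) // addr_ge0 ?subr_ge0 // sumr_ge0 // => z _; rewrite sqr_ge0.
Qed.

End Pairings.

(** The second inequality is that (sqrt q - 1)^2 is positive. *)
Lemma plane_gap (R : realType) (q : nat) : (1 < q)%N ->
  0 < Num.sqrt (q%:R : R) / q.+1%:R /\ 2 * (Num.sqrt (q%:R : R) / q.+1%:R) < 1.
Proof.
move=> q1.
have x2 : Num.sqrt (q%:R : R) ^+ 2 = q%:R by rewrite sqr_sqrtr ?ler0n.
have x0 : 0 < Num.sqrt (q%:R : R) by rewrite sqrtr_gt0 ltr0n ltnW.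
have qq : 1 < (q%:R : R) by rewrite ltr1n.
have qS : (q.+1%:R : R) = q%:R + 1 by rewrite -addn1 natrD.
split; first by rewrite divr_gt0 ?ltr0n.
rewrite mulrA ltr_pdivrMr ?ltr0n // mul1r qS.
have : Num.sqrt (q%:R : R) != 1 by apply: contraTneq qq => x1; rewrite -x2 x1 expr1n ltxx.
move=> ne; have : 0 < (Num.sqrt (q%:R : R) - 1) ^+ 2 by rewrite exprn_even_gt0 // subr_eq0.
have -> : (Num.sqrt (q%:R : R) - 1) ^+ 2 = Num.sqrt (q%:R : R) ^+ 2 - 2 * Num.sqrt (q%:R : R) + 1 by ring.
rewrite x2; move=> pos.
lra.
Qed.

(** * Spectral gap for functions of chambers *)

Section Gallery.
Variables (V : finType) (d : nat).
Local Notation n := d.+1.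
Local Notation chamberType := {ffun 'I_n -> V}.
Implicit Types (c b : chamberType) (S I : {set 'I_n}) (s t : {set V}).
Variables (R : realType) (q r N : nat) (C : {set chamberType}).
Hypothesis H : chamber_system R q r N C.
Hypothesis d2 : (2 <= d)%N.
Hypothesis q1 : (1 < q)%N.
Hypothesis r0 : (0 < r)%N.
Variable c0 : chamberType.
Hypothesis c0C : c0 \in C.
Local Notation K := (q.+1 * q ^ r.-1)%N.
Local Notation sq := (Num.sqrt (q%:R : R) / q.+1%:R).

Definition gallery_component : {set chamberType} := [set c | connect (gallery C finset.set0) c0 c].
Local Notation C0 := gallery_component.

Lemma gallery_component_sub c : c \in C0 -> c \in C.
Proof.
rewrite inE => /connectP [p]; elim: p c0 c0C => [|b p IH] c1 c1C /=; first by move=> _ ->.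
by case/andP => /and3P[_ bC _] pp lp; apply: IH pp lp.
Qed.

Lemma gallery_component_agree c c' S i0 : c \in C0 -> c' \in C -> i0 \in S -> {in S, c =1 c'} -> c' \in C0.
Proof.
move=> cC0 c'C iS e; have cC := gallery_component_sub cC0.
move: cC0; rewrite !inE => h; apply: connect_trans h _.
have := gallery_exists H iS cC c'C e; apply: connect_sub => b b'.
case/and3P => bC b'C /existsP [i /andP[_ bb']]; apply: connect1.
by rewrite /gallery bC b'C; apply/existsP; exists i; rewrite finset.in_set0.
Qed.

Local Notation T := {c : chamberType | c \in C0}.

Let e (I : {set 'I_n}) : rel T := fun x y => agree_off I (val x) (val y).

Let e_equiv I : equivalence_rel (e I).
Proof. by move=> x y z; apply: agree_off_equiv. Qed.

(** There is a third position, at which all chambers of the block agree, so a block stays inside one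
    gallery component. *)
Let block_T (x : T) (i j : 'I_n) b : b \in block_at C (val x) i j -> exists y : T, val y = b /\ e [set i; j] x y.
Proof.
rewrite inE => /andP[bC xb]; have /agree_offP xbE := xb.
have /card_gt0P [k kij] : (0 < #|~: [set i; j]|)%N.
  have := cardsC [set i; j]; rewrite card_ord cards2; case: (i != j) => /=; move: d2; lia.
have bC0 : b \in C0.
  apply: (gallery_component_agree (valP x) bC kij) => l lij.
  by apply: xbE; rewrite inE in lij.
by exists (exist _ b bC0).
Qed.

(** Within a block a chamber is determined by its vertices at [i] and [j], that is, by an edge of
    the block graph. *)
Let sum_block (x : T) (i j : 'I_n) (g : V -> V -> R) : i != j ->
  \sum_(y | e [set i; j] x y) g (val y i) (val y j) =
  \sum_(u in values (block_at C (val x) i j) i)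
    \sum_(v in values (block_at C (val x) i j) j | block_edge C (val x) i j u v) g u v.
Proof.
move=> ij; rewrite pair_big_dep /=.
pose A := [set y | e [set i; j] x y].
have -> : \sum_(y | e [set i; j] x y) g (val y i) (val y j) = \sum_(y in A) g (val y i) (val y j).
  by apply: eq_bigl => y; rewrite [RHS]inE.
rewrite -(big_imset (fun p : V * V => g p.1 p.2) (h := fun y : T => (val y i, val y j))) /=.
  apply: eq_bigl => -[u v] /=; apply/imsetP/idP => [[y]|].
    rewrite inE => exy [-> ->].
    have yB : val y \in block_at C (val x) i j.
      by rewrite inE (gallery_component_sub (valP y)); apply: exy.
    rewrite !mem_values //; apply/block_edgeP; by exists (val y).
  case/andP => _ /andP[_ /block_edgeP [b [bB -> ->]]].
  by have [y [yb exy]] := block_T bB; exists y; rewrite ?inE // yb.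
move=> y z; rewrite !inE => /agree_offP xy /agree_offP xz [yzi yzj].
apply: val_inj; apply/ffunP => k.
have [->//|ki] := eqVneq k i; have [->//|kj] := eqVneq k j.
by rewrite -xy ?xz // !inE negb_or ki.
Qed.

Let factor (x : T) (i j : 'I_n) (u : T -> R) : constant_along (e [set i]) u ->
  exists U : V -> R, forall y, e [set i; j] x y -> u y = U (val y j).
Proof.
move=> cu; suff /choice [U UE] : forall v, exists a : R,
    forall y, e [set i; j] x y -> val y j = v -> u y = a.
  by exists U => y exy; apply: UE exy _.
move=> v; case: (pselect (exists2 y, e [set i; j] x y & val y j = v)) => [[y exy yv]|no].
  exists (u y) => z exz zv; apply: cu; apply/agree_offP => k; rewrite inE => ki.
  have [->|kj] := eqVneq k j; first by rewrite zv yv.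
  by move/agree_offP: exz => <-; [move/agree_offP: exy => <- |]; rewrite // !inE negb_or ki.
by exists 0 => y exy yv; case: no; exists y.
Qed.

Let sum_class (x : T) I (u : T -> R) : avg (e I) u =1 (fun=> 0) -> \sum_(y | e I x y) u y = 0.
Proof.
move=> /(_ x) /eqP; rewrite /avg mulf_eq0 invr_eq0 => /orP[/eqP //|h].
by have := class_card_neq0 R (e_equiv I) x; rewrite h.
Qed.

(** By [complement_angle] it suffices to compare functions independent of vertex [i] with those
    independent of vertex [j], block by block. On a block they are functions [U] of vertex [j] and
    [W] of vertex [i]. *)
Let mean_angle (i j : 'I_n) (eps : R) : i != j -> 0 <= eps <= 1 ->
  (forall (x : T) (U W : V -> R),
     let B := block_at C (val x) i j in
     let E := block_edge C (val x) i j in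
     \sum_(y in values B i) \sum_(z in values B j | E y z) U z = 0 ->
     \sum_(y in values B i) \sum_(z in values B j | E y z) W y = 0 ->
     0 <= \sum_(y in values B i) \sum_(z in values B j | E y z)
       (eps * (U z ^+ 2 + W y ^+ 2) - 2 * (U z * W y))) ->
  forall F : T -> R,
    - (eps * (dotp (dev (e [set i]) F) (dev (e [set i]) F) +
              dotp (dev (e [set j]) F) (dev (e [set j]) F))) <=
    2 * dotp (dev (e [set i]) F) (dev (e [set j]) F).
Proof.
move=> ij eps01 HB; apply: (complement_angle (e12 := e [set i; j])) => //.
- by move=> x y; apply: agree_off_sub; rewrite finset.sub1set !inE eqxx.
- by move=> x y; apply: agree_off_sub; rewrite finset.sub1set !inE eqxx orbT.
move=> u w cu cw u0 w0; rewrite -subr_ge0.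
have -> : eps * (dotp u u + dotp w w) - 2 * dotp u w =
    \sum_x (eps * (u x ^+ 2 + w x ^+ 2) - 2 * (u x * w x)).
  rewrite /dotp sumrB -!mulr_sumr big_split /=.
  by congr (_ * (_ + _) - _); apply: eq_bigr => x _; rewrite expr2.
apply: (sum_ge0_classes (e_equiv [set i; j])) => x.
have [U UE] := factor x j cu; have [W WE] := factor x i cw.
have {}WE y : e [set i; j] x y -> w y = W (val y i) by rewrite finset.setUC; apply: WE.
have S g (G : V -> V -> R) : (forall y, e [set i; j] x y -> g y = G (val y i) (val y j)) ->
    \sum_(y | e [set i; j] x y) g y = \sum_(a in values (block_at C (val x) i j) i)
    \sum_(v in values (block_at C (val x) i j) j | block_edge C (val x) i j a v) G a v.
  by move=> gG; rewrite -sum_block //; apply: eq_bigr => y /gG.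
rewrite (S _ (fun a v => eps * (U v ^+ 2 + W a ^+ 2) - 2 * (U v * W a))); last first.
  by move=> y exy; rewrite UE ?WE.
apply: HB.
  by rewrite -(S u) // sum_class.
by rewrite -(S w) // sum_class.
Qed.


Let eps (i j : 'I_n) : R := sq * ((j == ordS i) || (i == ordS j))%:R.

Let adjacent_angle (i j : 'I_n) (F : T -> R) : i != j -> j == ordS i ->
  - (sq * (dotp (dev (e [set i]) F) (dev (e [set i]) F) +
           dotp (dev (e [set j]) F) (dev (e [set j]) F))) <=
  2 * dotp (dev (e [set i]) F) (dev (e [set j]) F).
Proof.
move=> ij /eqP ji; have [s0 s1] := plane_gap R q1; subst j; apply: mean_angle => //.
  by move: sq s0 s1 => s s0 s1; apply/andP; split; lra.
move=> x U W B E _ W0; apply: (plane_pairing U (ltnW q1) r0 _ W0).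
exact: (plane_at H i d2 (gallery_component_sub (valP x))).
Qed.

Let gallery_angle (F : T -> R) (i j : 'I_n) : i != j ->
  - (eps i j * (dotp (dev (e [set i]) F) (dev (e [set i]) F) +
           dotp (dev (e [set j]) F) (dev (e [set j]) F))) <=
  2 * dotp (dev (e [set i]) F) (dev (e [set j]) F).
Proof.
move=> ij; have [s0 s1] := plane_gap R q1; rewrite /eps.
have [ji|ji] := boolP (j == ordS i); first by rewrite mulr1; apply: adjacent_angle.
have [ij'|ij'] := boolP (i == ordS j).
  by rewrite mulr1 dotpC addrC; apply: adjacent_angle; rewrite // eq_sym.
rewrite mulr0; apply: mean_angle => //; first by rewrite lexx ler01.
move=> x U W B E U0 _.
have EPQ y z : E y z = (y \in values B i) && (z \in values B j).
  by apply: (block_edge_product H _ ij (finset.setCK _)).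
have UW := product_pairing W EPQ U0.
rewrite (eq_bigr (fun y => -2 * \sum_(z in values B j | E y z) U z * W y)) => [|y _].
  by rewrite -mulr_sumr UW mulr0.
by rewrite mulr_sumr; apply: eq_bigr => z _; rewrite mul0r sub0r mulNr.
Qed.

(** Only the two cyclic neighbours of [i] contribute. *)
Let eps_row i : \sum_(j | j != i) eps i j <= 1 - (1 - 2 * sq).
Proof.
have [s0 s1] := plane_gap R q1.
apply: (@le_trans _ _ (\sum_j sq * ((j == ordS i)%:R + (i == ordS j)%:R))).
  rewrite [leRHS](bigID (fun j => j != i)) /= -[leLHS]addr0 lerD //.
    apply: ler_sum => j _; rewrite ler_pM2l // -natrD ler_nat.
    by case: (j == _); case: (i == _).
  by apply: sumr_ge0 => j _; rewrite mulr_ge0 ?(ltW s0) // -natrD ler0n.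
have one (f : pred 'I_n) k : f =1 pred1 k -> \sum_j (f j)%:R = 1 :> R.
  by move=> fk; rewrite (bigD1 k) //= fk /= eqxx big1 ?addr0 // => j jk; rewrite fk /= (negPf jk).
rewrite -mulr_sumr big_split /= (one _ (ordS i)) // (one _ (ord_pred i)); first by move: sq => s; lra.
by move=> j /=; rewrite eq_sym; apply/eqP/eqP => [<-|->]; rewrite ?ordSK ?ord_predK.
Qed.

Let gallery_constant (F : T -> R) : (forall i, constant_along (e [set i]) F) -> forall x y, F x = F y.
Proof.
move=> cF; have c00 : c0 \in C0 by rewrite inE connect0.
pose x0 : T := exist _ c0 c00.
suff FE x : F x = F x0 by move=> x y; rewrite !FE.
have := valP x; rewrite inE => /connectP [p].
rewrite -[c0]/(val x0); elim: p (x0) => [|b p IH] y /=; first by move=> _ /val_inj ->.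
case/andP => yb pp lp; have bC0 : b \in C0.
  by have := valP y; rewrite !inE => h; apply: connect_trans h (connect1 yb).
have /and3P[_ _ /existsP [i /andP[_ yb']]] := yb.
by rewrite (cF i y (exist _ b bC0)) //; apply: IH.
Qed.

(* The Poincare inequality for functions of a single vertex of the chamber. *)
Lemma gallery_poincare (h : V -> R) (i j : 'I_n) : i != j -> exists m,
  (1 - 2 * sq) * (\sum_(c in C0) (h (c i) - m) ^+ 2) <= \sum_(c in C0) (h (c i) - h (c j)) ^+ 2.
Proof.
move=> ij; have [s0 s1] := plane_gap R q1.
have c00 : c0 \in C0 by rewrite inE connect0.
have T0 : (0 < #|{: T}|)%N by apply/card_gt0P; exists (exist _ c0 c00).
pose m := (\sum_(x : T) h (val x i)) / #|{: T}|%:R; exists m.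
pose G (x : T) := h (val x i) - m.
have G0 : \sum_x G x = 0.
  rewrite sumrB sumr_const /m -[X in _ - X]mulr_natr divfK ?subrr // pnatr_eq0 -lt0n //.
have gap := @spectral_gap R T 'I_n (fun k => e [set k]) eps (1 - 2 * sq) (fun k => e_equiv _).
have eps_sym k l : eps k l = eps l k by rewrite /eps orbC.
have c1 : 0 < 1 - 2 * sq by rewrite subr_gt0.
have {}gap := gap eps_sym eps_row gallery_angle c1 gallery_constant G G0.
have -> : \sum_(c in C0) (h (c i) - m) ^+ 2 = dotp G G.
  by rewrite -(sum_sig C0 (fun c : chamberType => (h (c i) - m) ^+ 2)); apply: eq_bigr => x _; rewrite expr2.
(* [G] depends only on vertex [i], so only its deviation along [i] is nonzero; that one is compared
   with the function h (c j) - m, which is constant along [i]. *)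
apply: le_trans gap _; rewrite (bigD1 i) //= [X in _ + X]big1 ?addr0 => [|k ki].
  have cG : constant_along (e [set i]) (fun x : T => h (val x j) - m).
    by move=> x y /agree_offP xy; rewrite xy // inE eq_sym.
  apply: le_trans (avg_best (e_equiv _) G cG) _.
  rewrite -(sum_sig C0 (fun c : chamberType => (h (c i) - h (c j)) ^+ 2)).
  by apply: ler_sum => x _; rewrite (_ : G x - _ = h (val x i) - h (val x j)) ?expr2 // /G; ring.
have cG : constant_along (e [set k]) G.
  by move=> x y /agree_offP xy; rewrite /G xy // inE eq_sym.
by apply: big1 => x _; rewrite /dev (avg_id (e_equiv _) cG) subrr mul0r.
Qed.

End Gallery.

(** * Connected components and their energies *)

Lemma link_set0 (V : finType) (Y : {set {set V}}) : link Y finset.set0 = Y.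
Proof.
apply/setP => s; apply/imsetP/idP => [[t]|sY].
  by rewrite inE => /andP[tY _] ->; rewrite finset.setD0.
by exists s; rewrite ?finset.setD0 // inE sY finset.sub0set.
Qed.

Section Components.
Variables (V : finType) (d : nat).
Local Notation n := d.+1.
Local Notation chamberType := {ffun 'I_n -> V}.
Implicit Types (c b : chamberType) (S I : {set 'I_n}) (s t : {set V}).
Variables (R : realType) (q r N : nat) (C : {set chamberType}).
Hypothesis H : chamber_system R q r N C.
Hypothesis d2 : (2 <= d)%N.
Hypothesis q1 : (1 < q)%N.
Hypothesis r0 : (0 < r)%N.
Local Notation K := (chamber_complex C).
Local Notation sq := (Num.sqrt (q%:R : R) / q.+1%:R).

Lemma complex_skelP x y : skel K x y <->
  exists c i j, [/\ c \in C, i != j, x = c i & y = c j].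
Proof.
split=> [/andP[xy /complexP [c cC]]|[c [i [j [cC ij -> ->]]]]].
  rewrite finset.subUset !finset.sub1set => /andP[/imsetP [i _ xi] /imsetP [j _ yj]].
  by exists c, i, j; split=> //; apply: contraNneq xy => e; rewrite xi yj e.
apply/andP; split; first by apply: contra ij => /eqP /(cs_inj H cC) ->.
apply/complexP; exists c => //.
by rewrite finset.subUset !finset.sub1set !imset_f.
Qed.

Lemma complex_skel_at x y i : skel K x y -> exists c j, [/\ c \in C, j != i, x = c i & y = c j].
Proof.
move=> /complex_skelP [c [k [l [cC kl -> ->]]]].
have [c' [c'C e im]] := rotate_onto H i k cC.
have : c l \in [set c' m | m in [set: 'I_n]] by rewrite im imset_f.
case/imsetP => m _ em; exists c', m; split=> //.
apply: contra kl => /eqP mi; apply/eqP/(cs_inj H cC); by rewrite em mi e.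
Qed.

Lemma complex_vertex v : v \in verts K.
Proof.
have [c cC cv] := cs_vertex H v; rewrite inE; apply/complexP; exists c => //.
by rewrite finset.sub1set -cv imset_f.
Qed.

Lemma skel_deg_bound x : (skel_deg K x <= n * N)%N.
Proof.
pose B := [set b in C | b ord0 == x].
apply: (@leq_trans #|finset.setX [set: 'I_n] B|).
  apply: leq_trans (leq_imset_card (fun z : 'I_n * chamberType => z.2 z.1) _).
  apply/subset_leq_card/fintype.subsetP => y; rewrite inE => /(complex_skel_at ord0) [b [i [bC _ xb yb]]].
  by apply/imsetP; exists (i, b); rewrite // !inE /= bC xb eqxx.
by rewrite cardsX cardsT card_ord leq_mul2l (bound_at H) orbT.
Qed.

Section OneComponent.
Variable v : V.
Local Notation Y := (component K v).
Local Notation comp := [set y | connect (skel K) v y].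

Lemma component_cell s : s \in K -> (exists2 x, x \in s & x \in comp) -> s \in Y.
Proof.
move=> sK [x xs]; rewrite !inE in sK * => xv; have sK' : s \in K by rewrite inE.
rewrite sK; apply/fintype.subsetP => y ys; rewrite inE.
have [<-//|xy] := eqVneq x y; apply: connect_trans xv (connect1 _).
rewrite /skel /= xy; apply: (complex_sub sK').
by rewrite finset.subUset !finset.sub1set xs ys.
Qed.

Lemma component_link t : t \in Y -> t != finset.set0 -> link Y t = link K t.
Proof.
rewrite inE => /andP[tK tv] /finset.set0Pn [x xt].
have YK s : (s \in Y) && (t \subset s) = (s \in K) && (t \subset s).
  rewrite [s \in Y]inE andbAC; apply/andP/idP => [[]//|sKt]; split=> //.
  case/andP: sKt => sK ts; have : s \in Y.
    apply: component_cell => //.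
    by exists x; [apply: (fintype.subsetP ts) | apply: (fintype.subsetP tv)].
  by rewrite inE => /andP[].
apply/setP => u; apply/imsetP/imsetP => -[s]; rewrite inE => st ->; exists s => //.
  by rewrite inE -YK.
by rewrite inE YK.
Qed.

Lemma component_pure : pure_complex d Y.
Proof.
split=> [s t|t].
  rewrite inE => /andP[sK sv] ts; rewrite inE (complex_sub sK ts).
  exact: fintype.subset_trans ts sv.
rewrite inE => /andP[tK tv].
have [c [cC tc [x xc xv]]] : exists c, [/\ c \in C, t \subset [set c i | i in [set: 'I_n]] &
    exists2 x, x \in [set c i | i in [set: 'I_n]] & x \in comp].
  have [t0|[x xt]] := finset.set_0Vmem t.
    have [c cC cv] := cs_vertex H v; exists c; split=> //; first by rewrite t0 finset.sub0set.
    by exists v; rewrite ?inE // -cv imset_f.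
  have [c cC tc] := complexP _ _ tK; exists c; split=> //; exists x; last exact: (fintype.subsetP tv).
  exact: (fintype.subsetP tc).
exists [set c i | i in [set: 'I_n]] => //.
rewrite inE card_imset ?cardsT ?card_ord ?eqxx ?andbT; last exact: (cs_inj H).
by apply: component_cell; [apply/complexP; exists c | exists x].
Qed.

Lemma component_verts x : (x \in verts Y) = (x \in comp).
Proof.
rewrite [LHS]inE; apply/idP/idP => [|xv]; first by case/setIdP => _; rewrite finset.sub1set.
apply: component_cell; last by exists x => //; apply: set11.
by have := complex_vertex x; rewrite [_ \in verts K]inE.
Qed.

Lemma component_skel x y : skel Y x y = (x \in comp) && skel K x y.
Proof.
apply/andP/andP => [[xy /setIdP [xyK]]|[xv /andP[xy xyK]]].
  by rewrite finset.subUset !finset.sub1set => /andP[xv _]; rewrite xv /skel /= xy.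
by split=> //; apply: component_cell => //; exists x; rewrite ?set21.
Qed.

Variable c0 : chamberType.
Hypothesis c0C : c0 \in C.
Hypothesis c0v : c0 ord0 = v.
Local Notation C0 := (gallery_component C c0).

Lemma gallery_in_component c i : c \in C0 -> c i \in comp.
Proof.
rewrite [c \in _]inE [c i \in _]inE => /connectP [p].
have same b j k : b \in C -> connect (skel K) (b j) (b k).
  move=> bC; have [->//|jk] := eqVneq j k; apply: connect1.
  by apply/complex_skelP; exists b, j, k.
suff : forall c1, c1 \in C -> path (gallery C finset.set0) c1 p -> c = last c1 p ->
    forall k, connect (skel K) (c1 k) (c i).
  by move=> h pp lp; rewrite -c0v; apply: h c0C pp lp _.
elim: p => [|b p IH] c1 c1C /=; first by move=> _ -> k; apply: same.
case/andP => /and3P[_ bC /existsP [l /andP[_ /agree_offP e]]] pp lp k.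
have [m ml] : exists m : 'I_n, m != l.
  have /card_gt0P [m] : (0 < #|[set~ l]|)%N by rewrite cardsC1 card_ord; apply: ltnW.
  by rewrite !inE; exists m.
apply: connect_trans (same c1 k m c1C) _; rewrite e ?inE //; exact: IH.
Qed.

(** Follow a path of vertices by chambers through its edges: successive chambers share a vertex in
    the same position, hence lie in one gallery component. *)
Lemma component_in_gallery x : x \in comp -> exists c i, c \in C0 /\ x = c i.
Proof.
rewrite inE => /connectP [p].
suff : forall c1 i, c1 \in C0 -> path (skel K) (c1 i) p -> x = last (c1 i) p ->
    exists c j, c \in C0 /\ x = c j.
  by move=> h pp lp; apply: (h c0 ord0); rewrite ?c0v // inE connect0.
elim: p => [|y p IH] c1 i c1C /=; first by move=> _ ->; exists c1, i.
case/andP => /(complex_skel_at i) [b [j [bC ji xb yb]]] pp lp.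
have bC0 : b \in C0.
  apply: (gallery_component_agree H c0C c1C bC (set11 i)) => l; rewrite inE => /eqP ->.
  exact: xb.
by apply: (IH b j); rewrite -?yb.
Qed.

(** An ordered edge occurs at positions [i] and [j] of at most [N] chambers. *)
Lemma gallery_energy (h : V -> R) (i j : 'I_n) : i != j ->
  \sum_(c in C0) (h (c i) - h (c j)) ^+ 2 <= N%:R * energy Y h.
Proof.
move=> ij.
rewrite (partition_big (fun c : chamberType => (c i, c j)) predT) //= /energy.
have E (x y : V) : \sum_(c in C0 | (c i, c j) == (x, y)) (h (c i) - h (c j)) ^+ 2 <=
    if (x \in verts Y) && (y \in verts Y) then N%:R * ((skel Y x y)%:R * (h x - h y) ^+ 2) else 0.
  have [[c]|no] := pselect (exists2 c, c \in C0 & (c i, c j) = (x, y)); last first.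
    rewrite big_pred0 => [|c]; last by apply/andP => -[cC /eqP e]; apply: no; exists c.
    by case: ifP => // _; rewrite mulr_ge0 ?ler0n // mulr_ge0 ?ler0n // sqr_ge0.
  move=> cC0 [xc yc]; have cC := gallery_component_sub c0C cC0.
  rewrite !component_verts -xc -yc !gallery_in_component //=.
  rewrite component_skel gallery_in_component //= (complex_skelP _ _).2 ?mul1r; last by exists c, i, j.
  rewrite (eq_bigr (fun=> (h (c i) - h (c j)) ^+ 2)) => [|b /andP[_ /eqP [-> ->]]] //.
  rewrite sum_const_set ler_wpM2r ?sqr_ge0 // ler_nat.
  apply: leq_trans (bound_at H i (c i)); apply/subset_leq_card/fintype.subsetP => b.
  case/setIdP => bC0 /eqP [e _]; rewrite inE e eqxx andbT.
  exact: (gallery_component_sub c0C).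
apply: (@le_trans _ _ (\sum_(p : V * V) if (p.1 \in verts Y) && (p.2 \in verts Y)
    then N%:R * ((skel Y p.1 p.2)%:R * (h p.1 - h p.2) ^+ 2) else 0)).
  by apply: ler_sum => -[x y] _; apply: E.
rewrite -big_mkcond -(pair_big_dep (fun x => x \in verts Y) (fun _ y => y \in verts Y)
  (fun x y => N%:R * ((skel Y x y)%:R * (h x - h y) ^+ 2))) /=.
by rewrite mulr_sumr; apply: ler_sum => x _; rewrite mulr_sumr.
Qed.

End OneComponent.
End Components.

(** * The uniform bound on second eigenvalues *)

Section Expansion.
Variables (V : finType) (d : nat).
Local Notation n := d.+1.
Local Notation chamberType := {ffun 'I_n -> V}.
Implicit Types (c b : chamberType) (S I : {set 'I_n}) (s t : {set V}).
Variables (R : realType) (q r N : nat) (C : {set chamberType}).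
Hypothesis H : chamber_system R q r N C.
Hypothesis d2 : (2 <= d)%N.
Hypothesis q1 : (1 < q)%N.
Hypothesis r0 : (0 < r)%N.
Local Notation K := (chamber_complex C).
Local Notation sq := (Num.sqrt (q%:R : R) / q.+1%:R).

(* Compares the degree-weighted variance of h over the vertices with the sum
   over chambers c of the squares (h (c i) - m)^2, and each such square with
   (h (c i) - h (c 0))^2 and (h (c 0) - m)^2. *)
Definition component_constant : R := 2 * (n * N)%N%:R ^+ 2 * (1 + (1 - 2 * sq)^-1).

Lemma component_constant_ge1 : (0 < N)%N -> 1 <= component_constant.
Proof.
move=> N0; have [_ s1] := plane_gap R q1.
have A : 1 <= (n * N)%N%:R ^+ 2 :> R by rewrite exprn_ege1 // ler1n muln_gt0.
have B : 0 <= (1 - 2 * sq)^-1 by rewrite invr_ge0 subr_ge0 ltW.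
rewrite /component_constant; move: (_ ^+ 2) (_^-1) A B => x y A B; nra.
Qed.

(** [gallery_poincare] controls the values of [h] at position 0, and the energy controls the passage
    to the other positions; every vertex of the component occurs in some chamber of the gallery
    component. *)
Lemma component_second_eigenvalue v :
  exists2 mu, second_eigenvalue (nadj_mx R (component K v)) mu &
    mu <= 1 - component_constant^-1 / 2.
Proof.
have [c0 c0C c0v] := cs_vertex H v.
have N0 : (0 < N)%N.
  by apply: leq_trans (cs_bound H v); apply/card_gt0P; exists c0; rewrite inE c0C c0v eqxx.
have D1 := component_constant_ge1 N0; have [s0 s1] := plane_gap R q1.
have c00 : c0 \in gallery_component C c0 by rewrite inE connect0.
have n1 : (1 < n)%N by apply: leq_trans d2 _.
pose o : 'I_n := Ordinal n1.
have vertsE x : x \in verts (component K v) <-> exists c i, c \in gallery_component C c0 /\ x = c i.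
  rewrite (component_verts H); split; first exact: (component_in_gallery H c0C c0v).
  by move=> [c [i [cC0 ->]]]; apply: (gallery_in_component H d2 c0C c0v).
have skelE c i j : c \in gallery_component C c0 -> i != j -> skel (component K v) (c i) (c j).
  move=> cC0 ij; rewrite component_skel (gallery_in_component H d2 c0C c0v) //=.
  by apply/(complex_skelP H); exists c, i, j; rewrite (gallery_component_sub c0C cC0).
apply: second_eigenvalue_energy.
- have -> : 2%N = #|[set c0 ord0; c0 o]|.
    by rewrite cards2 (_ : c0 ord0 != c0 o) //; apply/eqP => /(cs_inj H c0C).
  apply/subset_leq_card/fintype.subsetP => x /set2P [] ->; apply/vertsE.
    by exists c0, ord0.
  by exists c0, o.
- move=> x y; rewrite component_skel !(component_verts H) => /andP[xv xy].
  by move: xv; rewrite !inE => h; apply: connect_trans h (connect1 xy).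
- move=> x /vertsE [c [i [cC0 ->]]]; have [j ji] : exists j : 'I_n, j != i.
    by have [->|] := eqVneq i ord0; [exists o | move=> h; exists ord0; rewrite eq_sym].
  by apply/card_gt0P; exists (c j); rewrite inE skelE // eq_sym.
- by rewrite invr_ge0 invf_le1 ?D1 ?andbT; lra.
move=> h; have [m gap] := gallery_poincare H d2 q1 r0 c0C h (isT : ord0 != o).
exists m; set En := energy _ h.
have energyE i j : i != j -> \sum_(c in gallery_component C c0) (h (c i) - h (c j)) ^+ 2 <= N%:R * En.
  exact: (gallery_energy H d2 c0C c0v).
have En0 : 0 <= En by apply: energy_ge0.
have g0 : 0 < 1 - 2 * sq by rewrite subr_gt0.
have {}gap : \sum_(c in gallery_component C c0) (h (c ord0) - m) ^+ 2 <= (1 - 2 * sq)^-1 * (N%:R * En).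
  rewrite -(ler_pM2l g0) (mulVKf (lt0r_neq0 g0)); apply: le_trans gap _; exact: energyE.
have at_i i : \sum_(c in gallery_component C c0) (h (c i) - m) ^+ 2 <=
    2 * (N%:R * En) * (1 + (1 - 2 * sq)^-1).
  apply: (@le_trans _ _ (2 * \sum_(c in gallery_component C c0) (h (c i) - h (c ord0)) ^+ 2 +
      2 * \sum_(c in gallery_component C c0) (h (c ord0) - m) ^+ 2)).
    rewrite !mulr_sumr -big_split; apply: ler_sum => c _ /=.
    have := sqr_ge0 ((h (c i) - h (c ord0)) - (h (c ord0) - m)); nra.
  have A : \sum_(c in gallery_component C c0) (h (c i) - h (c ord0)) ^+ 2 <= N%:R * En.
    have [->|i0] := eqVneq i ord0; last exact: energyE.
    by rewrite big1 ?mulr_ge0 ?ler0n // => c _; rewrite subrr expr0n.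
  rewrite mulrDr mulr1 -!mulrA lerD // ler_pM2l // mulrC; lra.
rewrite mulrC ler_pdivrMr; last by lra.
apply: (@le_trans _ _ ((n * N)%N%:R * \sum_(x in verts (component K v)) (h x - m) ^+ 2)).
  rewrite mulr_sumr; apply: ler_sum => x xY; rewrite ler_wpM2r ?sqr_ge0 // ler_nat.
  apply: leq_trans (skel_deg_bound H x); apply/subset_leq_card/fintype.subsetP => y.
  by rewrite !inE -/(skel _ _ _) component_skel // => /andP[].
have cover : \sum_(x in verts (component K v)) (h x - m) ^+ 2 <=
    \sum_(i < n) \sum_(c in gallery_component C c0) (h (c i) - m) ^+ 2.
  rewrite pair_big_dep /=.
  rewrite [leRHS](partition_big (fun p : 'I_n * chamberType => p.2 p.1) (mem (verts (component K v)))) /=.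
    apply: ler_sum => x /vertsE [c [i [cC0 xE]]].
    rewrite (bigD1 (i, c)) /= ?cC0 ?xE ?eqxx // lerDl.
    by apply: sumr_ge0 => p _; apply: sqr_ge0.
  move=> [i c] /= cC0; have ciY : c i \in verts (component K v) by apply/vertsE; exists c, i.
  exact: ciY.
have {}cover : \sum_(x in verts (component K v)) (h x - m) ^+ 2 <=
    n%:R * (2 * (N%:R * En) * (1 + (1 - 2 * sq)^-1)).
  apply: le_trans cover _; apply: le_trans (ler_sum _ (fun i _ => at_i i)) _.
  by rewrite sumr_const card_ord -[leLHS]mulr_natl.
apply: le_trans (ler_wpM2l (ler0n _ _) cover) _.
rewrite /component_constant natrM.
move: (1 + _) (n%:R : R) (N%:R : R) => x y z.
by rewrite le_eqVlt; apply/orP; left; apply/eqP; ring.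
Qed.

Theorem component_high_dim_expander v :
  high_dim_expander d
    (Num.max (1 - (((n * N)%N%:R * (n * N)%N%:R * 4 ^+ (n * N))^-1 / 2))
       (1 - component_constant^-1 / 2)) (component K v).
Proof.
split=> [|t tY td]; first exact: (component_pure H).
have [t0|t0] := eqVneq t finset.set0.
  rewrite t0 link_set0; have [mu muE mule] := component_second_eigenvalue v.
  by exists mu => //; rewrite le_max mule orbT.
rewrite (component_link tY t0).
have tK : t \in K by case/setIdP: tY.
have [c [S [cC tE cardS]]] := chamber_of_cell H tK.
have /card_gt0P [i0 i0S] : (0 < #|S|)%N by rewrite cardS card_gt0.
have Sd : (#|S| < d)%N by rewrite cardS.
have [mu muE mule] := link_second_eigenvalue H d2 (ltnW q1) r0 cC i0S Sd.
by exists mu; rewrite ?tE // le_max mule.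
Qed.

Lemma connected_component v : skel_connected K -> component K v = K.
Proof.
move=> conn; apply/setP => s; apply/setIdP/idP => [[]//|sK]; split=> //.
by apply/fintype.subsetP => x xs; rewrite inE; apply: conn; apply: (complex_vertex H).
Qed.

End Expansion.

(** * The geodesic power as a chamber system *)

Section PowerComplex.
Variables (R : realType) (d q r : nat) (X : AtildeComplex d q).
Hypothesis d2 : (2 <= d)%N.
Hypothesis r0 : (0 < r)%N.
Hypothesis wide : geodesically_wide X r.
Local Notation F := (At_field X).
Local Notation n := d.+1.
Local Notation V := (At_vertex X).
Local Notation O := (vring F).
Local Notation emb M := (map_mx (val : O -> F) M).
Local Notation D i := (emb (flag_dg F d.+1 r i)).

Implicit Types (c b : {ffun 'I_n -> V}).

Definition chambers : {set {ffun 'I_n -> V}} := [set c | chb r c].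

Let chambersP c : c \in chambers <-> chamber r c.
Proof. by rewrite inE; split=> /asboolP. Qed.

Let chamber_lattice c : c \in chambers -> exists2 W, W \in unitmx & forall i : 'I_n, c i = pr (W *m D i).
Proof. by move=> /chambersP /(chamberP d2 r0 wide). Qed.

Lemma density_gt1 : (1 < q)%N.
Proof. by rewrite -(At_density X) finalg.card_finNzRing_gt1. Qed.

Let block_eq c W (i j : 'I_n) : (forall k : 'I_n, c k = pr (W *m D k)) -> val i = 1%N -> val j = 2%N ->
  block_at chambers c i j = block r d2 W.
Proof.
move=> cW iE jE; apply/setP => b.
have -> : i = widen_ord (d2 : (3 <= n)%N) 1 by apply: val_inj.
have -> : j = widen_ord (d2 : (3 <= n)%N) 2 by apply: val_inj.
rewrite !inE; congr (_ && _); apply/agree_offP/forallP => h k.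
  apply/implyP => ki; apply/implyP => kj; rewrite -cW h // !inE negb_or ki; exact: kj.
rewrite !inE negb_or => /andP[ki kj]; have := h k.
by rewrite ki kj /= cW => /eqP.
Qed.

Lemma plane_of_block c (i j : 'I_n) : c \in chambers -> val i = 1%N -> val j = 2%N ->
  hjelmslev_plane R q r (values (block_at chambers c i j) i) (values (block_at chambers c i j) j)
    (block_edge chambers c i j).
Proof.
move=> cC iE jE; have [W Wu cW] := chamber_lattice cC.
have [A [rho [rho_surj rho_eq0]]] := truncated_ring F r0.
have [X1 [X2 [[X1_eq X2_eq E_dot] [P1 P2]]]] := block_plane d2 r0 wide rho_surj rho_eq0 Wu.
have EE : block_edge chambers c i j = incidence r d2 W.
  apply: funext => x; apply: funext => y.
  rewrite /block_edge (block_eq cW iE jE) /incidence.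
  by apply: eq_existsb => b; congr (_ && ((b _ == _) && (b _ == _))); apply: val_inj.
rewrite EE /values (block_eq cW iE jE).
have -> : i = widen_ord (d2 : (3 <= n)%N) 1 by apply: val_inj.
have -> : j = widen_ord (d2 : (3 <= n)%N) 2 by apply: val_inj.
rewrite P1 P2.
have dX := @plane_degX _ _ _ _ r0 rho_surj rho_eq0 _ _ _ _ X2_eq E_dot.
have dY := @plane_degY _ _ _ _ r0 rho_surj rho_eq0 _ _ _ _ X1_eq E_dot.
have bd := @plane_bound R _ _ _ _ r0 rho_surj rho_eq0 _ _ _ _ X1_eq X2_eq E_dot.
have sp := @plane_spectrum R _ _ _ _ r0 rho_surj rho_eq0 _ _ _ _ X1_eq X2_eq E_dot.
by rewrite (At_density X) in dX dY bd sp.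
Qed.

Lemma chambers_system : chamber_system R q r ((q ^ r) ^ (n * n)) chambers.
Proof.
split.
- by move=> c /chambersP /(chamber_inj d2 r0 wide).
- move=> c /chambersP cc; apply/chambersP => i; have := chamber_rot 1 cc i.
  by rewrite !ffunE.
- move=> c c' i j /chamber_lattice [W Wu cW] /chambersP c'c e0 e.
  have c'0 : c' ord0 = pr W by rewrite -e0 cW flag0 map_mx1 mulmx1.
  have [W' [_ _ _ al]] := chamber_align d2 r0 wide c'c Wu c'0.
  by apply/esym; case: (al j i) => //; rewrite -e cW.
- move=> S c c' S0 cC c'C e.
  have := gallery_connected d2 r0 wide S0 (c := c) (c' := c'); rewrite !finset.in_set in cC c'C.
  move=> /(_ cC c'C e); apply: connect_sub => b b' /and3P[bC b'C /existsP [i /andP[iS bb']]].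
  apply: connect1; rewrite /gallery !finset.in_set bC b'C; apply/existsP; exists i; rewrite iS.
  apply/agree_offP => k; rewrite inE => ki; have /forallP/(_ k) := bb'.
  by rewrite ki => /eqP.
- move=> v; apply: leq_trans (chambers_at_vertex d2 r0 wide v).
  by apply/subset_leq_card/fintype.subsetP => c; rewrite !inE.
- exact: plane_of_block.
(* Being a chamber is a condition on cyclically consecutive positions, and no such pair contains
   both [i] and [j]. *)
- move=> c c' i j /chambersP cc /chambersP c'c ij ji ij' /agree_offP cE; apply/chambersP => k.
  rewrite !ffunE; have [ki|ki] := eqVneq k i.
    subst k; case: eqP => [_|ne]; first exact: c'c.
    rewrite cE; first exact: c'c.
    by rewrite !inE negb_or; apply/andP; split; [apply/eqP | rewrite eq_sym].
  case: eqP => [ke|_]; last exact: cc.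
  rewrite cE; first exact: c'c.
  by rewrite !inE negb_or ki; apply: contra ij' => /eqP <-; rewrite ke.
move=> v; have [W Wu <-] := pr_surj v.
exists [ffun i : 'I_n => pr (W *m D i)]; last by rewrite ffunE flag0 map_mx1 mulmx1.
apply/chambersP; have := chamber_flag d2 r0 wide Wu.
by congr (chamber r _); apply: funext => i; rewrite ffunE.
Qed.

Lemma geodesic_power_chambers : geodesic_power X r = chamber_complex chambers.
Proof.
apply/setP => t; rewrite !inE; apply/asboolP/existsP => [[s [f [f_inj sE fc]] ts]|[c /andP[/chambersP cc tc]]].
  exists [ffun i => f i]; apply/andP; split.
    by apply/chambersP => i; rewrite !ffunE; apply: fc.
  rewrite sE in ts; apply: fintype.subset_trans ts _; apply/fintype.subsetP => x /imsetP [i _ ->].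
  by apply/imsetP; exists i; rewrite ?ffunE.
exists [set c i | i in [set: 'I_n]] => //; exists c; split.
- exact: (chamber_inj d2 r0 wide cc).
- by apply/setP => x; apply/imsetP/imsetP => -[i _ ->]; exists i.
- exact: cc.
Qed.

End PowerComplex.

Theorem mainTheorem1 (R : realType) (d q r : nat) (hd : (2 <= d)%N)
    (hr : (0 < r)%N) :
  (forall X : AtildeComplex d q, geodesically_wide X r ->
   forall t, t \in faces (geodesic_power X r) (d - 2) ->
     let Y := link (geodesic_power X r) t in
     complete_bipartite Y \/
     (expander (q.+1 * q ^ r.-1) (Num.sqrt (q%:R : R) / q.+1%:R) Y /\
      (forall a : R, eigenvalue (adj_mx R Y) a <-> power_link_spectrum q r a)))
  /\
  (exists2 lam : R, lam < 1 &
   forall X : AtildeComplex d q, geodesically_wide X r ->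
     (skel_connected (geodesic_power X r) ->
        high_dim_expander d lam (geodesic_power X r)) /\
     (forall v, high_dim_expander d lam (component (geodesic_power X r) v))).
Proof.
have d2 : (2 <= d)%N := hd.
split=> [X wide t|].
  rewrite (geodesic_power_chambers d2 hr wide).
  have q0 : (0 < q)%N := ltnW (density_gt1 X).
  exact: (codimension_two_links (chambers_system R d2 hr wide) d2 q0 hr).
(* A residue field has at least two elements, so for q <= 1 there is no complex and any [lam] below
   1 will do. *)
have [q1|q1] := leqP q 1.
  by exists 0 => // X; have := density_gt1 X; rewrite ltnNge q1.
set N := ((q ^ r) ^ (d.+1 * d.+1))%N.
have N0 : (0 < N)%N by rewrite !expn_gt0 (ltnW q1).
(* Both entries depend only on [d], [q] and [r]: the first serves the links of nonempty cells, the
   second the component itself. *)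
exists (Num.max (1 - (((d.+1 * N)%N%:R * (d.+1 * N)%N%:R * 4 ^+ (d.+1 * N))^-1 / 2))
    (1 - (component_constant d R q N)^-1 / 2)).
  have D0 := lt_le_trans ltr01 (component_constant_ge1 d R q1 N0).
  rewrite gt_max !gtrBl (divr_gt0 _ (ltr0Sn R 1)) ?(divr_gt0 _ (ltr0Sn R 1)) ?invr_gt0 //.
  by rewrite !mulr_gt0 ?exprn_gt0 ?ltr0n ?muln_gt0.
move=> X wide; rewrite (geodesic_power_chambers d2 hr wide).
have H := chambers_system R d2 hr wide.
split=> [conn|v]; last exact: (component_high_dim_expander H d2 q1 hr).
have [v _] : exists v : At_vertex X, true by exists (pr 1%:M).
by rewrite -(connected_component H v conn); apply: (component_high_dim_expander H d2 q1 hr).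
Qed.
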